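(* Let $T$ be the complete $L_{\mathrm{Pres}}$-theory of a regular ordered abelian group, $\mathfrak U$ a monster model, and $p,q$ invariant global types in possibly infinitely (but small) many variables. Then $p\geq_{\mathrm D}q$ if and only if (1) $\mathcal H(p)\supseteq\mathcal H(q)$, and (2) for every prime $\mathfrak p$, $\kappa_{\mathfrak p}(p)\geq\kappa_{\mathfrak p}(q)$. Hence the $\sim_{\mathrm D}$-class of $q$ is determined by $\mathcal H(q)$ and the function $\mathfrak p\mapsto\kappa_{\mathfrak p}(q)$.
   Context: $L_{\mathrm{Pres}}=\{+,0,-,<,1,\equiv_n\ (n\in\omega)\}$, $1$ the least positive element if the group is discrete and $0$ otherwise, $\equiv_n$ congruence modulo $n$; an ordered abelian group is regular if it eliminates quantifiers in $L_{\mathrm{Pres}}$. A global type $p$ is invariant if for some small $A\subseteq\mathfrak U$, $d\equiv_A d'$ implies ($\varphi(x,d)\in p\iff\varphi(x,d')\in p$). $p\geq_{\mathrm D}q$ iff there are a small $A$ and a complete type $r(x,y)$ over $A$ extending $(p\restriction A)(x)\cup(q\restriction A)(y)$ with $p(x)\cup r(x,y)\vdash q(y)$; $\sim_{\mathrm D}$ is the induced equivalence. For $c\models q$ (in a bigger monster), $\langle\mathfrak U c\rangle$ is the group generated by $\mathfrak U\cup c$; $\mathcal H(q)$ is the set of (cuts of) convex subgroups $H$ of $\mathfrak U$ such that some element of $\langle\mathfrak U c\rangle$ fills the cut of $H$, i.e. is greater than every element of $H$ and smaller than every element of $\mathfrak U$ greater than $H$. For a prime $\mathfrak p$, $\kappa_{\mathfrak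 p}(q)=\dim_{\mathbb F_{\mathfrak p}}\bigl((D/\mathfrak pD)/(\mathfrak U/\mathfrak p\mathfrak U)\bigr)$ where $D=\mathrm{dcl}(\mathfrak U c)$. These do not depend on the choice of $c$. *)

(* Defs.v *)
From HB Require Import structures.
From mathcomp Require Import all_boot all_order all_algebra.
From mathcomp Require Import boolp classical_sets functions cardinality.

Set Implicit Arguments.
Unset Strict Implicit.
Unset Printing Implicit Defensive.

Import Order.TTheory GRing.Theory Num.Theory.

Local Open Scope classical_set_scope.
Local Open Scope card_scope.
Local Open Scope ring_scope.

HB.mixin Record POrderedZmodule_isOAG U of Num.POrderedZmodule U := {
  oag_total : total (<=%R : rel U);
  oag_lerD2l : forall z x y : U, x <= y -> z + x <= z + y
}.

#[short(type="oagType")]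
HB.structure Definition OAG :=
  { U of Num.POrderedZmodule U & POrderedZmodule_isOAG U }.

(* The intended interpretation of the constant 1 of L_Pres. *)
Definition oag_one (U : oagType) : U :=
  xget 0 [set x | 0 < x /\ forall y : U, 0 < y -> x <= y].

Definition oag_cong (U : oagType) (n : nat) (x y : U) : Prop :=
  exists z : U, x - y = z *+ n.

Definition copair {I J X : Type} (f : I -> X) (g : J -> X) (v : I + J) : X :=
  match v with inl i => f i | inr j => g j end.

(* Syntax of L_Pres. [formula V] is the type of formulas whose free variables
   lie in the (arbitrary, possibly infinite) type V; under a quantifier, [None]
   is the bound variable.  L_Pres(A)-formulas in the variables (x_i)_(i : I) are
   represented as [formula (I + A)], parameters being read as variables that
   have a prescribed value. *)
Inductive term (V : Type) : Type :=
| tVar of V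
| tZero
| tOne
| tAdd of term V & term V
| tOpp of term V.

Inductive formula (V : Type) : Type :=
| fEq of term V & term V
| fLt of term V & term V
| fCong of nat & term V & term V
| fNot of formula V
| fAnd of formula V & formula V
| fEx of formula (option V).

Fixpoint term_rename V W (f : V -> W) (t : term V) : term W :=
  match t with
  | tVar v => tVar (f v)
  | tZero => tZero W
  | tOne => tOne W
  | tAdd t1 t2 => tAdd (term_rename f t1) (term_rename f t2)
  | tOpp t1 => tOpp (term_rename f t1)
  end.

Fixpoint rename V W (f : V -> W) (phi : formula V) : formula W :=
  match phi with
  | fEq t1 t2 => fEq (term_rename f t1) (term_rename f t2)
  | fLt t1 t2 => fLt (term_rename f t1) (term_rename f t2)
  | fCong n t1 t2 => fCong n (term_rename f t1) (term_rename f t2)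
  | fNot phi1 => fNot (rename f phi1)
  | fAnd phi1 phi2 => fAnd (rename f phi1) (rename f phi2)
  | fEx phi1 => fEx (rename (omap f) phi1)
  end.

Fixpoint qf V (phi : formula V) : Prop :=
  match phi with
  | fNot phi1 => qf phi1
  | fAnd phi1 phi2 => qf phi1 /\ qf phi2
  | fEx _ => False
  | _ => True
  end.

(* An ordered abelian group is always considered with its canonical
   L_Pres-structure.  Since that structure is axiomatised by first-order
   sentences, the models of the L_Pres-theory of an ordered abelian group are
   again ordered abelian groups with their canonical L_Pres-structures. *)
Fixpoint teval (U : oagType) V (e : V -> U) (t : term V) : U :=
  match t with
  | tVar v => e v
  | tZero => 0
  | tOne => oag_one U
  | tAdd t1 t2 => teval e t1 + teval e t2
  | tOpp t1 => - teval e t1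
  end.

Fixpoint sat (U : oagType) V (e : V -> U) (phi : formula V) : Prop :=
  match phi with
  | fEq t1 t2 => teval e t1 = teval e t2
  | fLt t1 t2 => teval e t1 < teval e t2
  | fCong n t1 t2 => oag_cong n (teval e t1) (teval e t2)
  | fNot phi1 => ~ sat e phi1
  | fAnd phi1 phi2 => sat e phi1 /\ sat e phi2
  | fEx phi1 =>
      exists x : U, sat (fun v => if v is Some w then e w else x) phi1
  end.

Definition theory (U : oagType) : set (formula void) :=
  [set phi | sat (of_void U) phi].

Definition models (T : set (formula void)) (U : oagType) : Prop :=
  forall phi, T phi -> sat (of_void U) phi.

Definition regular_oag (G : oagType) : Prop :=
  forall n (phi : formula 'I_n), exists psi : formula 'I_n,
    qf psi /\ forall e : 'I_n -> G, sat e phi <-> sat e psi.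

Definition lpres_embedding (U N : oagType) (f : U -> N) : Prop :=
  [/\ {morph f : x y / x + y}, f 0 = 0, {morph f : x / - x} &
      [/\ {mono f : x y / x < y}, f (oag_one U) = oag_one N &
          forall n x y, oag_cong n (f x) (f y) <-> oag_cong n x y]].

Definition lpres_automorphism (U : oagType) (f : U -> U) : Prop :=
  bijective f /\ lpres_embedding f.

Definition elementary (U N : oagType) (j : U -> N) : Prop :=
  forall n (phi : formula 'I_n) (e : 'I_n -> U),
    sat e phi <-> sat (j \o e) phi.

Definition realizes (U : oagType) V P (c : V -> U) (a : P -> U)
    (r : set (formula (V + P))) : Prop :=
  forall phi, r phi -> sat (copair c a) phi.

(* Complete V-types over the parameters [a : P -> U], i.e. sets of formulas that
   are maximal among those finitely satisfiable in U. *)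
Definition complete_type (U : oagType) V P (a : P -> U)
    (r : set (formula (V + P))) : Prop :=
  (forall n (s : 'I_n -> formula (V + P)), (forall i, r (s i)) ->
     exists c : V -> U, forall i, sat (copair c a) (s i)) /\
  (forall phi, r phi \/ r (fNot phi)).

Definition global_type (U : oagType) V (p : set (formula (V + U))) : Prop :=
  complete_type (id : U -> U) p.

(* [small K A] is |A| < |K|. *)
Definition small (K : Type) X (A : set X) : Prop :=
  A #<= [set: K] /\ ~ ([set: K] #<= A).

Definition saturated (K : Type) (U : oagType) : Prop :=
  forall (A : set U) n (r : set (formula ('I_n + A))), small K A ->
    complete_type (val : A -> U) r ->
    exists c : 'I_n -> U, realizes c (val : A -> U) r.

Definition strongly_homogeneous (K : Type) (U : oagType) : Prop :=
  forall (A : set U) (f : A -> U), small K A ->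
    (forall phi : formula A, sat (val : A -> U) phi <-> sat f phi) ->
    exists s : U -> U,
      lpres_automorphism s /\ forall a : A, s (val a) = f a.

Definition strong_limit (K : Type) : Prop :=
  forall S : Type, small K [set: S] -> small K [set: set S].

Definition monster (K : Type) (T : set (formula void)) (U : oagType) : Prop :=
  [/\ models T U, small K [set: nat], strong_limit K,
      saturated K U & strongly_homogeneous K U].

Section Types.
Variable U : oagType.

(* phi(x, w) |-> phi(x, d) *)
Definition inst I P (d : P -> U) (phi : formula (I + P)) : formula (I + U) :=
  rename (copair inl (inr \o d)) phi.

Definition same_type (A : set U) n (d d' : 'I_n -> U) : Prop :=
  forall phi : formula ('I_n + A),
    sat (copair d (val : A -> U)) phi <-> sat (copair d' (val : A -> U)) phi.

Definition invariant_type (K : Type) I (p : set (formula (I + U))) : Prop :=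
  exists A : set U, small K A /\
    forall n (phi : formula (I + 'I_n)) (d d' : 'I_n -> U),
      same_type A d d' -> (p (inst d phi) <-> p (inst d' phi)).

Definition restrict I (A : set U) (p : set (formula (I + U))) :
    set (formula (I + A)) :=
  [set phi | p (inst (val : A -> U) phi)].
Arguments restrict {I} A p _.

Definition in_x I J P (phi : formula (I + P)) : formula ((I + J) + P) :=
  rename (copair (inl \o inl) inr) phi.

Definition in_y I J P (phi : formula (J + P)) : formula ((I + J) + P) :=
  rename (copair (inl \o inr) inr) phi.

(* The parameters in V are treated as new constants. *)
Definition entails (T : set (formula void)) V (S : set (formula V))
    (phi : formula V) : Prop :=
  forall (M : oagType) (e : V -> M), models T M ->
    (forall psi, S psi -> sat e psi) -> sat e phi.

Definition dominates (K : Type) (T : set (formula void)) I J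
    (p : set (formula (I + U))) (q : set (formula (J + U))) : Prop :=
  exists (A : set U) (r : set (formula ((I + J) + A))),
    [/\ small K A, complete_type (val : A -> U) r,
        @in_x I J A @` restrict A p `<=` r,
        @in_y I J A @` restrict A q `<=` r &
        forall phi, q phi ->
          entails T (@in_x I J U @` p `|` inst (val : A -> U) @` r)
            (@in_y I J U phi)].

Definition dom_equiv (K : Type) (T : set (formula void)) I J
    (p : set (formula (I + U))) (q : set (formula (J + U))) : Prop :=
  dominates K T p q /\ dominates K T q p.

Definition is_subgroup (H : set U) : Prop :=
  [/\ H 0, forall x y, H x -> H y -> H (x + y) & forall x, H x -> H (- x)].

Definition convex_subgroup (H : set U) : Prop :=
  is_subgroup H /\ forall x y z, H x -> H z -> x <= y -> y <= z -> H y.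

Definition generated (S : set U) : set U := smallest is_subgroup S.

Definition dcl (S : set U) : set U :=
  [set d | exists n (phi : formula (option 'I_n)) (b : 'I_n -> U),
     (forall i, S (b i)) /\
     forall x, sat (fun v => if v is Some i then b i else x) phi <-> x = d].

(* B is a set of representatives of an F_pr-basis of (D/pr D)/(W/pr W), that is
   of D/(W + pr D), for subgroups W of D.  Scalars in F_pr are represented by
   integers, and elements of B are automatically pairwise incongruent. *)
Definition quotient_basis (pr : nat) (D W B : set U) : Prop :=
  [/\ B `<=` D,
      forall d, D d -> exists (s : seq U) (k : U -> int) (w d' : U),
        [/\ [set` s] `<=` B, W w, D d' &
            d = \sum_(b <- s) b *~ k b + w + d' *+ pr] &
      forall (s : seq U) (k : U -> int) (w d' : U),
        uniq s -> [set` s] `<=` B -> W w -> D d' ->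
        \sum_(b <- s) b *~ k b = w + d' *+ pr ->
        forall b, b \in s -> (pr%:Z %| k b)%Z].

End Types.

Section Invariants.
Variables (U N : oagType) (j : U -> N) (I : Type) (c : I -> N).

Definition calH : set (set U) :=
  [set H | convex_subgroup H /\
     exists g : N, [/\ generated (range j `|` range c) g,
       forall h, H h -> j h < g &
       forall u, (forall h, H h -> h < u) -> g < j u]].

(* A chosen basis: the cardinal kappa_pr is the cardinality of this set. *)
Definition kappa (pr : nat) : set N :=
  xget set0
    [set B | quotient_basis pr (dcl (range j `|` range c)) (range j) B].

End Invariants.

(* Main.v *)
(** By quantifier elimination the type of a tuple over a model is given by the
    cuts and the residues of its linear forms.

    If p dominates q through r, let (c, d) realize p, q and r in an elementary
    extension.  An element of <U d> filling a convex subgroup H which no element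
    of <U c> fills can be moved inside the cut of H without affecting r, unless
    H or its upper part has a small cofinal or coinitial set; saturation excludes
    this.  Similarly every element of dcl(U d) is congruent modulo a prime pr to
    an element of dcl(U c), since otherwise it could be moved into a residue
    class of U; the exchange lemma then compares the dimensions.

    Conversely, up to a multiple, a translation and a sign, an invariant cut is
    the cut of a convex subgroup, and one of its two sides is determined by a
    small set A.  So r need only say, for each form of d, on which side of a form
    of c filling the same subgroup it lies, and that a basis of D/(U + pr D), for
    D = dcl(U d), is congruent to its image under an injection sigma into such a
    basis for c, modulo all powers of pr.  A finite part of this is satisfied by a
    realization c' in U of finitely many formulas of p and by d + delta, where
    delta is an infinitesimal realization, modulo some m, of the homomorphism
    mapping each basis element b to s_b - b, with s_b the copy of sigma(b) in
    U. *)
Require Import Defs.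
From HB Require Import structures.
From mathcomp Require Import all_boot all_order all_algebra.
From mathcomp Require Import boolp classical_sets functions cardinality.
From mathcomp Require Import generic_quotient ring_quotient filter.
From mathcomp Require Import ring zify.

Set Implicit Arguments.
Unset Strict Implicit.
Unset Printing Implicit Defensive.

Import Order.TTheory GRing.Theory Num.Theory.

Local Open Scope classical_set_scope.
Local Open Scope card_scope.
Local Open Scope ring_scope.

(** * Linear arithmetic in ordered abelian groups *)

Inductive zexp : Type :=
| ZA of nat
| Z0
| ZD of zexp & zexp
| ZN of zexp
| ZM of zexp & int
| ZMn of zexp & nat.

Fixpoint zeval (U : zmodType) (env : seq U) (e : zexp) : U :=
  match e with
  | ZA i => nth 0 env i
  | Z0 => 0
  | ZD a b => zeval env a + zeval env b
  | ZN a => - zeval env a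
  | ZM a k => zeval env a *~ k
  | ZMn a n => zeval env a *+ n
  end.

Fixpoint zcoef (i : nat) (e : zexp) : int :=
  match e with
  | ZA j => if eqn i j then 1 else 0
  | Z0 => 0
  | ZD a b => zcoef i a + zcoef i b
  | ZN a => - zcoef i a
  | ZM a k => zcoef i a * k
  | ZMn a n => zcoef i a * n%:Z
  end.

Fixpoint zsame (n : nat) (a b : zexp) : Prop :=
  match n with
  | O => True
  | S n => zcoef n a = zcoef n b /\ zsame n a b
  end.

Fixpoint zbound (n : nat) (e : zexp) : bool :=
  match e with
  | ZA j => (j < n)%N
  | Z0 => true
  | ZD a b => zbound n a && zbound n b
  | ZN a | ZM a _ | ZMn a _ => zbound n a
  end.

Lemma zevalE (U : zmodType) (env : seq U) e : zbound (size env) e ->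
  zeval env e = \sum_(i < size env) nth 0 env i *~ zcoef i e.
Proof.
elim: e => [j|| a IHa b IHb | a IHa | a IHa k | a IHa n] /= ltj.
- rewrite (bigD1 (Ordinal ltj)) //= -/(eqn j j).
  have -> : eqn j j by rewrite eqnE eqxx.
  rewrite mulr1z big1 ?addr0 // => i; rewrite -val_eqE /= => /negPf ij.
  by have -> : eqn i j = false by rewrite eqnE ij.
- by rewrite big1 // => i _; exact: mulr0z.
- case/andP: ltj => ? ?; rewrite IHa // IHb // -big_split.
  by apply: eq_bigr => i _; rewrite mulrzDr.
- by rewrite IHa // -sumrN; apply: eq_bigr => i _; rewrite mulrNz.
- by rewrite IHa // mulrz_suml; apply: eq_bigr => i _; rewrite mulrzA.
- by rewrite IHa // -sumrMnl; apply: eq_bigr => i _; rewrite mulrzA pmulrn.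
Qed.

Lemma zsameP (U : zmodType) (env : seq U) a b :
  zbound (size env) a && zbound (size env) b -> zsame (size env) a b ->
  zeval env a = zeval env b.
Proof.
move=> /andP[ha hb] hs; rewrite !zevalE //; apply: eq_bigr => -[i lti] _ /=.
suff -> : zcoef i a = zcoef i b by [].
elim: (size env) lti hs => // n IH; rewrite ltnS leq_eqVlt => /orP[/eqP->|lti] /= [] //.
by move=> _; exact: IH.
Qed.

Ltac zsame_atom x y :=
  first [ constr_eq x y
        | lazymatch x with
          | @bigop.body _ _ _ _ _ => lazymatch y with @bigop.body _ _ _ _ _ => unify x y end
          | ?f _ => lazymatch y with ?g _ => constr_eq f g; unify x y end
          end ].
Ltac zatom x env :=
  lazymatch env with
  | nil => constr:(@None nat)
  | cons ?y ?env' =>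
    match constr:(Set) with
    | _ => let _ := match constr:(Set) with _ => zsame_atom x y end in constr:(Some O)
    | _ => let r := zatom x env' in
           lazymatch r with Some ?n => constr:(Some (S n)) | None => constr:(@None nat) end
    end
  end.
Ltac zadd x env :=
  let r := zatom x env in
  lazymatch r with Some _ => env | None => 
    let rec app e := lazymatch e with
      | @nil ?T => constr:(@cons T x (@nil T)) | @cons ?T ?y ?e' => let e'' := app e' in constr:(@cons T y e'') end
    in app env end.
Ltac zcollect t env :=
  lazymatch t with
  | (?a + ?b)%R => let env := zcollect a env in zcollect b env
  | (- ?a)%R => zcollect a env
  | (0)%R => env
  | (?a *~ _)%R => zcollect a env
  | (?a *+ _)%R => zcollect a env
  | _ => zadd t env
  end.
Ltac zreify t env :=
  lazymatch t with
  | (?a + ?b)%R => let a := zreify a env in let b := zreify b env in constr:(ZD a b)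
  | (- ?a)%R => let a := zreify a env in constr:(ZN a)
  | (0)%R => constr:(Z0)
  | (?a *~ ?k)%R => let a := zreify a env in constr:(ZM a k)
  | (?a *+ ?n)%R => let a := zreify a env in constr:(ZMn a n)
  | _ => let r := zatom t env in lazymatch r with Some ?n => constr:(ZA n) end
  end.
Ltac zabel :=
  lazymatch goal with
  | |- @eq ?T ?a ?b =>
    let env := zcollect a (@nil T) in
    let env := zcollect b env in
    let ea := zreify a env in
    let eb := zreify b env in
    apply: (@zsameP _ env ea eb (erefl true));
    cbn [zsame size zcoef eqn]; repeat split; first [by [] | ring | lia | nia]
  end.

Section OAG.
Variable U : oagType.
Implicit Types x y z a b : U.

Lemma ole_add2l z x y : (z + x <= z + y) = (x <= y).
Proof.
apply/idP/idP => [h|]; last by apply: oag_lerD2l.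
by have := oag_lerD2l (- z) _ _ h; rewrite !addKr.
Qed.

Lemma olt_add2l z x y : (z + x < z + y) = (x < y).
Proof. by rewrite !lt_neqAle ole_add2l (inj_eq (addrI z)). Qed.

Lemma ole_sub x y : (x <= y) = (0 <= y - x).
Proof. by rewrite -(ole_add2l (- x)) addNr addrC. Qed.

Lemma olt_sub x y : (x < y) = (0 < y - x).
Proof. by rewrite -(olt_add2l (- x)) addNr addrC. Qed.

Lemma ole_total x y : (x <= y) || (y <= x).
Proof. exact: oag_total. Qed.

Lemma oltNge x y : (x < y) = ~~ (y <= x).
Proof.
have := ole_total x y; rewrite lt_neqAle; case: (eqVneq x y) => [->|nxy] /=.
  by rewrite lexx.
case: (boolP (x <= y)) => /= [xy _|_ ->] //.
by apply/esym/negP => yx; move: nxy; rewrite (@le_anti _ _ x y) ?xy ?yx // eqxx.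
Qed.

Lemma oleNgt x y : (x <= y) = ~~ (y < x).
Proof. by rewrite oltNge negbK. Qed.

Lemma otrichotomy x y : [\/ x < y, x = y | y < x].
Proof.
have [->|nxy] := eqVneq x y; first by constructor 2.
case: (boolP (x < y)) => [?|]; first by constructor 1.
by rewrite -oleNgt le_eqVlt eq_sym (negPf nxy) => ?; constructor 3.
Qed.

Definition nn (s : bool) x : bool := if s then 0 < x else 0 <= x.

Lemma nnW s x : nn s x -> 0 <= x.
Proof. by case: s => //; exact: ltW. Qed.

Lemma nnD s t x y : nn s x -> nn t y -> nn (s || t) (x + y).
Proof.
have A a b : 0 <= a -> 0 <= b -> 0 <= a + b.
  by move=> ha hb; apply: le_trans ha _; rewrite -{1}(addr0 a) ole_add2l.
have B a b : 0 < a -> 0 <= b -> 0 < a + b.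
  by move=> ha hb; apply: lt_le_trans ha _; rewrite -{1}(addr0 a) ole_add2l.
case: s t => [] [] /= hx hy.
- exact: B (ltW _).
- exact: B.
- by rewrite addrC; exact: B.
- exact: A.
Qed.

Lemma nnM s n x : nn s x -> nn (s && (0 < n)%N) (x *+ n).
Proof.
move=> h; have hw : 0 <= x *+ n.
  elim: n => [|n IH]; first by rewrite mulr0n lexx.
  by rewrite mulrS; exact: (@nnD false false _ _ (nnW h) IH).
case: s h => //; case: n hw => //= n _ h.
rewrite mulrS; apply: (@nnD true false) => //.
elim: n => [|n IH]; first by rewrite mulr0n /nn lexx.
by rewrite mulrS; exact: (@nnD false false _ _ (ltW h) IH).
Qed.

Lemma nn_lt x y : x < y -> nn true (y - x). Proof. by rewrite olt_sub. Qed.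
Lemma nn_le x y : x <= y -> nn false (y - x). Proof. by rewrite ole_sub. Qed.

Lemma lt_nn x y z : nn true z -> y - x = z -> x < y.
Proof. by move=> h e; rewrite olt_sub e. Qed.
Lemma le_nn s x y z : nn s z -> y - x = z -> x <= y.
Proof. by move=> h e; rewrite ole_sub e; exact: nnW h. Qed.

Lemma omulrn_gt0 n x : (0 < n)%N -> (0 < x *+ n) = (0 < x).
Proof.
move=> n0; apply/idP/idP => [h|h]; last by move: (@nnM true n _ h); rewrite n0.
rewrite oltNge; apply/negP => x0.
have : nn false ((0 - x) *+ n) by have := @nnM false n _ (nn_le x0).
rewrite /= sub0r mulNrn => h'.
have := @nnD true false _ _ h h'; rewrite /= subrr ltxx //.
Qed.

Lemma omulrn_eq0 n x : (0 < n)%N -> (x *+ n == 0) = (x == 0).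
Proof.
move=> n0; apply/eqP/eqP => [h|->]; last by rewrite mul0rn.
case: (otrichotomy 0 x) => // h'.
- by have := h'; rewrite -(omulrn_gt0 _ n0) h ltxx.
- have : 0 < - x by rewrite -sub0r -olt_sub.
  by rewrite -(omulrn_gt0 _ n0) mulNrn h oppr0 ltxx.
Qed.

Lemma omulrn_ge0 n x : (0 < n)%N -> (0 <= x *+ n) = (0 <= x).
Proof. by move=> n0; rewrite !le_eqVlt ![0 == _]eq_sym omulrn_gt0 // omulrn_eq0. Qed.

Lemma omulrnI n x y : (0 < n)%N -> x *+ n = y *+ n -> x = y.
Proof.
move=> n0 h; apply/eqP; rewrite -subr_eq0 -(omulrn_eq0 _ n0) mulrnBl h subrr //.
Qed.

Lemma lt_nnM n x y z : (0 < n)%N -> nn true z -> (y - x) *+ n = z -> x < y.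
Proof. by move=> n0 h e; rewrite olt_sub -(omulrn_gt0 _ n0) e. Qed.
Lemma le_nnM n s x y z : (0 < n)%N -> nn s z -> (y - x) *+ n = z -> x <= y.
Proof. by move=> n0 h e; rewrite ole_sub -(omulrn_ge0 _ n0) e; exact: nnW h. Qed.

End OAG.

Definition scaled (P : Prop) (n : nat) (h : P) := h.

Ltac nnof h :=
  lazymatch h with
  | pair ?h1 ?h2 => let a := nnof h1 in let b := nnof h2 in constr:(nnD a b)
  | @scaled _ ?n ?h => let a := nnof h in constr:(nnM n a)
  | _ => let T := type of h in
    lazymatch T with
    | is_true (_ < _)%R => constr:(nn_lt h)
    | is_true (_ <= _)%R => constr:(nn_le h)
    | _ => h
    end
  end.
(* [h] is a tuple of inequalities whose sum is the goal; its first component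
   has to be strict when the goal is. *)
Ltac olin h :=
  let H := nnof h in
  lazymatch goal with
  | |- is_true (_ < _)%R => apply: (lt_nn H); zabel
  | |- is_true (_ <= _)%R => apply: (le_nn H); zabel
  | |- False => let E := fresh in
     have E : nn true _ := H; 
     move: E; rewrite /nn /=; 
     lazymatch goal with |- is_true (0 < ?x)%R -> False =>
       let E' := fresh in assert (E' : x = 0) by zabel; rewrite E' ltxx; done end
  end.
(* As [olin], after multiplying the goal by [n > 0]. *)
Ltac olinM n h :=
  let H := nnof h in
  lazymatch goal with
  | |- is_true (_ < _)%R => apply: (@lt_nnM _ n _ _ _ _ H); [|zabel]
  | |- is_true (_ <= _)%R => apply: (@le_nnM _ n _ _ _ _ _ H); [|zabel]
  end; try done.

(** * Formulas *)

Lemma term_eval_rename (U : oagType) (V W : Type) (f : V -> W) (e : W -> U) (t : term V) :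
  teval e (term_rename f t) = teval (e \o f) t.
Proof. by elim: t => //= [t1 -> t2 ->|t ->]. Qed.

Lemma sat_rename (U : oagType) (V W : Type) (f : V -> W) (e : W -> U) (phi : formula V) :
  sat e (rename f phi) = sat (e \o f) phi.
Proof.
elim: phi W f e => //= [V1 t t'|V1 t t'|V1 n t t'|V1 phi IH|V1 phi IH psi IH'|V1 phi IH] W f e.
- by rewrite !term_eval_rename.
- by rewrite !term_eval_rename.
- by rewrite !term_eval_rename.
- by rewrite IH.
- by rewrite IH IH'.
- congr (exists x, _); apply/funext => x; rewrite IH; congr (sat _ _).
  by apply/funext => -[].
Qed.

Fixpoint term_vars (V : Type) (t : term V) : seq V :=
  match t with
  | tVar v => [:: v]
  | tZero | tOne => [::]
  | tAdd t1 t2 => term_vars t1 ++ term_vars t2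
  | tOpp t1 => term_vars t1
  end.

Fixpoint free_vars (V : Type) (phi : formula V) : seq V :=
  match phi with
  | fEq t1 t2 | fLt t1 t2 | fCong _ t1 t2 => term_vars t1 ++ term_vars t2
  | fNot phi1 => free_vars phi1
  | fAnd phi1 phi2 => free_vars phi1 ++ free_vars phi2
  | fEx phi1 => pmap id (free_vars phi1)
  end.

Lemma In_cat T (x : T) s t : List.In x (s ++ t) <-> List.In x s \/ List.In x t.
Proof. exact: List.in_app_iff. Qed.

Lemma In_pmap_id T (x : T) s : List.In (Some x) s -> List.In x (pmap id s).
Proof.
elim: s => // -[y|] s IH /=; last by case=> // h; exact: IH.
by case=> [[->]|h]; [left|right; exact: IH].
Qed.

Lemma term_eval_ext (U : oagType) (V : Type) (e e' : V -> U) (t : term V) :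
  (forall v, List.In v (term_vars t) -> e v = e' v) -> teval e t = teval e' t.
Proof.
elim: t => //= [v h|t1 IH t2 IH' h|t IH h]; first by apply: h; left.
- by rewrite IH ?IH' // => v hv; apply: h; apply/In_cat; [right|left].
- by rewrite IH.
Qed.

Lemma sat_ext (U : oagType) (V : Type) (e e' : V -> U) (phi : formula V) :
  (forall v, List.In v (free_vars phi) -> e v = e' v) -> sat e phi = sat e' phi.
Proof.
elim: phi e e' => /= [V1 t t'|V1 t t'|V1 n t t'|V1 phi IH|V1 phi IH psi IH'|V1 phi IH] e e' h.
1-3: by rewrite (@term_eval_ext _ _ e e' t) 1?(@term_eval_ext _ _ e e' t') // => v hv;
   apply: h; apply/In_cat; (by left) || (by right).
- by rewrite (IH e e').
- by rewrite (IH e e') 1?(IH' e e') // => v hv; apply: h; apply/In_cat; (by left) || (by right).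
- congr (exists x, _); apply/funext => x; apply: IH => -[v|] // hv.
  by apply: h; apply: In_pmap_id.
Qed.

Lemma finite_support (V : Type) (s : seq V) : exists n (f : V -> 'I_n.+1) (g : 'I_n.+1 -> option V),
  forall v, List.In v s -> g (f v) = Some v.
Proof.
elim: s => [|v s [n [f [g fgK]]]].
  by exists 0%N, (fun=> ord0), (fun=> None).
exists n.+1, (fun w => if `[< w = v >] then ord_max else lift ord_max (f w)).
exists (fun i => if unlift ord_max i is Some j then g j else Some v) => w.
case: asboolP => [-> _|wv []] /=; first by rewrite unlift_none.
- by move=> E; case: wv.
- by rewrite liftK; exact: fgK.
Qed.

Definition oenv (U : oagType) (V : Type) n (g : 'I_n -> option V) (e : V -> U) : 'I_n -> U :=
  fun i => if g i is Some v then e v else 0.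

Lemma sat_support (V : Type) (phi : formula V) : exists n (f : V -> 'I_n) (g : 'I_n -> option V),
  forall (U : oagType) (e : V -> U), sat e phi = sat (oenv g e) (rename f phi).
Proof.
have [n [f [g fgK]]] := finite_support (free_vars phi).
exists n.+1, f, g => U e; rewrite sat_rename; apply: sat_ext => v /fgK /=.
by rewrite /oenv => ->.
Qed.

Lemma elementary0 (U N : oagType) (j : U -> N) : elementary j -> j 0 = 0.
Proof.
move=> elj; pose phi : formula 'I_1 := fEq (tVar ord0) (tZero _).
by have /(_ (fun=> 0)) /= [] := elj 1%N phi => /(_ erefl).
Qed.

Lemma elementary_sat (U N : oagType) (j : U -> N) (elj : elementary j) (V : Type)
  (phi : formula V) (e : V -> U) : sat e phi <-> sat (j \o e) phi.
Proof.
have [n [f [g h]]] := sat_support phi; rewrite (h _ e) (h _ (j \o e)) elj.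
suff -> : j \o oenv g e = oenv g (j \o e) by [].
by apply/funext => i /=; rewrite /oenv; case: (g i) => //; exact: elementary0.
Qed.

Lemma elementary_comp (U N M : oagType) (j : U -> N) (k : N -> M) :
  elementary j -> elementary k -> elementary (k \o j).
Proof. by move=> ej ek n phi e; rewrite ej ek. Qed.

Lemma ex_closure_ord n (X : Type) (phi : formula (X + 'I_n)) : exists psi : formula X,
  forall (U : oagType) (e : X -> U),
    sat e psi <-> exists y : 'I_n -> U, sat (copair e y) phi.
Proof.
elim: n X phi => [|n IH] X phi.
  have f0 (i : 'I_0) : X by case: i.
  pose f (v : X + 'I_0) := match v with inl x => x | inr i => f0 i end.
  exists (rename f phi) => U e.
  have E (y : 'I_0 -> U) : e \o f = copair e y by apply/funext => -[|[]].
  rewrite sat_rename; split=> [h|[y]]; last by rewrite -E.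
  by exists (fun=> 0); rewrite -E.
pose f (v : X + 'I_n.+1) : option X + 'I_n := match v with
  | inl x => inl (Some x)
  | inr i => if unlift ord0 i is Some k then inr k else inl None end.
have [psi h] := IH _ (rename f phi).
exists (fEx psi) => U e /=; split => [[x]|[y hy]].
- move=> /h[y]; rewrite sat_rename => hy.
  exists (fun i => if unlift ord0 i is Some k then y k else x).
  have <- : copair (fun v => if v is Some w then e w else x) y \o f
     = copair e (fun i => if unlift ord0 i is Some k then y k else x) => //.
  by apply/funext => -[//|i] /=; case: (unlift ord0 i).
- exists (y ord0); apply/h; exists (fun i => y (lift ord0 i)); rewrite sat_rename.
  have -> // : copair (fun v => if v is Some w then e w else y ord0)
      (fun i => y (lift ord0 i)) \o f = copair e y.
  by apply/funext => -[//|i] /=; case: unliftP => [k|] ->.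
Qed.

Lemma ex_closure (X J : Type) (phi : formula (X + J)) : exists psi : formula X,
  forall (U : oagType) (e : X -> U),
    sat e psi <-> exists y : J -> U, sat (copair e y) phi.
Proof.
have [n [f [g fgK]]] := finite_support (pmap (fun v : X + J => if v is inr w then Some w else None) (free_vars phi)).
have [psi h] := ex_closure_ord (rename (copair inl (inr \o f)) phi).
exists psi => U e; rewrite h; split=> -[y hy].
- exists (y \o f); move: hy; rewrite sat_rename.
  by congr (sat _ _); apply/funext => -[].
- exists (oenv g y); rewrite sat_rename; move: hy; rewrite (@sat_ext _ _ (copair e y) (copair e (oenv g y) \o copair inl (inr \o f))) //.
  move=> -[//|w] /= hw; rewrite /oenv fgK //.
  elim: (free_vars phi) hw => //= -[x|w'] s IHs /= []; [by []|exact: IHs| |].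
    by case=> ->; left.
  by move=> hw; right; exact: IHs.
Qed.

Definition conjs (V : Type) (s : seq (formula V)) : formula V :=
  foldr (@fAnd V) (fEq (tZero V) (tZero V)) s.

Lemma sat_conjs (U : oagType) (V : Type) (e : V -> U) (s : seq (formula V)) :
  sat e (conjs s) <-> forall phi, List.In phi s -> sat e phi.
Proof.
elim: s => [|phi s IH] /=; first by split.
split=> [[h /IH hs] psi [<-//|]|h]; first exact: hs.
by split; [apply: h; left|apply/IH => psi hpsi; apply: h; right].
Qed.

Lemma universal_closure n (phi : formula 'I_n) : exists psi : formula void,
  forall U : oagType, sat (of_void U) psi <-> forall e : 'I_n -> U, sat e phi.
Proof.
have [psi h] := ex_closure_ord (rename (inr : 'I_n -> void + 'I_n) (fNot phi)).
exists (fNot psi) => U /=; rewrite h; split=> [hn e|he [y]].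
- apply: contrapT => ne; apply: hn; exists e; rewrite sat_rename /=.
  by move: ne; congr (~ sat _ _).
- by rewrite sat_rename /=; apply; exact: he.
Qed.

(** * Linear forms and quantifier elimination *)

Definition lin (V : Type) : Type := (seq (V * int) * int)%type.

Definition leval (U : oagType) (V : Type) (e : V -> U) (l : lin V) : U :=
  \sum_(t <- l.1) e t.1 *~ t.2 + oag_one U *~ l.2.

Definition lvar (V : Type) (v : V) : lin V := ([:: (v, 1%Z)], 0%Z).
Definition lone (V : Type) : lin V := ([::], 1%Z).
Definition lzero (V : Type) : lin V := ([::], 0%Z).
Definition ladd (V : Type) (l l' : lin V) : lin V := (l.1 ++ l'.1, l.2 + l'.2).
Definition lscale (V : Type) (k : int) (l : lin V) : lin V :=
  ([seq (t.1, t.2 * k) | t <- l.1], l.2 * k).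
Definition lmap (V W : Type) (f : V -> W) (l : lin V) : lin W :=
  ([seq (f t.1, t.2) | t <- l.1], l.2).

Section Leval.
Variables (U : oagType) (V : Type) (e : V -> U).

Lemma leval_var v : leval e (lvar v) = e v.
Proof. by rewrite /leval big_seq1 /= mulr1z mulr0z addr0. Qed.
Lemma leval_one : leval e (lone V) = oag_one U.
Proof. by rewrite /leval big_nil /= mulr1z add0r. Qed.
Lemma leval_zero : leval e (lzero V) = 0.
Proof. by rewrite /leval big_nil /= mulr0z add0r. Qed.
Lemma leval_add l l' : leval e (ladd l l') = leval e l + leval e l'.
Proof. by rewrite /leval big_cat /= mulrzDr addrACA. Qed.
Lemma leval_scale k l : leval e (lscale k l) = leval e l *~ k.
Proof.
rewrite /leval big_map /= mulrzDl mulrzA; congr (_ + _).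
by rewrite mulrz_suml; apply: eq_bigr => t _; rewrite mulrzA.
Qed.
Lemma leval_opp l : leval e (lscale (-1) l) = - leval e l.
Proof. by rewrite leval_scale mulrNz mulr1z. Qed.
End Leval.

Lemma leval_map (U : oagType) (V W : Type) (f : V -> W) (e : W -> U) l :
  leval e (lmap f l) = leval (e \o f) l.
Proof. by rewrite /leval big_map. Qed.

Definition lbind (V W : Type) (g : W -> option V) (l : lin W) : lin V :=
  (pmap (fun t => omap (fun v => (v, t.2)) (g t.1)) l.1, l.2).

Lemma leval_bind (U : oagType) (V : Type) n (g : 'I_n -> option V) (e : V -> U) l :
  leval e (lbind g l) = leval (oenv g e) l.
Proof.
case: l => s k; rewrite /leval /=; congr (_ + _).
elim: s => [|[i c] s IH]; first by rewrite !big_nil.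
rewrite big_cons -IH /= {1}/oenv; case: (g i) => [v|] /=; first by rewrite big_cons.
by rewrite mul0rz add0r.
Qed.

Fixpoint lin_of_term (V : Type) (t : term V) : lin V :=
  match t with
  | tVar v => lvar v
  | tZero => lzero V
  | tOne => lone V
  | tAdd t1 t2 => ladd (lin_of_term t1) (lin_of_term t2)
  | tOpp t1 => lscale (-1) (lin_of_term t1)
  end.

Lemma lin_of_termE (U : oagType) (V : Type) (e : V -> U) (t : term V) :
  leval e (lin_of_term t) = teval e t.
Proof.
elim: t => /= [v|||t <- t' <-|t <-].
- exact: leval_var.
- exact: leval_zero.
- exact: leval_one.
- exact: leval_add.
- exact: leval_opp.
Qed.

Definition tmulz (V : Type) (t : term V) (k : int) : term V :=
  match k with
  | Posz n => iter n (tAdd t) (tZero V)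
  | Negz n => tOpp (iter n.+1 (tAdd t) (tZero V))
  end.

Lemma tmulzE (U : oagType) (V : Type) (e : V -> U) (t : term V) k :
  teval e (tmulz t k) = teval e t *~ k.
Proof.
have H n : teval e (iter n (tAdd t) (tZero V)) = teval e t *+ n.
  by elim: n => [|n IH] /=; rewrite ?mulr0n // IH mulrS.
by case: k => n; rewrite /tmulz; [exact: H|rewrite NegzE mulrNz -pmulrn -H].
Qed.

Definition term_of_lin (V : Type) (l : lin V) : term V :=
  tAdd (foldr (fun t => tAdd (tmulz (tVar t.1) t.2)) (tZero V) l.1) (tmulz (tOne V) l.2).

Lemma term_of_linE (U : oagType) (V : Type) (e : V -> U) (l : lin V) :
  teval e (term_of_lin l) = leval e l.
Proof.
rewrite /= tmulzE; congr (_ + _); case: l => s k /=.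
elim: s => [|[v c] s IH] /=; first by rewrite big_nil.
by rewrite big_cons tmulzE IH.
Qed.

Definition divs (U : oagType) (n : nat) (x : U) : Prop := exists z : U, x = z *+ n.

Definition fPos (V : Type) (l : lin V) := fLt (tZero V) (term_of_lin l).
Definition fZero (V : Type) (l : lin V) := fEq (term_of_lin l) (tZero V).
Definition fDiv (V : Type) (n : nat) (l : lin V) := fCong n (term_of_lin l) (tZero V).

Lemma sat_fPos (U : oagType) (V : Type) (e : V -> U) l : sat e (fPos l) = (0 < leval e l).
Proof. by rewrite -term_of_linE. Qed.
Lemma sat_fZero (U : oagType) (V : Type) (e : V -> U) l : sat e (fZero l) = (leval e l = 0).
Proof. by rewrite -term_of_linE. Qed.
Lemma sat_fDiv (U : oagType) (V : Type) (e : V -> U) n l :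
  sat e (fDiv n l) = divs n (leval e l).
Proof. by rewrite -term_of_linE /= /oag_cong /divs subr0. Qed.

Section Divs.
Variable U : oagType.
Implicit Types x y : U.

Lemma divs0 n : divs n (0 : U).
Proof. by exists 0; rewrite mul0rn. Qed.
Lemma divsD n x y : divs n x -> divs n y -> divs n (x + y).
Proof. by case=> a -> [b ->]; exists (a + b); rewrite mulrnDl. Qed.
Lemma divsN n x : divs n x -> divs n (- x).
Proof. by case=> a ->; exists (- a); rewrite mulNrn. Qed.
Lemma divsB n x y : divs n x -> divs n y -> divs n (x - y).
Proof. by move=> hx hy; apply: divsD => //; apply: divsN. Qed.
Lemma divs_mulz n x k : divs n x -> divs n (x *~ k).
Proof. by case=> a ->; exists (a *~ k); zabel. Qed.
Lemma divs_muln n x : divs n (x *+ n).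
Proof. by exists x. Qed.
Lemma divs_dvd n m x : (n %| m)%N -> divs m x -> divs n x.
Proof. by case/dvdnP => k -> [z ->]; exists (z *+ k); rewrite mulrnA. Qed.
Lemma divs_dvdz (n : nat) (k : int) x : (n%:Z %| k)%Z -> divs n (x *~ k).
Proof. by case/dvdzP => q ->; exists (x *~ q); rewrite mulrzA -pmulrn. Qed.
Lemma divs_sum (T : eqType) (s : seq T) n (F : T -> U) :
  (forall t, t \in s -> divs n (F t)) -> divs n (\sum_(t <- s) F t).
Proof.
move=> h; rewrite big_seq; elim/big_ind: _ => // [|x y]; [exact: divs0|exact: divsD].
Qed.
Lemma divs_cong n x y : divs n (x - y) -> divs n x <-> divs n y.
Proof.
move=> h; split=> h'.
- by rewrite -(subKr x y); apply: divsB.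
- by rewrite -(subrK y x); apply: divsD.
Qed.
Lemma divsM n m x : (0 < m)%N -> divs (n * m) (x *+ m) <-> divs n x.
Proof.
move=> m0; split=> -[z].
- by rewrite mulrnA => /(omulrnI m0) ->; exists z.
- by move=> ->; exists z; rewrite mulrnA.
Qed.

End Divs.

Definition agree (U N : oagType) (V : Type) (ts : seq (lin V)) (m : nat)
    (e : V -> U) (e' : V -> N) : Prop :=
  forall t, List.In t ts ->
    [/\ (0 < leval e t) = (0 < leval e' t), (leval e t == 0) = (leval e' t == 0) &
     forall n, (0 < n)%N -> (n %| m)%N -> (divs n (leval e t) <-> divs n (leval e' t))].

Lemma agreeW (U N : oagType) (V : Type) (ts ts' : seq (lin V)) (m m' : nat)
  (e : V -> U) (e' : V -> N) : (forall t, List.In t ts -> List.In t ts') -> (m %| m')%N ->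
  agree ts' m' e e' -> agree ts m e e'.
Proof.
move=> sub mm h t /sub/h[h1 h2 h3]; split=> // n n0 nm.
by apply: h3 => //; exact: dvdn_trans nm mm.
Qed.

Definition lsub (V : Type) (t1 t2 : term V) := ladd (lin_of_term t1) (lscale (-1) (lin_of_term t2)).
Lemma lsubE (U : oagType) (V : Type) (e : V -> U) (t1 t2 : term V) :
  leval e (lsub t1 t2) = teval e t1 - teval e t2.
Proof. by rewrite leval_add leval_opp !lin_of_termE. Qed.

Lemma qf_data (V : Type) (phi : formula V) : qf phi ->
  exists (ts : seq (lin V)) (m : nat), (0 < m)%N /\
  forall (U N : oagType) (e : V -> U) (e' : V -> N),
    agree ts m e e' -> (sat e phi <-> sat e' phi).
Proof.
elim: phi => // {V} V.
- move=> t t' _; exists [:: lsub t t'], 1%N; split=> // U N e e' /(_ _ (or_introl erefl)).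
  rewrite !lsubE => -[_ h _] /=; rewrite !(rwP eqP).
  by rewrite -subr_eq0 h subr_eq0.
- move=> t t' _; exists [:: lsub t' t], 1%N; split=> // U N e e' /(_ _ (or_introl erefl)).
  by rewrite !lsubE -!olt_sub => -[h _ _] /=; rewrite h.
- case=> [|n] t t' _.
    exists [:: lsub t t'], 1%N; split=> // U N e e' /(_ _ (or_introl erefl)).
    rewrite !lsubE => -[_ h _] /=; rewrite /oag_cong.
    split=> -[z] /eqP; rewrite mulr0n.
      by rewrite h => /eqP ?; exists 0; rewrite mulr0n.
    by rewrite -h => /eqP ?; exists 0; rewrite mulr0n.
  exists [:: lsub t t'], n.+1; split=> // U N e e' /(_ _ (or_introl erefl)).
  by rewrite !lsubE => -[_ _ /(_ n.+1 isT (dvdnn _))] h /=; exact: h.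
- move=> phi IH /= /IH[ts [m [m0 h]]]; exists ts, m; split=> // U N e e' /h E.
  by rewrite E.
- move=> phi IH psi IH' /= [/IH[ts [m [m0 h]]] /IH'[ts' [m' [m'0 h']]]].
  exists (ts ++ ts'), (m * m')%N; split=> [|U N e e' hh]; first by rewrite muln_gt0 m0.
  rewrite (h U N e e') ?(h' U N e e') //.
    by apply: agreeW hh => [t ht|]; [apply/In_cat; right|exact: dvdn_mull].
  by apply: agreeW hh => [t ht|]; [apply/In_cat; left|exact: dvdn_mulr].
Qed.

Lemma models_theory (G M : oagType) : models (theory G) M ->
  forall n (phi : formula 'I_n), (forall e : 'I_n -> G, sat e phi) -> forall e : 'I_n -> M, sat e phi.
Proof.
move=> mM n phi h; have [psi hpsi] := universal_closure phi.
by apply/hpsi/mM/hpsi.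
Qed.

Definition fImp (V : Type) (phi psi : formula V) := fNot (fAnd phi (fNot psi)).
Lemma sat_fImp (U : oagType) (V : Type) (e : V -> U) (phi psi : formula V) :
  sat e (fImp phi psi) <-> (sat e phi -> sat e psi).
Proof.
split=> /= [h hp|h [hp]]; last by apply; exact: h.
by apply: contrapT => hn; exact: h.
Qed.

Lemma regular_data (G : oagType) (regG : regular_oag G) (V : Type) (phi : formula V) :
  exists (ts : seq (lin V)) (m : nat), (0 < m)%N /\
  forall (U N : oagType) (mU : models (theory G) U) (mN : models (theory G) N)
    (e : V -> U) (e' : V -> N), agree ts m e e' -> (sat e phi <-> sat e' phi).
Proof.
have [n [f [g hfg]]] := sat_support phi.
have [psi [qpsi hpsi]] := regG n (rename f phi).
have H (M : oagType) (mM : models (theory G) M) (e : 'I_n -> M) : sat e (rename f phi) <-> sat e psi.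
  have := @models_theory G M mM n (fAnd (fImp (rename f phi) psi) (fImp psi (rename f phi))).
  have h0 (e0 : 'I_n -> G) : sat e0 (fAnd (fImp (rename f phi) psi) (fImp psi (rename f phi))).
    by split; apply/sat_fImp => /hpsi.
  by move=> /(_ h0 e) [/sat_fImp h1 /sat_fImp h2]; split.
have [ts [m [m0 h]]] := qf_data qpsi.
exists [seq lbind g t | t <- ts], m; split=> // U N mU mN e e' ag.
rewrite (hfg _ e) (hfg _ e') !H //; apply: h => t ht.
have := ag (lbind g t); rewrite !leval_bind; apply.
by apply/List.in_map_iff; exists t.
Qed.

Definition same_sat (U N : oagType) (V : Type) (e : V -> U) (e' : V -> N) : Prop :=
  forall phi : formula V, sat e phi <-> sat e' phi.

Lemma same_sat_forms (G : oagType) (regG : regular_oag G) (U N : oagType)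
    (mU : models (theory G) U) (mN : models (theory G) N) (V : Type)
    (e : V -> U) (e' : V -> N) :
  (forall l : lin V, [/\ (0 < leval e l) = (0 < leval e' l), (leval e l == 0) = (leval e' l == 0) &
     forall n, (0 < n)%N -> (divs n (leval e l) <-> divs n (leval e' l))]) ->
  same_sat e e'.
Proof.
move=> h phi; have [ts [m [m0 hts]]] := regular_data regG phi.
by apply: hts => // t _; have [h1 h2 h3] := h t; split=> // n n0 _; exact: h3.
Qed.

Section SameSat.
Variables (U N : oagType) (V : Type) (e : V -> U) (e' : V -> N) (ee' : same_sat e e').

Lemma same_sat_pos l : (0 < leval e l) = (0 < leval e' l).
Proof. by apply/idP/idP => h; move: (ee' (fPos l)); rewrite !sat_fPos => -[h1 h2]; auto. Qed.
Lemma same_sat_eq0 l : leval e l = 0 <-> leval e' l = 0.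
Proof. by move: (ee' (fZero l)); rewrite !sat_fZero. Qed.
Lemma same_sat_divs n l : divs n (leval e l) <-> divs n (leval e' l).
Proof. by move: (ee' (fDiv n l)); rewrite !sat_fDiv. Qed.
End SameSat.

Definition hull (N : oagType) (V : Type) (e : V -> N) : set N :=
  [set b | exists m l, (0 < m)%N /\ b *+ m = leval e l].

Section Hull.
Variables (N : oagType) (V : Type) (e : V -> N).

Lemma hull_leval l : hull e (leval e l).
Proof. by exists 1%N, l. Qed.
Lemma hull_var v : hull e (e v).
Proof. by rewrite -(leval_var e); exact: hull_leval. Qed.
Lemma hull0 : hull e 0.
Proof. by rewrite -(leval_zero e); exact: hull_leval. Qed.
Lemma hullD a b : hull e a -> hull e b -> hull e (a + b).
Proof.
case=> m [l [m0 hm]] [m' [l' [m'0 hm']]]; exists (m * m')%N, (ladd (lscale m' l) (lscale m l')).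
rewrite muln_gt0 m0 m'0 leval_add !leval_scale -hm -hm'; split=> //; zabel.
Qed.
Lemma hull_mulz a k : hull e a -> hull e (a *~ k).
Proof.
case=> m [l [m0 hm]]; exists m, (lscale k l); split=> //.
by rewrite leval_scale -hm; zabel.
Qed.
Lemma hullN a : hull e a -> hull e (- a).
Proof. by move=> /(hull_mulz (-1)); rewrite mulrNz mulr1z. Qed.
Lemma hullB a b : hull e a -> hull e b -> hull e (a - b).
Proof. by move=> ha hb; apply: hullD => //; apply: hullN. Qed.
Lemma hull_muln a k : hull e a -> hull e (a *+ k).
Proof. exact: hull_mulz k. Qed.
Lemma hull_pure a n : (0 < n)%N -> hull e (a *+ n) -> hull e a.
Proof.
move=> n0 [m [l [m0 hm]]]; exists (n * m)%N, l; split; first by rewrite muln_gt0 n0.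
by rewrite mulrnA.
Qed.
Lemma hull_sum (T : eqType) (s : seq T) (F : T -> N) :
  (forall t, t \in s -> hull e (F t)) -> hull e (\sum_(t <- s) F t).
Proof.
elim: s => [|t s IH] h; first by rewrite big_nil; exact: hull0.
rewrite big_cons; apply: hullD; first by apply: h; rewrite mem_head.
by apply: IH => u us; apply: h; rewrite in_cons us orbT.
Qed.
End Hull.

Definition transfer (N M : oagType) (V : Type) (e : V -> N) (e' : V -> M) (tau : N -> M) : Prop :=
  [/\ forall b m l, (0 < m)%N -> b *+ m = leval e l -> tau b *+ m = leval e' l,
      forall a b, hull e a -> hull e b -> tau (a + b) = tau a + tau b,
      forall a k, hull e a -> tau (a *~ k) = tau a *~ k &
      forall b, hull e b -> [/\ (0 < b) = (0 < tau b), b = 0 <-> tau b = 0,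
         hull e' (tau b) & forall n, divs n b <-> divs n (tau b)]].

Lemma hull_transfer (N M : oagType) (V : Type) (e : V -> N) (e' : V -> M) :
  same_sat e e' -> exists tau, transfer e e' tau.
Proof.
move=> ee'.
have ex b : {c : M | forall m l, (0 < m)%N -> b *+ m = leval e l -> c *+ m = leval e' l}.
  apply: cid; have [[m [l [m0 hm]]]|nb] := pselect (hull e b); last first.
    by exists 0 => m l m0 hm; case: nb; exists m, l.
  have [c hc] : divs m (leval e' l) by apply/(same_sat_divs ee'); exists b.
  exists c => m' l' m'0 hm'; apply: (omulrnI m0); apply: subr0_eq.
  have := same_sat_eq0 ee' (ladd (lscale m' l) (lscale (- m%:Z) l')).
  rewrite !leval_add !leval_scale -hm -hm' hc => -[h _].
  by rewrite -[RHS]h; zabel.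
exists (fun b => sval (ex b)).
have T b m l : (0 < m)%N -> b *+ m = leval e l -> sval (ex b) *+ m = leval e' l.
  exact: (svalP (ex b)).
have M0 m n : (0 < m -> 0 < n -> 0 < m * n)%N by rewrite muln_gt0 => -> ->.
split=> // [a b [m [l [m0 hm]]] [m' [l' [m'0 hm']]]|a k [m [l [m0 hm]]]|b [m [l [m0 hm]]]].
- have := @T (a + b) (m * m')%N (ladd (lscale m' l) (lscale m l')) (M0 _ _ m0 m'0).
  rewrite !leval_add !leval_scale -hm -hm' -(T _ _ _ m0 hm) -(T _ _ _ m'0 hm') => h.
  by apply: (omulrnI (M0 _ _ m0 m'0)); rewrite h; zabel.
- have := @T (a *~ k) m (lscale k l) m0; rewrite !leval_scale -hm -(T _ _ _ m0 hm) => h.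
  by apply: (omulrnI m0); rewrite h; zabel.
- have hT := T _ _ _ m0 hm; split.
  + by rewrite -(omulrn_gt0 _ m0) -[RHS](omulrn_gt0 _ m0) hm hT; exact: same_sat_pos.
  + rewrite !(rwP eqP) -(omulrn_eq0 _ m0) -[sval _ == 0](omulrn_eq0 _ m0) hm hT -!(rwP eqP).
    exact: same_sat_eq0.
  + by exists m, l.
  + by move=> n; rewrite -(divsM n _ m0) -(divsM n (sval _) m0) hm hT; exact: same_sat_divs.
Qed.

Definition oscons (U : oagType) (V : Type) (e : V -> U) (x : U) (v : option V) : U :=
  if v is Some w then e w else x.
Lemma sat_fEx (U : oagType) (V : Type) (e : V -> U) phi :
  sat e (fEx phi) = exists x : U, sat (oscons e x) phi.
Proof. by []. Qed.
Lemma sat_fAnd (U : oagType) (V : Type) (e : V -> U) (phi psi : formula V) :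
  sat e (fAnd phi psi) = (sat e phi /\ sat e psi).
Proof. by []. Qed.
Lemma sat_fNot (U : oagType) (V : Type) (e : V -> U) (phi : formula V) :
  sat e (fNot phi) = ~ sat e phi.
Proof. by []. Qed.

(** * Approximate divisibility *)

Section One.
Variable U : oagType.

Lemma one_spec : oag_one U = 0 \/
  0 < oag_one U /\ forall y : U, 0 < y -> oag_one U <= y.
Proof.
rewrite /oag_one; case: xgetP => [x _ hx|]; first by right.
by left.
Qed.

Lemma one_ge0 : 0 <= oag_one U.
Proof. by case: one_spec => [->|[/ltW]]. Qed.

Lemma one_nat_ge0 n : 0 <= oag_one U *+ n.
Proof. by have /= := nnM n (one_ge0 : nn false (oag_one U)). Qed.

Lemma one_le_nat m n : (m <= n)%N -> oag_one U *+ m <= oag_one U *+ n.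
Proof.
move=> mn; have h := one_nat_ge0 (n - m); apply: (le_nn (h : nn false _)).
by rewrite mulrnBr.
Qed.

Lemma between_ones (n : nat) (y : U) : 0 < oag_one U -> 0 <= y -> y <= oag_one U *+ n ->
  exists2 i, (i <= n)%N & y = oag_one U *+ i.
Proof.
move=> o0; elim: n => [|n IH] y0 yn.
  by exists 0%N => //; apply: le_anti; rewrite yn mulr0n y0.
case: one_spec => [o|[_ oleast]]; first by rewrite o ltxx in o0.
have [h|h] := boolP (y <= oag_one U *+ n).
  by have [i ni ->] := IH y0 h; exists i => //; exact: leqW.
exists n.+1 => //; apply: le_anti; rewrite yn /=.
rewrite -oltNge olt_sub in h; have {}h := oleast _ h.
by olin h.
Qed.
End One.

Lemma mulz_ge0 (U : oagType) (a : U) (k : int) : 0 <= a -> 0 <= k -> 0 <= a *~ k.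
Proof. by case: k => // n a0 _; have /= := nnM n (a0 : nn false a). Qed.

Lemma lin2 (t : lin bool) : exists k l c : int, forall (U : oagType) (e : bool -> U),
  leval e t = e false *~ k + e true *~ l + oag_one U *~ c.
Proof.
case: t => s c; elim: s => [|[b x] s [k [l [c' IH]]]].
  by exists 0, 0, c => U e; rewrite /leval big_nil; zabel.
have E (U : oagType) (e : bool -> U) : leval e ((b, x) :: s, c) = e b *~ x + leval e (s, c).
  by rewrite /leval big_cons addrA.
case: b E => E.
- by exists k, (l + x), c' => U e; rewrite E IH; zabel.
- by exists (k + x), l, c' => U e; rewrite E IH; zabel.
Qed.

(* The signs of finitely many forms are constant on such pairs, so quantifier
   elimination transfers a formula from a pair for which it is obvious. *)
Definition near_pair (U : oagType) (B : nat) (e : bool -> U) : Prop :=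
  oag_one U *+ B < e true - e false /\ (e true - e false) *+ B.+1 < e false.

Lemma near_pair_sign (U : oagType) (t : lin bool) : exists (B : nat) (s s' : bool),
  forall B' (e : bool -> U), (B <= B')%N -> near_pair B' e ->
  (0 < leval e t) = s /\ (leval e t == 0) = s'.
Proof.
have [k [l [c hklc]]] := lin2 t.
pose B := (`|k| + `|l| + `|c|)%N; exists B.
have pos (x : U) : 0 < x -> (0 < x) = true /\ (x == 0) = false.
  by move=> h; rewrite h (gt_eqF h).
have neg (x : U) : 0 < - x -> (0 < x) = false /\ (x == 0) = false.
  move=> h; rewrite -oppr_eq0 (gt_eqF h); split=> //.
  by apply/negP => h'; olin (nn_lt h, nn_lt h').
have o0 := one_ge0 U.
have cof (a : U) (q : int) B' : 0 <= a -> - B'%:Z <= q -> 0 <= a *~ q + a *+ B'.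
  move=> a0 hq; have /(mulz_ge0 a0) h : 0 <= q + B'%:Z by lia.
  by olin h.
have [e|e|e] := ltgtP (k + l) 0.
- exists false, false => B' e' BB' [h1 h2]; apply: neg; rewrite hklc.
  have v0 : 0 <= e' false by have := one_nat_ge0 U B'; move=> h0; olin (h2, scaled B'.+1 h1, scaled B'.+1 h0).
  have ep0 : 0 <= e' true - e' false by have h0 := one_nat_ge0 U B'; olin (h1, h0).
  have a1 := mulz_ge0 v0 (_ : 0 <= - (k + l) - 1).
  have {}a1 : 0 <= e' false *~ (- (k + l) - 1) by apply: a1; lia.
  have a2 : 0 <= (e' true - e' false) *~ (- l) + (e' true - e' false) *+ B' by apply: cof => //; lia.
  have a3 : 0 <= oag_one U *~ (- c) + oag_one U *+ B' by apply: cof => //; lia.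
  by olin (h1, h2, a1, a2, a3).
- exists true, false => B' e' BB' [h1 h2]; apply: pos; rewrite hklc.
  have v0 : 0 <= e' false by have := one_nat_ge0 U B'; move=> h0; olin (h2, scaled B'.+1 h1, scaled B'.+1 h0).
  have ep0 : 0 <= e' true - e' false by have h0 := one_nat_ge0 U B'; olin (h1, h0).
  have a1 := mulz_ge0 v0 (_ : 0 <= (k + l) - 1).
  have {}a1 : 0 <= e' false *~ ((k + l) - 1) by apply: a1; lia.
  have a2 : 0 <= (e' true - e' false) *~ l + (e' true - e' false) *+ B' by apply: cof => //; lia.
  have a3 : 0 <= oag_one U *~ c + oag_one U *+ B' by apply: cof => //; lia.
  by olin (h1, h2, a1, a2, a3).
have kE : k = - l by lia.
have [e1|e1|e1] := ltgtP l 0.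
- exists false, false => B' e' BB' [h1 h2]; apply: neg; rewrite hklc kE.
  have ep0 : 0 <= e' true - e' false by have h0 := one_nat_ge0 U B'; olin (h1, h0).
  have a2 : 0 <= (e' true - e' false) *~ (- l - 1) by apply: mulz_ge0 => //; lia.
  have a3 : 0 <= oag_one U *~ (- c) + oag_one U *+ B' by apply: cof => //; lia.
  by olin (h1, a2, a3).
- exists true, false => B' e' BB' [h1 h2]; apply: pos; rewrite hklc kE.
  have ep0 : 0 <= e' true - e' false by have h0 := one_nat_ge0 U B'; olin (h1, h0).
  have a2 : 0 <= (e' true - e' false) *~ (l - 1) by apply: mulz_ge0 => //; lia.
  have a3 : 0 <= oag_one U *~ c + oag_one U *+ B' by apply: cof => //; lia.
  by olin (h1, a2, a3).
exists (0 < oag_one U *~ c), (oag_one U *~ c == 0) => B' e' _ _.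
by rewrite hklc kE e1 oppr0 !mulr0z !add0r.
Qed.

Section Gap.
Variables (G : oagType) (regG : regular_oag G).
Variables (U : oagType) (mU : models (theory G) U).

Lemma gap_near n : (0 < n)%N -> exists B, forall e : bool -> U, near_pair B e ->
  exists x, e false < x *+ n /\ x *+ n < e true.
Proof.
move=> n0.
pose f0 : lin (option bool) := ladd (lscale n (lvar None)) (lscale (-1) (lvar (Some false))).
pose f1 : lin (option bool) := ladd (lvar (Some true)) (lscale (- n%:Z) (lvar None)).
pose phi := fEx (fAnd (fPos f0) (fPos f1)).
have hphi (e : bool -> U) : sat e phi <-> exists x, e false < x *+ n /\ x *+ n < e true.
  rewrite /phi sat_fEx; split=> -[x].
  - rewrite sat_fAnd !sat_fPos !leval_add !leval_scale !leval_var /=.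
    by move=> [h1 h2]; exists x; split; [olin h1 | olin h2].
  - move=> [h1 h2]; exists x; rewrite sat_fAnd !sat_fPos !leval_add !leval_scale !leval_var /=.
    by split; [olin h1 | olin h2].
have [ts [m [m0 hts]]] := regular_data regG phi.
have [B [S hS]] : exists B (S : lin bool -> bool * bool), forall t, List.In t ts ->
    forall B' (e : bool -> U), (B <= B')%N -> near_pair B' e ->
      (0 < leval e t) = (S t).1 /\ (leval e t == 0) = (S t).2.
  have /choice[F hF] : forall t : lin bool, exists F : nat * (bool * bool),
      forall B' (e : bool -> U), (F.1 <= B')%N -> near_pair B' e ->
      (0 < leval e t) = F.2.1 /\ (leval e t == 0) = F.2.2.
    by move=> t; have [B [s [s' h]]] := near_pair_sign U t; exists (B, (s, s')).
  exists (foldr (fun t b => maxn (F t).1 b) 0%N ts), (fun t => (F t).2) => t ht B' e hB' np.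
  apply: hF np; apply: leq_trans hB'.
  elim: (ts) ht => //= t' s IH [->|/IH h]; first exact: leq_maxl.
  exact: leq_trans h (leq_maxr _ _).
exists B => e np; apply/hphi.
have [P hP] : exists P, P = (2 * m * n)%N by exists (2 * m * n)%N.
have [v hv] : exists v, v = e false by exists (e false).
have [w hw] : exists w, w = e true by exists (e true).
pose e' (b : bool) : U := if b then w + v *+ (P * B.+2) else v + v *+ (P * B.+1).
have P2 : (2 <= P)%N by rewrite hP -mulnA leq_pmulr // muln_gt0 m0.
have := np; rewrite /near_pair -hv -hw => -[np1 np2].
have h0 := one_nat_ge0 U B.
have v0 : 0 < v by olin (np2, scaled B.+1 np1, scaled B.+1 h0).
have vP := nn_lt v0; rewrite subr0 in vP.
have np' : near_pair B e'.
  have vw : (0 : U) <= v *+ P by apply: nnW (nnM P vP).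
  split; rewrite /e'; first by olin (np1, vw).
  by olin np2.
apply/(hts U U mU mU e e'); last first.
  have eP k : v *+ (2 * m * k) *+ n = v *+ (P * k) by rewrite hP -mulrnA mulnAC.
  apply/hphi; exists (v *+ (2 * m * B.+2)); rewrite eP /e'; split.
    have [P' hP'] : exists P', P = P'.+2 by exists (P - 2)%N; lia.
    by rewrite hP'; olin (vP, nnM P' vP).
  have w0 : 0 < w by olin (vP, np1, h0).
  by olin w0.
move=> t ht; have [-> ->] := hS t ht B e (leqnn _) np.
have [-> ->] := hS t ht B e' (leqnn _) np'; split=> // d d0 dm.
apply: divs_cong; have [k [l [c hE]]] := lin2 t; rewrite !hE.
have dP : (d %| P)%N by rewrite hP mulnAC dvdn_mull.
have [z1 hz1] := divs_dvd (dvdn_mulr B.+1 dP) (divs_muln (P * B.+1) v).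
have [z2 hz2] := divs_dvd (dvdn_mulr B.+2 dP) (divs_muln (P * B.+2) v).
exists (- z1 *~ k - z2 *~ l); by rewrite /e' hz1 hz2 -hv -hw; zabel.
Qed.

Lemma gap n : (0 < n)%N -> exists B, forall a b : U, a + oag_one U *+ B < b ->
  exists x, a < x *+ n /\ x *+ n < b.
Proof.
move=> n0; have [B hB] := gap_near n0; exists B => a b ab.
have h0 := one_nat_ge0 U B.
pose c := if 0 <= a then a else - a.
have c0 : 0 <= c.
  rewrite /c; case: ifP => // /negbT; rewrite -oltNge => h; by olin h.
have ca : 0 <= c + a.
  rewrite /c; case: ifP => [h|_]; [by olin (h, h)|by rewrite addNr].
pose t := (c + (b - a)) *+ B.+3.
have tn : 0 <= t *+ n - t.
  have d0 : nn false (c + (b - a)) by rewrite /nn; olin (c0, ab, h0).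
  have /nnW := nnM (B.+3 * (n - 1)) d0; rewrite /t => h; olin h.
pose e (x : bool) := (if x then b else a) + t *+ n.
have [|x [h1 h2]] := hB e.
  split; rewrite /e; first by olin ab.
  have abp : nn true (b - a) by rewrite /nn; olin (ab, h0).
  have c' := nnM B.+2 (c0 : nn false c).
  have c'' : nn false (c *+ B.+2) := nnW c'.
  by rewrite /t in tn *; olin (tn, ca, c'', abp, abp).
exists (x - t); rewrite /e in h1 h2; split; [olin h1|olin h2].
Qed.

Lemma gap_coset n : (0 < n)%N -> exists B, forall a b z : U, a + oag_one U *+ B < b ->
  exists x, a < x /\ x < b /\ divs n (x - z).
Proof.
move=> n0; have [B hB] := gap n0; exists B => a b z ab.
have [|x [h1 h2]] := hB (a - z) (b - z); first by olin ab.
exists (z + x *+ n); split; [olin h1|split; [olin h2|exists x; zabel]].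
Qed.

Lemma room B (s : seq (nat * U)) :
  (forall k a, List.In (k, a) s -> (0 < k)%N /\ forall i, oag_one U *+ i < a) ->
  (exists u : U, 0 < u) ->
  exists eps : U, oag_one U *+ B < eps /\ forall k a, List.In (k, a) s -> eps *+ k < a.
Proof.
move=> hs [u u0]; have [o0|[o0 _]] := one_spec U; last first.
  exists (oag_one U *+ B.+1); split; first by olin o0.
  by move=> k a /hs[_ /(_ (B.+1 * k)%N)]; rewrite mulrnA.
elim: s hs => [|[k a] s IH] hs.
  by exists u; split=> //; rewrite o0 mul0rn.
have [|eps [h1 h2]] := IH; first by move=> k' a' h; apply: hs; right.
have [k0 /(_ 0%N)] := hs k a (or_introl erefl); rewrite mulr0n => a0.
have [C hC] := gap k0; have [|x [x0 xa]] := hC 0 a; first by rewrite o0 mul0rn addr0.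
rewrite omulrn_gt0 // in x0; rewrite o0 mul0rn in h1.
exists (if x <= eps then x else eps); rewrite o0 mul0rn; split; first by case: ifP.
move=> k' a' [[<- <-]|h]; case: ifP => // c.
- have {}c : eps < x by rewrite oltNge c.
  by olin (xa, nnM k (nn_lt c)).
- by have h' := h2 _ _ h; olin (h', nnM k' (nn_le c)).
- by exact: h2.
Qed.

End Gap.

(** * Small sets and bases modulo a prime *)

Lemma card_le_fun (T U : Type) (A : set T) (B : set U) (f : T -> U) :
  (forall x, A x -> B (f x)) -> (forall x y, A x -> A y -> f x = f y -> x = y) -> A #<= B.
Proof.
move=> hf fi; suff [g] : $|{injfun A >-> B}| by exact: inj_card_le.
apply/injfunPex; exists f => // x y /set_mem Ax /set_mem Ay; exact: fi.
Qed.

Lemma card_le_typeP (X Y : Type) :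
  [set: X] #<= [set: Y] <-> exists f : X -> Y, injective f.
Proof.
split=> [/card_leP[f]|[f fi]]; last by apply: (card_le_fun (f := f)) => // x y _ _; exact: fi.
exists (fun x => val (f (to_setT x))) => x y /val_inj h.
have /(congr1 val) // : to_setT x = to_setT y.
by have := @inj _ _ _ f; apply; rewrite ?inE.
Qed.

Lemma injections_total (X Y : Type) :
  (exists f : X -> Y, injective f) \/ (exists f : Y -> X, injective f).
Proof.
pose P (R : set (X * Y)) := forall p q, R p -> R q -> (p.1 = q.1 <-> p.2 = q.2).
have [F FP tF|R [PR Rmax]] := @Zorn_bigcup _ P.
  move=> p q [R FR Rp] [S FS Sq]; have [RS|SR] := tF _ _ FR FS.
  - by apply: (FP _ FS) => //; exact: RS.
  - by apply: (FP _ FR) => //; exact: SR.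
have [hx|nx] := pselect (forall x, exists y, R (x, y)).
  left; have [f hf] := choice hx; exists f => x x' e.
  by apply/(PR _ _ (hf x) (hf x')).
have [hy|ny] := pselect (forall y, exists x, R (x, y)).
  right; have [f hf] := choice hy; exists f => y y' e.
  by apply/(PR _ _ (hf y) (hf y')).
move: nx ny => /existsNP[x0 nx0] /existsNP[y0 ny0].
exfalso; apply: (Rmax (R `|` [set (x0, y0)])).
  split; first by move=> ?; left.
  by move=> /(_ (x0, y0) (or_intror erefl)) h; apply: nx0; exists y0.
have aux x y : R (x, y) -> x <> x0 /\ y <> y0.
  by move=> h; split=> e; [apply: nx0; exists y; rewrite -e|apply: ny0; exists x; rewrite -e].
move=> [x y] [x' y'] [Rp|[-> ->]] [Rq|[-> ->]] //=.
- exact: (PR _ _ Rp Rq).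
- by have [? ?] := aux _ _ Rp.
- by have [h1 h2] := aux _ _ Rq; split=> e; [case: h1|case: h2].
Qed.

Section Small.
Variables (K : Type) (K_nat : small K [set: nat]) (K_lim : strong_limit K).
Implicit Types X Y : Type.

Lemma small_inj X Y (f : X -> Y) : injective f -> small K [set: Y] -> small K [set: X].
Proof.
move=> fi [YK nKY]; have XY : [set: X] #<= [set: Y] by apply/card_le_typeP; exists f.
by split=> [|h]; [exact: card_le_trans YK|apply: nKY; exact: card_le_trans XY].
Qed.

Lemma small_le T U (A : set T) (B : set U) : A #<= B -> small K B -> small K A.
Proof.
move=> AB [BK nKB]; split; first exact: card_le_trans BK.
by move=> h; apply: nKB; exact: card_le_trans AB.
Qed.

Lemma small_set T (A : set T) : small K A <-> small K [set: A].
Proof.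
have /card_eqPle[h1 h2] : [set: A] #= A by exact: card_setT.
by split; exact: small_le.
Qed.

Lemma small_range X T (f : X -> T) : small K [set: X] -> small K (range f).
Proof. exact/small_le/card_image_le. Qed.

Lemma small_surj X Y (f : X -> Y) : (forall y, exists x, f x = y) ->
  small K [set: X] -> small K [set: Y].
Proof.
move=> /choice[g hg]; apply: (@small_inj _ _ g) => y y' e.
by rewrite -(hg y) e hg.
Qed.

Lemma small_sum X Y : small K [set: X] -> small K [set: Y] -> small K [set: X + Y].
Proof.
have H A B (f : A -> B) : injective f -> small K [set: B] -> small K [set: A + B].
  move=> fi sB; have sB' : small K [set: set (set B)] by exact/K_lim/K_lim.
  pose g (v : A + B) : set (set B) := match v with
    | inl a => [set [set f a]] | inr b => [set [set b]; set0] end.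
  apply: (small_inj (f := g)) sB' => -[a|b] [a'|b'] //= /seteqP[h1 h2].
  - have /seteqP[/(_ (f a) erefl) /= /fi -> //] : [set f a] = [set f a'] by exact: h1.
  - have /= /seteqP[_ /(_ (f a) erefl) //] : set0 = [set f a] by apply: h2; right.
  - have /= /seteqP[_ /(_ (f a') erefl) //] : set0 = [set f a'] by apply: h1; right.
  - have /= [] : [set [set b']; set0] [set b] by apply: h1; left.
      by move/seteqP => [/(_ b erefl) /= -> //].
    by move/seteqP => [/(_ b erefl)].
have [[f fi]|[f fi]] := injections_total X Y => sX sY; first exact: H fi sY.
by apply: (small_surj (f := fun v : Y + X => match v with inl y => inr y | inr x => inl x end)) (H _ _ _ fi sX) => -[v|v]; [exists (inr v)|exists (inl v)].
Qed.

Lemma small_prod X Y : small K [set: X] -> small K [set: Y] -> small K [set: X * Y].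
Proof.
move=> sX sY; have /K_lim := small_sum sX sY.
apply: (small_inj (f := fun p => [set inl p.1; inr p.2])) => -[x y] [x' y'] /seteqP[h _] /=.
have [[->]|//] := h (inl x) (or_introl erefl).
by have [//|[->]] := h (inr y) (or_intror erefl).
Qed.

Lemma small_seq X : small K [set: X] -> small K [set: seq X].
Proof.
move=> sX; have /K_lim := small_prod K_nat sX.
apply: (small_inj (f := fun s => [set p | onth s p.1 = Some p.2])).
elim=> [|x s IH] [|x' s'] //.
- by move/seteqP => [_ /(_ (0%N, x') erefl)].
- by move/seteqP => [/(_ (0%N, x) erefl)].
move=> h; have [e] : onth (x' :: s') 0 = Some x.
  by have /seteqP[/(_ (0%N, x) erefl)] := h.
rewrite e; congr (_ :: _); apply: IH; apply/seteqP; split=> -[i y] hi.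
  by have /seteqP[/(_ (i.+1, y) hi)] := h.
by have /seteqP[_ /(_ (i.+1, y) hi)] := h.
Qed.

Lemma small_count (T : countType) : small K [set: T].
Proof. exact: small_inj (pcan_inj pickleK) K_nat. Qed.

Lemma small_lin X : small K [set: X] -> small K [set: lin X].
Proof.
move=> sX; apply: small_prod (small_count int).
exact/small_seq/small_prod/(small_count int).
Qed.

Lemma small_setU T (A B : set T) : small K A -> small K B -> small K (A `|` B).
Proof.
move=> /small_set sA /small_set sB.
have : small K (range (fun v : A + B => match v with inl a => val a | inr b => val b end)).
  exact/small_range/small_sum.
apply: small_le; apply: subset_card_le => x [Ax|Bx].
- by exists (inl (SigSub (mem_set Ax))).
- by exists (inr (SigSub (mem_set Bx))).
Qed.

End Small.

Section Modular.
Variables (N : zmodType) (p : nat) (p_prime : prime p) (W : set N).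
Hypotheses (W0 : W 0) (WD : forall x y, W x -> W y -> W (x + y)).
Hypotheses (WN : forall x, W x -> W (- x)) (Wp : forall x, W (x *+ p)).
Implicit Types X Y Z : set N.

Lemma subgroup_mulz x k : W x -> W (x *~ k).
Proof.
move=> Wx; have H n : W (x *+ n) by elim: n => [|n IH]; rewrite ?mulr0n // mulrS; exact: WD.
by case: k => n; [exact: H|rewrite NegzE mulrNz; apply/WN/H].
Qed.

Definition independent X : Prop := forall (s : seq N) (k : N -> int),
  uniq s -> [set` s] `<=` X -> W (\sum_(b <- s) b *~ k b) -> forall b, b \in s -> (p%:Z %| k b)%Z.

Definition spanned X (g : N) : Prop := exists l : seq (N * int),
  (forall t, t \in l -> X t.1) /\ W (g - \sum_(t <- l) t.1 *~ t.2).

Lemma sum_uniqF (l : seq (N * int)) : exists (s : seq N) (k : N -> int),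
  [/\ uniq s, forall b, b \in s -> exists2 t, t \in l & t.1 = b &
   forall (M : zmodType) (F : N -> M), \sum_(t <- l) F t.1 *~ t.2 = \sum_(b <- s) F b *~ k b].
Proof.
elim: l => [|[b c] l [s [k [us sl IH]]]].
  by exists [::], (fun=> 0); split=> // M F; rewrite !big_nil.
have sl' b' : b' \in s -> exists2 t, t \in (b, c) :: l & t.1 = b'.
  by move=> /sl[t tl tb]; exists t => //; rewrite in_cons tl orbT.
have [bs|bs] := boolP (b \in s).
  exists s, (fun x => if x == b then k x + c else k x); split=> // M F.
  rewrite big_cons IH (perm_big _ (perm_to_rem bs)) [RHS](perm_big _ (perm_to_rem bs)) /= !big_cons eqxx.
  rewrite mulrzDr addrA [_ + F b *~ c]addrC; congr (_ + _).
  apply: eq_big_seq => x; rewrite mem_rem_uniq // inE => /andP[/negPf -> _] //.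
exists (b :: s), (fun x => if x == b then c else k x); split=> [|b'|M F].
- by rewrite /= bs.
- rewrite in_cons => /orP[/eqP->|]; last exact: sl'.
  by exists (b, c) => //; exact: mem_head.
- rewrite !big_cons eqxx IH; congr (_ + _); apply: eq_big_seq => x xs.
  by case: eqP => // e; rewrite e (negPf bs) in xs.
Qed.

Lemma sum_uniq (l : seq (N * int)) : exists (s : seq N) (k : N -> int),
  [/\ uniq s, forall b, b \in s -> exists2 t, t \in l & t.1 = b &
   \sum_(t <- l) t.1 *~ t.2 = \sum_(b <- s) b *~ k b].
Proof.
by have [s [k [us sl E]]] := sum_uniqF l; exists s, k; split=> //; exact: (E _ id).
Qed.

Lemma spanned_sub X g : X g -> spanned X g.
Proof.
move=> Xg; exists [:: (g, 1%Z)]; split=> [t|]; first by rewrite inE => /eqP->.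
by rewrite big_seq1 /= mulr1z subrr.
Qed.
Lemma spannedW X g : W g -> spanned X g.
Proof. by exists [::]; split=> //; rewrite big_nil subr0. Qed.
Lemma spannedD X g h : spanned X g -> spanned X h -> spanned X (g + h).
Proof.
case=> l [hl Wl] [l' [hl' Wl']]; exists (l ++ l'); split=> [t|].
  by rewrite mem_cat => /orP[/hl|/hl'].
by rewrite big_cat opprD addrACA; exact: WD.
Qed.
Lemma spannedZ X g k : spanned X g -> spanned X (g *~ k).
Proof.
case=> l [hl Wl]; exists [seq (t.1, t.2 * k) | t <- l]; split=> [t /mapP[u /hl ? ->] //|].
rewrite big_map; have := subgroup_mulz k Wl.
by rewrite mulrzBl mulrz_suml; congr (W (_ - _)); apply: eq_bigr => t _; rewrite mulrzA.
Qed.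
Lemma spanned_trans X Y g : spanned X g -> (forall x, X x -> spanned Y x) -> spanned Y g.
Proof.
case=> l [hl Wl] XY; rewrite -(subrK (\sum_(t <- l) t.1 *~ t.2) g).
apply: spannedD; first exact: spannedW.
elim: l hl {Wl} => [|t l IH] hl; first by rewrite big_nil; apply: spannedW.
rewrite big_cons; apply: spannedD; first by apply/spannedZ/XY/hl; exact: mem_head.
by apply: IH => u ul; apply: hl; rewrite in_cons ul orbT.
Qed.

Lemma independent_sub X Y : X `<=` Y -> independent Y -> independent X.
Proof. by move=> XY iY s k us sX; apply: iY => //; exact: subset_trans XY. Qed.

Lemma independent_add X g : independent X -> ~ spanned X g -> independent (X `|` [set g]).
Proof.
move=> iX ng s k us sX hW.
have [gs|gs] := boolP (g \in s); last first.
  apply: iX hW => // x xs; have [//|e] := sX x xs.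
  by move: xs gs; rewrite /= e => ->.
have sX' : [set` rem g s] `<=` X.
  move=> x /=; rewrite mem_rem_uniq // inE => /andP[/= xg xs].
  by have [//|/= e] := sX x xs; rewrite e eqxx in xg.
rewrite (perm_big _ (perm_to_rem gs)) /= big_cons in hW.
have [pk|pk] := boolP (p%:Z %| k g)%Z.
  have : W (\sum_(b <- rem g s) b *~ k b).
    rewrite -(addKr (g *~ k g) (\sum_(b <- _) _)); apply: WD => //.
    by apply: WN; have /dvdzP[q ->] := pk; rewrite mulrzA -pmulrn.
  move=> /(iX _ _ (rem_uniq g us) sX') h b bs.
  have [-> //|bg] := eqVneq b g; apply: h.
  by rewrite mem_rem_uniq // inE /= bg.
exfalso; apply: ng.
have cop : coprimez p (k g) by rewrite coprimezE prime_coprime // -[(p %| _)%N]dvdzE.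
have [u [v]] := Bezoutz p (k g); rewrite (eqP cop) => uv.
have E : g = (g *~ u) *+ p + (g *~ k g + \sum_(b <- rem g s) b *~ k b) *~ v - (\sum_(b <- rem g s) b *~ k b) *~ v.
  by rewrite mulrzDl addrA addrK pmulrn -!mulrzA -mulrzDr [k g * v]mulrC uv mulr1z.
rewrite E; apply: spannedD; first by apply: spannedW; apply: WD => //; exact: subgroup_mulz.
rewrite -mulrNz; apply: spannedZ; exists [seq (b, k b) | b <- rem g s].
rewrite big_map /= subrr; split=> // t /mapP[b bs ->]; exact: sX'.
Qed.

Lemma basis_exists (D : set N) : exists B, [/\ B `<=` D, independent B & D `<=` spanned B].
Proof.
have [F FP tF|B [[BD iB] Bmax]] := @Zorn_bigcup _ [set B | B `<=` D /\ independent B].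
  split=> [x [B /FP[BD _] Bx]|s k us sF]; first exact: BD.
  have [[B0 FB0]|F0] := pselect (exists B0, F B0); last first.
    by case: s us sF => // x s _ /(_ x (mem_head _ _)) [B FB _]; case: F0; exists B.
  have [B [FB sB]] : exists B, F B /\ [set` s] `<=` B.
    elim: s sF {us} => [|x s IH] sF; first by exists B0.
    have [|B [FB sB]] := IH; first by move=> y ys; apply: sF; rewrite /= in_cons ys orbT.
    have [B' FB' B'x] := sF x (mem_head _ _).
    have [BB'|B'B] := tF _ _ FB FB'.
      by exists B'; split=> // y /=; rewrite in_cons => /orP[/eqP->//|/sB/BB'].
    by exists B; split=> // y /=; rewrite in_cons => /orP[/eqP->|/sB//]; exact: B'B.
  by have [_] := FP _ FB; apply.
exists B; split=> // g Dg; apply: contrapT => ng.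
apply: (Bmax (B `|` [set g])).
  split=> [|h]; first by move=> x; left.
  by apply: ng; apply/spanned_sub/h; right.
split; last exact: independent_add.
by move=> x [/BD //|->].
Qed.

Lemma exchange X Y : independent X -> (forall x, X x -> spanned Y x) -> X #<= Y.
Proof.
move=> iX XY.
pose dom (R : set (N * N)) x := exists y, R (x, y).
pose ran (R : set (N * N)) y := exists x, R (x, y).
pose P (R : set (N * N)) := [/\ forall a b, R (a, b) -> X a /\ Y b,
  forall q r, R q -> R r -> (q.1 = r.1 <-> q.2 = r.2),
  independent [set x | (X x /\ ~ dom R x) \/ ran R x] &
  forall a b, R (a, b) -> X b -> dom R b].
have [F FP tF|R [[PR1 PR2 PR3 PR4] Rmax]] := @Zorn_bigcup _ P.
  have [[R0 FR0]|F0] := pselect (exists R0, F R0); last first.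
    have -> : \bigcup_(R in F) R = set0 by apply/seteqP; split=> // x [R FR]; case: F0; exists R.
    split=> //; apply: independent_sub iX => x [[]//|[]] //.
  split=> [a b [R /FP[h _ _ _] Rab]|q r [R FR Rq] [S FS Sr]|s k us hs|a b [R FR Rab] Xb].
  - exact: h.
  - have [RS|SR] := tF _ _ FR FS.
      by have [_ h _ _] := FP _ FS; apply: h => //; exact: RS.
    by have [_ h _ _] := FP _ FR; apply: h => //; exact: SR.
  - have [R [FR hR]] : exists R, F R /\ forall x, x \in s ->
        (X x /\ ~ dom (\bigcup_(R in F) R) x) \/ ran R x.
      elim: s hs {us} => [|x s IH] hs; first by exists R0.
      have [|R [FR hR]] := IH; first by move=> y ys; apply: hs; rewrite /= in_cons ys orbT.
      have [h|[y [S FS Sy]]] := hs x (mem_head _ _).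
        by exists R; split=> // z; rewrite in_cons => /orP[/eqP->|/hR //]; left.
      have [RS|SR] := tF _ _ FR FS.
        exists S; split=> // z; rewrite in_cons => /orP[/eqP->|/hR[]]; first by right; exists y.
          by left.
        by move=> [w Rw]; right; exists w; exact: RS.
      exists R; split=> // z; rewrite in_cons => /orP[/eqP->|/hR //].
      by right; exists y; exact: SR.
    have [_ _ h _] := FP _ FR; apply: h => // x /hR[[Xx nx]|]; last by right.
    by left; split=> // -[y Ry]; apply: nx; exists y, R.
  - by have [_ _ _ h] := FP _ FR; have [y Ry] := h _ _ Rab Xb; exists y, R.
have total x : X x -> exists y, R (x, y).
  move=> Xx; apply: contrapT => ndx.
  pose Z := [set z | (X z /\ ~ dom R z /\ z <> x) \/ ran R z].
  have nxZ : ~ spanned Z x.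
    case=> l [hl Wl]; have [s [k [us sl E]]] := sum_uniq l.
    have xs : x \notin s.
      apply/negP => /sl[t tl tx]; have := hl t tl; rewrite tx => -[[_ []]//|[w Rw]].
      exact/ndx/(PR4 _ _ Rw).
    have := PR3 (x :: s) (fun z => if z == x then 1 else - k z).
    rewrite /= xs us => /(_ isT) /(_ _ _ x (mem_head _ _)); rewrite eqxx => h.
    have : (p%:Z %| 1)%Z; last by rewrite dvdz1 /= => /eqP e; have := prime_gt1 p_prime; rewrite e.
    apply: h.
      move=> z /=; rewrite in_cons => /orP[/eqP->|/sl[t /hl] ht <-]; first by left.
      by case: ht => [[? []]|]; [left|right].
    rewrite big_cons eqxx mulr1z; move: Wl; rewrite E; congr (W (_ + _)).
    rewrite -sumrN; apply: eq_big_seq => z zs; case: eqP => [e|_]; last by rewrite mulrNz.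
    by rewrite e (negPf xs) in zs.
  have [y [Yy ny]] : exists y, Y y /\ ~ spanned Z y.
    apply: contrapT => h; apply: nxZ; apply: spanned_trans (XY x Xx) _ => y Yy.
    by apply: contrapT => ny; apply: h; exists y.
  have nry : ~ ran R y by move=> r; apply: ny; apply: spanned_sub; right.
  apply: (Rmax (R `|` [set (x, y)])).
    split; first by move=> ?; left.
    by move=> /(_ (x, y) (or_intror erefl)) h; apply: ndx; exists y.
  split.
  - by move=> a b [/PR1 //|[-> ->]].
  - move=> [a b] [a' b'] [Rq|[-> ->]] [Rr|[-> ->]] //=.
    + exact: (PR2 _ _ Rq Rr).
    + split=> e; exfalso; first by apply: ndx; exists b; rewrite -e.
      by apply: nry; exists a; rewrite -e.
    + split=> e; exfalso; first by apply: ndx; exists b'; rewrite e.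
      by apply: nry; exists a'; rewrite e.
  - have iZ : independent Z.
      apply: independent_sub PR3 => z [[Xz [ndz _]]|]; [by left|by right].
    apply: independent_sub (independent_add iZ ny) => z [[Xz ndz]|[w [Rw|[_ ->]]]].
    + left; left; split=> //; split=> [[w Rw]|e]; first by apply: ndz; exists w; left.
      by apply: ndz; exists y; right; rewrite e.
    + by left; right; exists w.
    + by right.
  - move=> a b [Rab /(PR4 _ _ Rab)[w Rw]|[_ ->] Xy]; first by exists w; left.
    have [yx|nyx] := pselect (y = x); first by exists y; right; rewrite /= yx.
    have [[w Rw]|ndy] := pselect (dom R y); first by exists w; left.
    by exfalso; apply: ny; apply: spanned_sub; left.
have /choice[f hf] : forall x, exists y, X x -> R (x, y).
  by move=> x; have [/total[y ?]|nx] := pselect (X x); [exists y|exists 0].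
apply: (card_le_fun (f := f)) => [x Xx|x x' Xx Xx' e].
  by have [] := PR1 _ _ (hf x Xx).
by apply/(PR2 _ _ (hf _ Xx) (hf _ Xx')).
Qed.

End Modular.

(** * Compactness and saturation *)

Section Ultrapower.
Import Quotient.
Local Open Scope quotient_scope.
Variables (X : Type) (N : oagType) (F : set_system X) (FU : UltraFilter F).

Definition funs : zmodType := (X -> N : Type).
Definition null_fun (FU' : UltraFilter F) (f : funs) : bool :=
  `[< F [set x | f x = 0] >].

Lemma null_fun_zmod : zmod_closed (null_fun FU).
Proof.
split=> [|f g]; first by apply/asboolP; apply: filterS filterT.
move=> /asboolP Ff /asboolP Fg; apply/asboolP; apply: filterS (filterI Ff Fg).
by move=> x [/= fx gx]; change (f x - g x = 0); rewrite fx gx subrr.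
Qed.

Definition null_zmod : zmodClosed funs :=
  HB.pack (null_fun FU) (GRing.isZmodClosed.Build funs (null_fun FU) null_fun_zmod).

Definition ultrapower : Type := {quot null_zmod}.
HB.instance Definition _ := GRing.Zmodule.on ultrapower.
HB.instance Definition _ := Choice.on ultrapower.

Definition upi (f : X -> N) : ultrapower := \pi_({quot null_zmod}) f.

Lemma upi_eq f g : upi f = upi g <-> F [set x | f x = g x].
Proof.
have E : null_fun FU ((f : funs) - (g : funs)) = (upi f == upi g) := idealrBE null_zmod f g.
rewrite (rwP eqP) -E; split=> [/asboolP|h].
  by apply: filterS => x /= h; apply: subr0_eq.
by apply/asboolP; apply: filterS h => x /= e; change (f x - g x = 0); rewrite e subrr.
Qed.

Lemma upi_surj (a : ultrapower) : exists f, a = upi f.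
Proof. by exists (repr a); rewrite /upi reprK. Qed.

Lemma upi0 : upi (fun=> 0) = 0.
Proof. by rewrite /upi (_ : (fun=> 0) = 0) // raddf0. Qed.
Lemma upiD f g : upi f + upi g = upi (fun x => f x + g x).
Proof. by rewrite /upi -raddfD. Qed.
Lemma upiN f : - upi f = upi (fun x => - f x).
Proof. by rewrite /upi -raddfN. Qed.
Lemma upiMn f n : upi f *+ n = upi (fun x => f x *+ n).
Proof.
elim: n => [|n IH]; first by rewrite mulr0n -upi0.
by rewrite mulrS IH upiD; congr upi; apply/funext => x; rewrite mulrS.
Qed.

Definition ule (a b : ultrapower) : bool :=
  `[< F [set x | (repr a : X -> N) x <= (repr b : X -> N) x] >].

Lemma repr_upi f : F [set x | f x = (repr (upi f) : X -> N) x].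
Proof. by apply/upi_eq; rewrite {2}/upi reprK. Qed.

Lemma uleE f g : ule (upi f) (upi g) <-> F [set x | f x <= g x].
Proof.
rewrite /ule; split=> [/asboolP h|h]; last apply/asboolP;
  apply: filterS (filterI h (filterI (repr_upi f) (repr_upi g))) => x [/= h' [e1 e2]].
- by rewrite e1 e2.
- by rewrite -e1 -e2.
Qed.

Lemma ule_refl : reflexive ule.
Proof. by move=> a; have [f ->] := upi_surj a; apply/uleE; apply: filterS filterT => x _ /=. Qed.
Lemma ule_anti : antisymmetric ule.
Proof.
move=> a b; have [f ->] := upi_surj a; have [g ->] := upi_surj b => /andP[/uleE h /uleE h'].
apply/upi_eq; apply: filterS (filterI h h') => x [/= h1 h2].
by apply: le_anti; rewrite h1 h2.
Qed.
Lemma ule_trans : transitive ule.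
Proof.
move=> b a c; have [f ->] := upi_surj a; have [g ->] := upi_surj b; have [k ->] := upi_surj c.
move=> /uleE h /uleE h'; apply/uleE; apply: filterS (filterI h h') => x [/= h1 h2].
exact: le_trans h2.
Qed.

HB.instance Definition _ := Order.Le_isPOrder.Build ring_display ultrapower
  ule_refl ule_anti ule_trans.

Lemma ultrapower_total : total (<=%R : rel ultrapower).
Proof.
move=> a b; have [f ->] := upi_surj a; have [g ->] := upi_surj b.
have [h|h] := in_ultra_setVsetC [set x | f x <= g x] FU.
  by apply/orP; left; apply/uleE.
apply/orP; right; apply/uleE; apply: filterS h => x /= /negP; rewrite -oltNge.
exact: ltW.
Qed.

Lemma ultrapower_add (z x y : ultrapower) : x <= y -> z + x <= z + y.
Proof.
have [f ->] := upi_surj x; have [g ->] := upi_surj y; have [h ->] := upi_surj z.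
move=> /uleE hh; rewrite !upiD; apply/uleE; apply: filterS hh => t /=.
by rewrite ole_add2l.
Qed.

HB.instance Definition _ := POrderedZmodule_isOAG.Build ultrapower
  ultrapower_total ultrapower_add.

Lemma upi_lt (f g : X -> N) : (upi f < upi g) <-> F [set x | f x < g x].
Proof.
split=> [h|h].
  have [//|h'] := in_ultra_setVsetC [set x | f x < g x] FU.
  suff : upi g <= upi f by rewrite oleNgt h.
  by apply/uleE; apply: filterS h' => x /= /negP; rewrite -oleNgt.
rewrite oltNge; apply/negP => /uleE h'.
by have [x /= [h1]] := filter_ex (filterI h h'); rewrite oleNgt h1.
Qed.

Lemma one_unique (U : oagType) (u : U) : 0 < u -> (forall y, 0 < y -> u <= y) -> oag_one U = u.
Proof.
move=> u0 hu; rewrite /oag_one; case: xgetP => [x _ [x0 hx]|/(_ u) []//].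
by apply: le_anti; rewrite hx // hu.
Qed.

Lemma upi_one : oag_one ultrapower = upi (fun=> oag_one N).
Proof.
have [o|[o0 ol]] := one_spec N; last first.
  apply: one_unique; first by rewrite -upi0; apply/upi_lt; apply: filterS filterT.
  move=> y; have [f ->] := upi_surj y; rewrite -upi0 => /upi_lt h; apply/uleE.
  by apply: filterS h => x /= /ol.
rewrite o upi0; have [//|[m0 ml]] := one_spec ultrapower; exfalso.
have [f hf] := upi_surj (oag_one ultrapower); rewrite hf in m0 ml.
rewrite -upi0 in m0; have {}m0 := (upi_lt _ _).1 m0.
have hN (a : N) : exists b, 0 < a -> 0 < b /\ b < a.
  have [a0|na] := pselect (0 < a); last by exists 0 => h; case: na.
  apply: contrapT => hn; have := @one_unique N a a0; rewrite o => h.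
  have {}h : 0 = a.
    apply: h => y y0; rewrite oleNgt; apply/negP => ya; apply: hn.
    by exists y.
  by rewrite h ltxx in a0.
have [s hs] := choice hN.
have : 0 < upi (s \o f).
  by rewrite -upi0; apply/upi_lt; apply: filterS m0 => x /= /hs[].
move=> /ml; rewrite oleNgt => /negP; apply.
by apply/upi_lt; apply: filterS m0 => x /= /hs[].
Qed.

Lemma upi_teval (V : Type) (e : V -> X -> N) (t : term V) :
  teval (fun v => upi (e v)) t = upi (fun x => teval (e^~ x) t).
Proof.
elim: t => [v|||t IH t' IH'|t IH] /=.
- by [].
- by rewrite upi0.
- exact: upi_one.
- by rewrite IH IH' upiD.
- by rewrite IH upiN.
Qed.

Theorem los (V : Type) (e : V -> X -> N) (phi : formula V) :
  sat (fun v => upi (e v)) phi <-> F [set x | sat (e^~ x) phi].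
Proof.
elim: phi e => {V} V.
- by move=> t t' e /=; rewrite !upi_teval upi_eq.
- by move=> t t' e /=; rewrite !upi_teval upi_lt.
- move=> n t t' e /=; rewrite /oag_cong !upi_teval upiN upiD; split=> [[z]|h].
    have [f ->] := upi_surj z; rewrite upiMn => /upi_eq h.
    by apply: filterS h => x /= h; exists (f x).
  have /choice[f hf] : forall x, exists z, sat (e^~ x) (fCong n t t') ->
      teval (e^~ x) t - teval (e^~ x) t' = z *+ n.
    move=> x; have [[z hz]|nh] := pselect (sat (e^~ x) (fCong n t t')); first by exists z.
    by exists 0 => /nh.
  exists (upi f); rewrite upiMn; apply/upi_eq; apply: filterS h => x /= h; exact: hf.
- move=> phi IH e /=; rewrite IH; split=> h.
    by have [//|] := in_ultra_setVsetC [set x | sat (e^~ x) phi] FU.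
  by move=> h'; have [x [/= ]] := filter_ex (filterI h h').
- move=> phi IH psi IH' e /=; rewrite IH IH'; split=> [[h h']|h].
    exact: filterI.
  by split; apply: filterS h => x [].
- move=> phi IH e; rewrite sat_fEx; split=> [[z]|h].
    have [f ->] := upi_surj z.
    have -> : oscons (fun v => upi (e v)) (upi f) =
      (fun v => upi ((fun v : option V => if v is Some w then e w else f) v)) by apply/funext => -[].
    move=> /IH h; apply: filterS h => x; rewrite /= => h; exists (f x).
    by move: h; congr (sat _ _); apply/funext => -[].
  have /choice[f hf] : forall x, exists z, sat (e^~ x) (fEx phi) -> sat (oscons (e^~ x) z) phi.
    move=> x; have [[z hz]|nh] := pselect (sat (e^~ x) (fEx phi)); first by exists z.
    by exists 0 => /nh.
  exists (upi f).
  have -> : oscons (fun v => upi (e v)) (upi f) =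
      (fun v => upi ((fun v : option V => if v is Some w then e w else f) v)) by apply/funext => -[].
  apply/IH; apply: filterS h => x /= /hf.
  by congr (sat _ _); apply/funext => -[].
Qed.

End Ultrapower.

Definition finsat (U : oagType) (V P : Type) (a : P -> U) (r : set (formula (V + P))) : Prop :=
  forall s, (forall phi, List.In phi s -> r phi) ->
    exists c : V -> U, forall phi, List.In phi s -> sat (copair c a) phi.

Theorem compactness (N : oagType) (J : Type) (S : set (formula (J + N))) :
  finsat id S -> exists (M : oagType) (k : N -> M) (y : J -> M),
    elementary k /\ realizes y k S.
Proof.
move=> hS; pose X := seq (formula (J + N)).
pose up (s : X) : set X := [set s' | forall phi, List.In phi s -> List.In phi s'].
pose F0 : set_system X := [set A | exists s, up s `<=` A].
have F0P : ProperFilter F0.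
  apply: Build_ProperFilter_ex.
    by move=> A [s hs]; exists s; apply: hs.
  split.
  - by exists [::].
  - move=> A B [s hs] [s' hs']; exists (s ++ s') => t ht; split.
      by apply: hs => phi hphi; apply: ht; apply/In_cat; left.
    by apply: hs' => phi hphi; apply: ht; apply/In_cat; right.
  - by move=> A B AB [s hs]; exists s; exact: subset_trans AB.
have [F [FU F0F]] := ultraFilterLemma F0P.
have /choice[y hy] : forall s : X, exists c : J -> N,
    forall phi, List.In phi s -> S phi -> sat (copair c id) phi.
  move=> s; have [|c hc] := hS [seq phi <- s | `[< S phi >]].
    by move=> phi /List.filter_In[_ /asboolP].
  by exists c => phi hphi Sphi; apply: hc; apply/List.filter_In; split=> //; apply/asboolP.
pose e (v : J + N) (s : X) : N := match v with inl j => y s j | inr a => a end.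
exists (ultrapower N FU), (fun a => upi FU (e (inr a))), (fun j => upi FU (e (inl j))).
split=> [n phi a|phi Sphi].
  have -> : (fun b => upi FU (e (inr b))) \o a = (fun i => upi FU ((fun i (s : X) => a i) i)) by [].
  rewrite los; split=> [h|/filter_ex[] //].
  by apply: filterS filterT => s _.
have -> : copair (fun j => upi FU (e (inl j))) (fun b => upi FU (e (inr b))) = (fun v => upi FU (e v)).
  by apply/funext => -[].
apply/los; apply: (@filterS _ _ _ (up [:: phi])).
  move=> s /(_ phi (or_introl erefl)) /hy /(_ Sphi).
  by congr (sat _ _); apply/funext => -[].
by apply: F0F; exists [:: phi].
Qed.

Lemma In_codom n (T : Type) (s : 'I_n -> T) x :
  List.In x [seq s i | i <- enum 'I_n] <-> exists i, s i = x.
Proof.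
rewrite List.in_map_iff; split=> [[i [<- _]]|[i <-]]; first by exists i.
exists i; split=> //; have := mem_enum 'I_n i; rewrite inE.
by elim: (enum 'I_n) => //= j l IH; rewrite in_cons => /orP[/eqP->|/IH]; [left|right].
Qed.

Lemma In_nth (T : Type) (d x : T) s : List.In x s <-> exists i : 'I_(size s), nth d s i = x.
Proof.
split=> [|[[i lti] /= <-]].
  elim: s => //= y s IH [->|/IH[i hi]]; first by exists ord0.
  by exists (lift ord0 i).
elim: s i lti => // y s IH [|i] lti /=; first by left.
by right; exact: IH.
Qed.

Lemma complete_typeE (U : oagType) (V P : Type) (a : P -> U) (r : set (formula (V + P))) :
  complete_type a r <-> finsat a r /\ forall phi, r phi \/ r (fNot phi).
Proof.
split=> -[h hc]; split=> //; [move=> s hs|move=> n s hs].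
  pose d : formula (V + P) := fEq (tZero _) (tZero _).
  have [|c hc'] := h (size s) (fun i => nth d s i).
    by move=> i; apply: hs; apply/(In_nth d); exists i.
  by exists c => phi /(In_nth d)[i <-].
have [|c hc'] := h [seq s i | i <- enum 'I_n]; first by move=> phi /In_codom[i <-].
by exists c => i; apply: hc'; apply/In_codom; exists i.
Qed.

Section Complete.
Variables (U : oagType) (V P : Type) (a : P -> U).
Implicit Types (r : set (formula (V + P))).

Lemma complete_not r phi : complete_type a r -> (r (fNot phi) <-> ~ r phi).
Proof.
move=> /complete_typeE[h hc]; split=> [rn rp|np]; last by case: (hc phi).
have [|c hc'] := h [:: phi; fNot phi]; first by move=> psi [<-|[<-|]].
by have /= := hc' (fNot phi) (or_intror (or_introl erefl)); apply; apply: hc'; left.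
Qed.

Lemma complete_realizes (N : oagType) (j : U -> N) (c : V -> N) r : complete_type a r ->
  realizes c (j \o a) r -> forall phi, r phi <-> sat (copair c (j \o a)) phi.
Proof.
move=> hr real phi; split=> [rp|s]; first exact: real.
by apply: contrapT => np; have /(complete_not _ hr) rn := np; exact: (real _ rn).
Qed.

Lemma finsat_add r phi :
  (forall s, (forall psi, List.In psi s -> r psi) ->
    exists c : V -> U, sat (copair c a) phi /\ forall psi, List.In psi s -> sat (copair c a) psi) ->
  finsat a (r `|` [set phi]).
Proof.
move=> h s hs.
have [s' [hs' sub]] : exists s', (forall psi, List.In psi s' -> r psi) /\
    forall psi, List.In psi s -> List.In psi s' \/ psi = phi.
  elim: s hs => [|psi s IH] hs; first by exists [::].
  have [|s' [h1 h2]] := IH; first by move=> psi' hp; apply: hs; right.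
  have [rp|->] := hs psi (or_introl erefl).
    exists (psi :: s'); split=> [psi' [<-|/h1]//|psi' [->|/h2[]]]; [by left; left|by left; right|by right].
  by exists s'; split=> // psi' [->|/h2//]; right.
have [c [cphi cs]] := h s' hs'.
by exists c => psi /sub[/cs|->].
Qed.

Lemma lindenbaum r : finsat a r -> exists2 r', r `<=` r' & complete_type a r'.
Proof.
move=> fr.
have [F FP tF|S [PS Smax]] := @Zorn_bigcup _ [set S | finsat a (r `|` S)].
  move=> s hs.
  have [[S0 FS0]|F0] := pselect (exists S, F S); last first.
    by apply: fr => phi /hs[//|[S FS]]; case: F0; exists S.
  have [S [FS hS]] : exists S, F S /\ forall phi, List.In phi s -> (r `|` S) phi.
    elim: s hs => [|phi s IH] hs; first by exists S0.
    have [|S [FS hS]] := IH; first by move=> psi hpsi; apply: hs; right.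
    have [rphi|[S' FS' S'phi]] := hs phi (or_introl erefl).
      by exists S; split=> // psi [<-|/hS]; first by left.
    have [SS|SS] := tF _ _ FS FS'.
      by exists S'; split=> // psi [<-|/hS[]]; [right|left|right; exact: SS].
    by exists S; split=> // psi [<-|/hS //]; right; exact: SS.
  exact: FP hS.
exists (r `|` S); first by move=> phi; left.
apply/complete_typeE; split=> // phi; apply: contrapT => /not_orP[n1 n2].
have H psi : ~ (r `|` S) psi -> exists s, (forall psi, List.In psi s -> (r `|` S) psi) /\
    forall c : V -> U, (forall psi, List.In psi s -> sat (copair c a) psi) -> ~ sat (copair c a) psi.
  move=> npsi; apply: contrapT => hn; apply: (Smax (S `|` [set psi])).
    split=> [x|h]; first by left.
    by apply: npsi; right; apply: h; right.
  rewrite /= setUA; apply: finsat_add => s hs; apply: contrapT => h'.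
  apply: hn; exists s; split=> // c hc hpsi; apply: h'; exists c; split=> //.
have [s [hs ns]] := H _ n1; have [s' [hs' ns']] := H _ n2.
have [|c hc] := PS (s ++ s'); first by move=> psi /In_cat[/hs|/hs'].
have c1 : ~ sat (copair c a) phi by apply: ns => psi hpsi; apply: hc; apply/In_cat; left.
have := ns' c; apply; last exact: c1.
by move=> psi hpsi; apply: hc; apply/In_cat; right.
Qed.

End Complete.

Lemma saturated_family (K : Type) (U : oagType) (satU : saturated K U) n (P : Type)
    (smP : small K [set: P]) (a : P -> U) (r : set (formula ('I_n + P))) :
  finsat a r -> exists c : 'I_n -> U, realizes c a r.
Proof.
move=> fr; pose A := range a.
have aA p : a p \in A by apply/mem_set; exists p.
pose a' (p : P) : A := SigSub (aA p).
pose f : 'I_n + P -> 'I_n + A := copair inl (inr \o a').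
have E (c : 'I_n -> U) : copair c (val : A -> U) \o f = copair c a by apply/funext => -[].
have [|r' sub cr] := @lindenbaum U 'I_n A val (rename f @` r).
  move=> s hs.
  have [s' [hs' es]] : exists s', (forall psi, List.In psi s' -> r psi) /\ s = map (rename f) s'.
    elim: s hs => [|psi s IH] hs; first by exists [::].
    have [|s' [h1 ->]] := IH; first by move=> psi' hp; apply: hs; right.
    have [psi0 rpsi0 e] := hs psi (or_introl erefl).
    by exists (psi0 :: s'); split=> [psi' [<-//|/h1]|] //=; rewrite e.
  have [c hc] := fr s' hs'; exists c => phi; rewrite es => /List.in_map_iff[psi [<- /hc]].
  by rewrite sat_rename E.
have [c hc] := satU A n r' (small_range a smP) cr.
exists c => phi rphi; have /hc : r' (rename f phi) by apply: sub; exists phi.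
by rewrite sat_rename E.
Qed.

Section Saturation.
Variables (K : Type) (K_nat : small K [set: nat]) (K_lim : strong_limit K).
Variables (U : oagType) (satU : saturated K U).

Lemma saturated_cut (P P' : Type) (smP : small K [set: P]) (smP' : small K [set: P'])
    (lo : P -> U) (hi : P' -> U) (cg : bool) (z : U) :
  (forall (s : seq P) (s' : seq P') m, (0 < m)%N -> exists x,
    [/\ forall i, List.In i s -> lo i < x, forall i, List.In i s' -> x < hi i & cg -> divs m (x - z)]) ->
  exists x, [/\ forall i, lo i < x, forall i, x < hi i & cg -> forall m, (0 < m)%N -> divs m (x - z)].
Proof.
move=> h; pose Q := (P + P' + unit)%type.
pose a (q : Q) : U := match q with inl (inl i) => lo i | inl (inr i) => hi i | inr _ => z end.
pose x : 'I_1 + Q := inl ord0.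
pose flo i : formula ('I_1 + Q) := fLt (tVar (inr (inl (inl i)))) (tVar x).
pose fhi i : formula ('I_1 + Q) := fLt (tVar x) (tVar (inr (inl (inr i)))).
pose fc m : formula ('I_1 + Q) := fCong m (tVar x) (tVar (inr (inr tt))).
pose r : set (formula ('I_1 + Q)) := [set phi | (exists i, phi = flo i) \/ (exists i, phi = fhi i) \/
   cg /\ exists2 m, (0 < m)%N & phi = fc m].
have smQ : small K [set: Q] by apply: small_sum => //; [exact: small_sum|exact: small_count].
have [|c hc] := @saturated_family K U satU 1 Q smQ a r.
  move=> s hs.
  have [s1 [s2 [m [m0 hh]]]] : exists (s1 : seq P) (s2 : seq P') m, (0 < m)%N /\ forall c : 'I_1 -> U,
     (forall i, List.In i s1 -> lo i < c ord0) -> (forall i, List.In i s2 -> c ord0 < hi i) ->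
     (cg -> divs m (c ord0 - z)) ->
     forall phi, List.In phi s -> sat (copair c a) phi.
    elim: s hs => [|phi s IH] hs; first by exists [::], [::], 1%N.
    have [|s1 [s2 [m [m0 hm]]]] := IH; first by move=> psi hpsi; apply: hs; right.
    have [[i e]|[[i e]|[hcg [d d0 e]]]] := hs phi (or_introl erefl).
    - exists (i :: s1), s2, m; split=> // c hc hc' hz psi [<-|].
        by rewrite e; exact: hc i (or_introl erefl).
      by apply: hm => // j hj; apply: hc; right.
    - exists s1, (i :: s2), m; split=> // c hc hc' hz psi [<-|].
        by rewrite e; exact: hc' i (or_introl erefl).
      by apply: hm => // j hj; apply: hc'; right.
    - exists s1, s2, (m * d)%N; rewrite muln_gt0 m0; split=> // c hc hc' hz psi [<-|].
        by rewrite e; have [w hw] := divs_dvd (dvdn_mull m (dvdnn d)) (hz hcg); exists w.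
      apply: hm => // _; apply: divs_dvd (hz hcg); exact: dvdn_mulr.
  have [y [hy hy' hz]] := h s1 s2 m m0; exists (fun=> y); exact: hh.
exists (c ord0); split=> [i|i|hcg m m0].
- by have := hc (flo i); apply; left; exists i.
- by have := hc (fhi i); apply; right; left; exists i.
have [w hw] : sat (copair c a) (fc m) by apply: hc; right; right; split=> //; exists m.
by exists w.
Qed.

Lemma saturated_avoid (P : Type) (smP : small K [set: P]) (a : P -> U) (p : nat) :
  (forall s : seq P, exists x, forall i, List.In i s -> ~ divs p (x - a i)) ->
  exists x, forall i, ~ divs p (x - a i).
Proof.
move=> h; pose f i : formula ('I_1 + P) := fNot (fCong p (tVar (inl ord0)) (tVar (inr i))).
have [|c hc] := @saturated_family K U satU 1 P smP a (range f).
  move=> s hs; have [s' e] : exists s', s = map f s'.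
    elim: s hs => [|psi s IH] hs; first by exists [::].
    have [|s' ->] := IH; first by move=> psi' hp; apply: hs; right.
    by have [i _ <-] := hs psi (or_introl erefl); exists (i :: s').
  have [x hx] := h s'; exists (fun=> x) => phi; rewrite e => /List.in_map_iff[i [<- /hx]].
  by [].
by exists (c ord0) => i; have := hc (f i); apply; exists i.
Qed.

End Saturation.

(** * Elementary extensions *)

Section Elementary.
Variables (U N : oagType) (j : U -> N) (elj : elementary j).

Lemma elementary_same_sat (V : Type) (e : V -> U) : same_sat e (j \o e).
Proof. by move=> phi; exact: elementary_sat. Qed.

Lemma elementaryD x y : j (x + y) = j x + j y.
Proof.
have := same_sat_eq0 (elementary_same_sat (id : U -> U))
  (ladd (lvar (x + y)) (lscale (-1) (ladd (lvar x) (lvar y)))).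
rewrite !leval_add !leval_scale !leval_add !leval_var /= => -[h _].
by apply: subr0_eq; rewrite -[RHS]h; zabel.
Qed.
Lemma elementaryN x : j (- x) = - j x.
Proof. by apply/eqP; rewrite -addr_eq0 -elementaryD addNr elementary0. Qed.
Lemma elementaryB x y : j (x - y) = j x - j y.
Proof. by rewrite elementaryD elementaryN. Qed.
Lemma elementaryMn x n : j (x *+ n) = j x *+ n.
Proof. by elim: n => [|n IH]; rewrite ?mulr0n ?elementary0 // !mulrS elementaryD IH. Qed.
Lemma elementaryMz x k : j (x *~ k) = j x *~ k.
Proof. by case: k => n; rewrite ?NegzE ?mulrNz ?elementaryN -?pmulrn elementaryMn. Qed.
Lemma elementary_one : j (oag_one U) = oag_one N.
Proof.
have := same_sat_eq0 (elementary_same_sat (id : U -> U))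
  (ladd (lvar (oag_one U)) (lscale (-1) (lone U))).
rewrite !leval_add !leval_scale !leval_one !leval_var /= => -[h _].
by apply: subr0_eq; rewrite -[RHS]h; zabel.
Qed.
Lemma elementary_gt0 x : (0 < j x) = (0 < x).
Proof.
have := same_sat_pos (elementary_same_sat (id : U -> U)) (lvar x).
by rewrite !leval_var /= => ->.
Qed.
Lemma elementary_lt x y : (j x < j y) = (x < y).
Proof. by rewrite olt_sub -elementaryB elementary_gt0 -olt_sub. Qed.
Lemma elementary_le x y : (j x <= j y) = (x <= y).
Proof. by rewrite !oleNgt elementary_lt. Qed.
Lemma elementary_inj : injective j.
Proof. by move=> x y e; apply: le_anti; rewrite -!elementary_le e lexx. Qed.
Lemma elementary_divs n x : divs n (j x) <-> divs n x.
Proof.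
have := same_sat_divs (elementary_same_sat (id : U -> U)) n (lvar x).
by rewrite !leval_var /= => ->.
Qed.
Lemma elementary_leval (V : Type) (e : V -> U) l : leval (j \o e) l = j (leval e l).
Proof.
case: l => s k; rewrite /leval elementaryD elementaryMz elementary_one; congr (_ + _).
elim: s => [|t s IH]; first by rewrite !big_nil elementary0.
by rewrite /= !big_cons elementaryD elementaryMz IH.
Qed.
Lemma elementary_pure x n : (0 < n)%N -> range j (x *+ n) -> range j x.
Proof.
move=> n0 [u _ hu]; have [w hw] : divs n u by apply/elementary_divs; exists x.
by exists w => //; apply: (omulrnI n0); rewrite -elementaryMn -hw.
Qed.
End Elementary.

Lemma lin_option (W : Type) (t : lin (option W)) : exists (k : int) (l : lin W),
  forall (U : oagType) (e : W -> U) x, leval (oscons e x) t = x *~ k + leval e l.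
Proof.
case: t => s c; elim: s => [|[b x] s [k [l IH]]].
  by exists 0, ([::], c) => U e x; rewrite /leval !big_nil; zabel.
have E (U : oagType) (e : option W -> U) : leval e ((b, x) :: s, c) = e b *~ x + leval e (s, c).
  by rewrite /leval big_cons addrA.
case: b E => [w|] E.
- exists k, (ladd (lscale x (lvar w)) l) => U e y.
  by rewrite E IH leval_add leval_scale leval_var /=; zabel.
- by exists (k + x), l => U e y; rewrite E IH /=; zabel.
Qed.

Lemma lin_sum (J W : Type) (t : lin (J + W)) : exists (l : lin J) (l' : lin W),
  forall (U : oagType) (e : J -> U) (e' : W -> U),
    leval (copair e e') t = leval e l + leval e' l' /\ l.2 = 0.
Proof.
case: t => s c; elim: s => [|[b x] s [l [l' IH]]].
  by exists (lzero _), ([::], c) => U e e'; rewrite leval_zero /leval !big_nil /=; split=> //; zabel.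
have E (U : oagType) (e : J + W -> U) : leval e ((b, x) :: s, c) = e b *~ x + leval e (s, c).
  by rewrite /leval big_cons addrA.
case: b E => w E.
- exists (ladd (lscale x (lvar w)) l), l' => U e e'; have [h hl] := IH U e e'.
  by rewrite E h leval_add leval_scale leval_var /= addrA hl mul0r.
- exists l, (ladd (lscale x (lvar w)) l') => U e e'; have [h hl] := IH U e e'.
  by rewrite E h leval_add leval_scale leval_var /= addrCA.
Qed.

Section HullOrder.
Variables (M : oagType) (V : Type) (e : V -> M).

Lemma hull_pure_z a k : k != 0 -> hull e (a *~ k) -> hull e a.
Proof.
case: k => n k0; first by rewrite -pmulrn; apply: hull_pure; rewrite lt0n.
by rewrite NegzE mulrNz -pmulrn => /hullN; rewrite opprK; exact: hull_pure.
Qed.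

Lemma notin_hull_far w k l : ~ hull e w -> k != 0 ->
  (0 < w *~ k + leval e l /\ forall i, oag_one M *+ i < w *~ k + leval e l) \/
  (w *~ k + leval e l < 0 /\ forall i, oag_one M *+ i < - (w *~ k + leval e l)).
Proof.
move=> nw k0; set y := w *~ k + leval e l.
have ho i : hull e (oag_one M *+ i) by rewrite -(leval_one e); apply/hull_muln/hull_leval.
have ny : ~ hull e y.
  move=> hy; apply: nw; apply: (hull_pure_z k0).
  by rewrite -(addrK (leval e l) (w *~ k)); apply: hullB => //; exact: hull_leval.
have far z : ~ hull e z -> 0 < z -> forall i, oag_one M *+ i < z.
  move=> nz z0 i; rewrite oltNge; apply/negP => zi.
  have [o|[o0 _]] := one_spec M.
    by rewrite o mul0rn oleNgt z0 in zi.
  by have [i' _ e'] := between_ones o0 (ltW z0) zi; apply: nz; rewrite e'.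
have [y0|y0|y0] := otrichotomy 0 y.
- by left; split=> //; exact: far.
- by case: ny; rewrite -y0; exact: hull0.
- right; split=> //; apply: far; last by rewrite -sub0r -olt_sub.
  by move=> /hullN; rewrite opprK.
Qed.

Variables (G : oagType) (regG : regular_oag G) (mM : models (theory G) M).

Lemma signs_near w (L : seq (int * lin V)) B : ~ hull e w -> exists eps,
  oag_one M *+ B < eps /\ forall x, w < x -> x < w + eps -> forall k l, List.In (k, l) L ->
    (0 < x *~ k + leval e l) = (0 < w *~ k + leval e l) /\
    (x *~ k + leval e l == 0) = (w *~ k + leval e l == 0).
Proof.
move=> nw.
pose far (k : int) l := let y := w *~ k + leval e l in if 0 < y then y else - y.
pose s := [seq (`|t.1|%N, far t.1 t.2) | t <- L & t.1 != 0].
have [||eps [h1 h2]] := @room G regG M mM B s.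
- move=> n a /List.in_map_iff[[k l] [[<- <-] /List.filter_In[_ k0]]]; split.
    by rewrite absz_gt0.
  rewrite /far /=; have [[y0 hy]|[y0 hy]] := notin_hull_far l nw k0; first by rewrite y0.
  by rewrite oltNge (ltW y0).
- have [w0|w0|w0] := otrichotomy 0 w; first by exists w.
    by case: nw; rewrite -w0; exact: hull0.
  by exists (- w); rewrite -sub0r -olt_sub.
exists eps; split=> // x wx xe k l hkl.
have [->|k0] := eqVneq k 0; first by rewrite !mulr0z.
have hs : List.In (`|k|%N, far k l) s.
  by apply/List.in_map_iff; exists (k, l); split=> //; apply/List.filter_In.
have := h2 _ _ hs; rewrite /far; set y := w *~ k + leval e l => hy.
have hx : nn true (x - w) := nn_lt wx.
have hx' : nn false ((w + eps - x) *+ `|k|) := nnW (nnM _ (nn_lt xe)).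
have hx'' : nn false ((x - w) *+ `|k|) := nnW (nnM _ hx).
have [[y0 _]|[y0 _]] := notin_hull_far l nw k0; rewrite -/y in y0.
- rewrite y0 in hy.
  have : 0 < x *~ k + leval e l.
    rewrite /y in hy y0; case: (k) hy hx' hx'' y0 => n /= hy hx' hx'' y0; first by olin (y0, hx'').
    by rewrite NegzE in hy *; olin (hy, hx').
  by move=> h; rewrite h y0 (gt_eqF h) (gt_eqF y0).
- have y0' : (0 < y) = false by rewrite oltNge (ltW y0).
  rewrite y0' in hy.
  have : x *~ k + leval e l < 0.
    rewrite /y in hy y0; case: (k) hy hx' hx'' y0 => n /= hy hx' hx'' y0; first by olin (hy, hx').
    by rewrite NegzE in y0 *; olin (y0, hx'').
  by move=> h; rewrite y0' (lt_eqF h) (lt_eqF y0) oltNge (ltW h).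
Qed.

End HullOrder.

Definition fills (U N : oagType) (j : U -> N) (H : set U) (g : N) : Prop :=
  (forall h, H h -> j h < g) /\ forall u, (forall h, H h -> h < u) -> g < j u.

Section Extension.
Variables (G : oagType) (regG : regular_oag G).
Variables (U N : oagType) (j : U -> N) (elj : elementary j).
Variables (mN : models (theory G) N).
Variables (I : Type) (c : I -> N).

Let e : I + U -> N := copair c j.
Let S : set N := range j `|` range c.

Lemma env_in_gens v : S (e v).
Proof. by case: v => [i|u]; [right; exists i|left; exists u]. Qed.

Lemma generatedE : generated S = [set leval e l | l in setT].
Proof.
apply/seteqP; split=> [x|_ [l _ <-]].
  apply; split; last first.
    move=> _ [[u _ <-]|[i _ <-]].
    - by exists (lvar (inr u)) => //; rewrite leval_var.
    - by exists (lvar (inl i)) => //; rewrite leval_var.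
  split=> [|_ _ [l _ <-] [l' _ <-]|_ [l _ <-]].
  - by exists (lzero _) => //; rewrite leval_zero.
  - by exists (ladd l l') => //; rewrite leval_add.
  - by exists (lscale (-1) l) => //; rewrite leval_opp.
move=> A [[A0 AD AN] SA].
have AZ x k : A x -> A (x *~ k).
  move=> Ax; have H n : A (x *+ n) by elim: n => [|n IH]; rewrite ?mulr0n // mulrS; exact: AD.
  by case: k => n; [exact: H|rewrite NegzE mulrNz; apply/AN/H].
apply: (AD); last by apply: (AZ); rewrite -(elementary_one elj); apply: SA; left; exists (oag_one U).
case: l => s k /=; elim: s => [|t s IH]; first by rewrite big_nil.
by rewrite big_cons; apply: (AD) => //; apply/AZ/SA/env_in_gens.
Qed.

Lemma calHE H : calH j c H <-> convex_subgroup H /\ exists l, fills j H (leval e l).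
Proof.
rewrite /calH /=; split=> -[cH [g h]]; split=> //.
  by case: h; rewrite -/S generatedE => -[l _ <-] h1 h2; exists l.
by exists (leval e g); case: h => h1 h2; split=> //; rewrite -/S generatedE; exists g.
Qed.

Lemma dclE : dcl S = hull e.
Proof.
apply/seteqP; split=> [d [n [phi [b [Sb hb]]]]|d [m [l [m0 hm]]]]; last first.
  have [n [f [g fgK]]] := finite_support [seq t.1 | t <- l.1].
  pose psi : formula (option 'I_n.+1) := fZero (ladd (lscale m (lvar None)) (lscale (-1) (lmap (Some \o f) l))).
  exists n.+1, psi, (oenv g e); split=> [i|x].
    rewrite /oenv; case: (g i) => [v|]; first exact: env_in_gens.
    by left; exists 0 => //; rewrite (elementary0 elj).
  rewrite sat_fZero leval_add leval_opp leval_scale leval_var leval_map.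
  have -> : leval ((fun v => if v is Some i then oenv g e i else x) \o (Some \o f)) l = leval e l.
    rewrite /leval; congr (_ + _); case: (l) fgK => s k /=.
    elim: s => [|t s IH] fgK; first by rewrite !big_nil.
    rewrite !big_cons IH; last by move=> v hv; apply: fgK; right.
    by congr (_ *~ _ + _); rewrite /= /oenv fgK //; left.
  rewrite -hm; split=> [h|->]; last by zabel.
  by apply: (omulrnI m0); apply: subr0_eq; rewrite -[RHS]h; zabel.
apply: contrapT => nd.
have [ts [m [m0 hts]]] := regular_data regG phi.
have /choice[F hF] : forall t : lin (option 'I_n), exists kl : int * lin 'I_n,
    forall (U : oagType) (e : 'I_n -> U) x, leval (oscons e x) t = x *~ kl.1 + leval e kl.2.
  by move=> t; have [k [l h]] := lin_option t; exists (k, l).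
have nd' : ~ hull b d.
  case=> q [l [q0 hq]]; apply: nd; apply: (hull_pure q0); rewrite hq.
  have hb' i : hull e (b i).
    have [[u _ <-]|[i' _ <-]] := Sb i; first exact: (hull_var e (inr u)).
    exact: (hull_var e (inl i')).
  apply: hullD; last by rewrite -(leval_one e); apply/hull_mulz/hull_leval.
  case: l {hq} => s k /=; elim: s => [|t s IH]; first by rewrite big_nil; exact: hull0.
  by rewrite big_cons; apply: hullD => //; exact: hull_mulz.
have [B hB] := gap_coset regG mN m0.
have [eps [eps0 heps]] := signs_near regG mN [seq F t | t <- ts] B nd'.
have [|x [dx [xeps hx]]] := hB d (d + eps) d; first by olin eps0.
have [dx' _] : x = d /\ True; last by rewrite dx' ltxx in dx.
split=> //; apply/hb; apply/(hts N N mN mN (oscons b x) (oscons b d)); last exact/hb.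
move=> t ht; rewrite !hF; have := List.in_map F _ _ ht; rewrite [F t]surjective_pairing => /(heps x dx xeps _ _) [hs1 hs2].
rewrite hs1 hs2; split=> // n' n'0 n'm; apply: divs_cong.
have := divs_mulz (F t).1 (divs_dvd n'm hx); by congr divs; zabel.
Qed.
End Extension.

Section Kappa.
Variables (G : oagType) (regG : regular_oag G).
Variables (U N : oagType) (j : U -> N) (elj : elementary j).
Variables (mN : models (theory G) N).

Definition mod_base (p : nat) : set N := [set g | exists u x, g = j u + x *+ p].

Lemma mod_base0 p : mod_base p 0.
Proof. by exists 0, 0; rewrite (elementary0 elj) mul0rn addr0. Qed.
Lemma mod_baseD p x y : mod_base p x -> mod_base p y -> mod_base p (x + y).
Proof.
move=> [u [a ->]] [v [b ->]]; exists (u + v), (a + b).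
by rewrite (elementaryD elj); zabel.
Qed.
Lemma mod_baseN p x : mod_base p x -> mod_base p (- x).
Proof. by move=> [u [a ->]]; exists (- u), (- a); rewrite (elementaryN elj); zabel. Qed.
Lemma mod_base_mul p x : mod_base p (x *+ p).
Proof. by exists 0, x; rewrite (elementary0 elj) add0r. Qed.
Lemma mod_base_range p u : mod_base p (j u).
Proof. by exists u, 0; rewrite mul0rn addr0. Qed.

Variables (I : Type) (c : I -> N).
Let e : I + U -> N := copair c j.

Lemma hull_range u : hull e (j u).
Proof. exact: (hull_var e (inr u)). Qed.

Section Prime.
Variables (p : nat) (p_prime : prime p).

Lemma quotient_basisE B :
  quotient_basis p (dcl (range j `|` range c)) (range j) B <->
  [/\ B `<=` hull e, independent p (mod_base p) B & hull e `<=` spanned (mod_base p) B].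
Proof.
have p0 := prime_gt0 p_prime.
rewrite /quotient_basis (dclE regG elj mN c) -/e; split=> -[Be h1 h2]; split=> //.
- move=> s k us sB [u [x E]] b bs.
  apply: (h2 s k (j u) x us sB _ _ E b bs); first by exists u.
  apply: (hull_pure p0); rewrite -(addKr (j u) (x *+ p)) -E addrC.
  apply: hullB; last exact: hull_range.
  by apply: hull_sum => b' /sB/Be; exact: hull_mulz.
- move=> g /h1[s [k [w [d' [sB [u _ <-] hd' E]]]]].
  exists [seq (b, k b) | b <- s]; split=> [t /mapP[b /sB ? ->] //|].
  by rewrite big_map /=; exists u, d'; rewrite E; zabel.
- move=> d /[dup] hd /h2[l [hl [u [x E]]]].
  have [s [k [us sl E']]] := sum_uniq l; exists s, k, (j u), x.
  have sB : [set` s] `<=` B by move=> b /sl[t /hl ht <-].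
  have rj : range j (j u) by exists u.
  split=> //.
    apply: (hull_pure p0); rewrite -(addKr (j u) (x *+ p)) -E E' addrC.
    apply: hullB; last exact: hull_range.
    apply: hullB => //; apply: hull_sum => b /sB/Be; exact: hull_mulz.
  by rewrite -E' -addrA -E; zabel.
- move=> s k w d' us sB [u _ <-] hd' E b bs.
  by apply: (h1 s k us sB _ b bs); exists u, d'.
Qed.

Lemma kappaP : [/\ kappa j c p `<=` hull e, independent p (mod_base p) (kappa j c p)
  & hull e `<=` spanned (mod_base p) (kappa j c p)].
Proof.
apply/quotient_basisE; rewrite /kappa.
have [B hB] : exists B, quotient_basis p (dcl (range j `|` range c)) (range j) B.
  have [B hB] := basis_exists p_prime (mod_base0 p) (@mod_baseD p) (@mod_baseN p) (@mod_base_mul p) (hull e).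
  by exists B; apply/quotient_basisE.
exact: (@xgetPex _ set0 [set B | quotient_basis p (dcl (range j `|` range c)) (range j) B] (ex_intro _ B hB)).
Qed.

Lemma independent_pow B : B `<=` hull e -> independent p (mod_base p) B ->
  forall i (s : seq N) k, uniq s -> [set` s] `<=` B ->
  mod_base (p ^ i) (\sum_(b <- s) b *~ k b) -> forall b, b \in s -> ((p ^ i)%N%:Z %| k b)%Z.
Proof.
move=> Be iB; elim=> [|i IH] s k us sB; first by move=> _ b _; exact: dvd1z.
move=> [u [x E]] b bs.
have pi0 : (0 < p ^ i)%N by rewrite expn_gt0 prime_gt0.
have dv : forall b, b \in s -> ((p ^ i)%N%:Z %| k b)%Z.
  by apply: IH => //; exists u, (x *+ p); rewrite E -mulrnA -expnS.
pose k' b := (k b %/ (p ^ i)%N%:Z)%Z.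
have E1 : \sum_(b <- s) b *~ k b = (\sum_(b <- s) b *~ k' b) *+ (p ^ i).
  rewrite -sumrMnl; apply: eq_big_seq => b' /dv/divzK h.
  by rewrite -[in LHS]h mulrzA -pmulrn.
have [w _ hw] : range j (\sum_(b <- s) b *~ k' b - x *+ p).
  apply: (elementary_pure elj pi0); exists u => //.
  by rewrite mulrnBl -E1 E -mulrnA -expnS addrK.
have : (p%:Z %| k' b)%Z.
  apply: (iB s k' us sB _ b bs); exists w, x.
  by rewrite hw subrK.
case/dvdzP => q hq; have /divzK <- := dv b bs; rewrite -/(k' b) hq expnS PoszM.
by rewrite -mulrA dvdz_mull.
Qed.

Lemma spanned_pow B : B `<=` hull e -> hull e `<=` spanned (mod_base p) B ->
  forall i g, hull e g -> exists (l : seq (N * int)) u g',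
    [/\ forall t, t \in l -> B t.1, hull e g' & g = \sum_(t <- l) t.1 *~ t.2 + j u + g' *+ (p ^ i)].
Proof.
move=> Be sB i g hg.
elim: i => [|i [l [u [g' [hl hg' ->]]]]].
  by exists [::], 0, g; split=> //; rewrite big_nil (elementary0 elj) expn0; zabel.
have [l' [hl' [v [x E]]]] := sB _ hg'.
exists (l ++ [seq (t.1, t.2 * (p ^ i)%N%:Z) | t <- l']), (u + v *+ (p ^ i)), x; split.
- by move=> t; rewrite mem_cat => /orP[/hl //|/mapP[t' /hl' ? ->]].
- apply: (hull_pure (prime_gt0 p_prime)); rewrite -(addKr (j v) (x *+ p)) -E addrC.
  apply: hullB; last exact: hull_range.
  apply: hullB => //; apply: hull_sum => t /hl'/Be; exact: hull_mulz.
- rewrite big_cat big_map /= (elementaryD elj) (elementaryMn elj) expnS.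
  have -> : \sum_(t <- l') t.1 *~ (t.2 * (p ^ i)%N%:Z) = (\sum_(t <- l') t.1 *~ t.2) *+ (p ^ i).
    by rewrite -sumrMnl; apply: eq_bigr => t _; rewrite mulrzA -pmulrn.
  have -> : g' = \sum_(t <- l') t.1 *~ t.2 + (j v + x *+ p) by rewrite -E; zabel.
  by zabel.
Qed.


(* [F] is the identity, or a matching of a basis with part of another one. *)
Lemma divs_independent B : B `<=` hull e -> independent p (mod_base p) B ->
  forall i (s : seq N) (F : N -> N) k v, uniq s -> (forall b, b \in s -> B (F b)) ->
  {in s &, injective F} ->
  divs (p ^ i) (\sum_(b <- s) F b *~ k b + j v) <->
    (forall b, b \in s -> ((p ^ i)%N%:Z %| k b)%Z) /\ divs (p ^ i) v.
Proof.
move=> Be iB i s F k v us sB Finj; split=> [[x E]|[hk hv]]; last first.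
  apply: divsD; last exact/(elementary_divs elj).
  by apply: divs_sum => b /hk; exact: divs_dvdz.
have /choice[g hg] : forall x, exists b, (exists2 b', b' \in s & F b' = x) -> b \in s /\ F b = x.
  move=> y; have [[b bs by_]|nb] := pselect (exists2 b', b' \in s & F b' = y); first by exists b.
  by exists 0.
have gF b : b \in s -> g (F b) = b.
  move=> bs; have [|h1 h2] := hg (F b); first by exists b.
  exact: Finj.
have hk b : b \in s -> ((p ^ i)%N%:Z %| k b)%Z.
  move=> bs; rewrite -(gF b bs).
  apply: (independent_pow Be iB (i := i) (s := map F s) (k := k \o g)).
  - by rewrite map_inj_in_uniq.
  - by move=> y /mapP[b' /sB hb ->].
  - exists (- v), x; rewrite (elementaryN elj) big_map -E.
    rewrite (eq_big_seq (fun b => F b *~ k b)); last by move=> b' /gF /= ->.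
    by zabel.
  - exact: map_f.
split=> //; apply/(elementary_divs elj).
have -> : j v = (\sum_(b <- s) F b *~ k b + j v) - \sum_(b <- s) F b *~ k b by zabel.
apply: divsB; first by exists x.
by apply: divs_sum => b /hk; exact: divs_dvdz.
Qed.

End Prime.
End Kappa.

(** * Cuts of convex subgroups *)

Definition above (U : oagType) (H : set U) (v : U) : Prop := forall h, H h -> h < v.

Lemma not_above (U : oagType) (H : set U) v : ~ above H v -> exists2 h, H h & v <= h.
Proof.
move=> /existsNP[h /not_implyP[Hh nh]]; exists h => //.
by rewrite oleNgt; apply/negP.
Qed.

Lemma models_elementary (G U N : oagType) (j : U -> N) (elj : elementary j) :
  models (theory G) U -> models (theory G) N.
Proof.
move=> mU phi /mU /(elementary_sat elj).
by have -> // : j \o of_void U = of_void N by apply/funext => -[].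
Qed.

Lemma convex_subgroup_mul (U : oagType) (H : set U) x n : convex_subgroup H -> H x -> H (x *+ n).
Proof.
move=> [[H0 HD _] _] Hx; elim: n => [|n IH]; first by rewrite mulr0n.
by rewrite mulrS; exact: HD.
Qed.

Section Fills.
Variables (G : oagType) (regG : regular_oag G).
Variables (U N : oagType) (j : U -> N) (elj : elementary j).
Variables (mU : models (theory G) U).
Variables (H : set U) (cH : convex_subgroup H) (g : N) (fg : fills j H g).

Lemma fills_gt0 : 0 < g.
Proof. by have [[H0 _ _] _] := cH; have [/(_ 0 H0)] := fg; rewrite (elementary0 elj). Qed.

Lemma fills_one : H (oag_one U).
Proof.
have [[H0 HD HN] Hc] := cH; have [f1 f2] := fg.
have [->//|[o0 _]] := one_spec U; apply: contrapT => n1.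
have /f2 : above H (oag_one U).
  move=> h Hh; rewrite oltNge; apply/negP => oh; apply: n1.
  by apply: Hc H0 Hh _ oh; exact: ltW.
rewrite (elementary_one elj) oltNge => /negP; apply.
have [o|[_ h]] := one_spec N; last exact: h _ fills_gt0.
by rewrite o; exact: ltW fills_gt0.
Qed.

Lemma fills_ones n : H (oag_one U *+ n).
Proof. exact: convex_subgroup_mul cH fills_one. Qed.

Lemma fills_far h i : H h -> j h + oag_one N *+ i < g.
Proof.
move=> Hh; rewrite -(elementary_one elj) -(elementaryMn elj) -(elementaryD elj).
by have [f1 _] := fg; apply: f1; have [[_ HD _] _] := cH; apply: HD => //; exact: fills_ones.
Qed.

Lemma fills_far_above v i : above H v -> g < j v - oag_one N *+ i.
Proof.
move=> av; rewrite -(elementary_one elj) -(elementaryMn elj) -(elementaryB elj).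
have [_ f2] := fg; apply: f2 => h Hh; have : h + oag_one U *+ i < v.
  by apply: av; have [[_ HD _] _] := cH; apply: HD => //; exact: fills_ones.
by move=> h'; olin h'.
Qed.

Lemma fills_div n v : (0 < n)%N -> above H v -> exists2 v', above H v' & v' *+ n < v.
Proof.
move=> n0 av; have [[H0 HD HN] Hc] := cH; have [f1 f2] := fg.
have [B hB] := gap regG mU n0.
have [[w [Hw wB]]|nw] := pselect (exists w, H w /\ oag_one U *+ B < w).
  have [|x [x1 x2]] := hB (v - w) v; first by olin wB.
  exists x => // h Hh; rewrite oltNge; apply/negP => xh.
  have : w + h *+ n < v by apply/av/HD => //; exact: convex_subgroup_mul.
  by move=> h'; olin (h', x1, nnM n (nn_le xh)).
have [o0|[o0 _]] := one_spec U; last first.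
  by case: nw; exists (oag_one U *+ B.+1); split; [exact: fills_ones|olin o0].
have v0 := av 0 H0; have [|x [x1 x2]] := hB 0 v; first by rewrite o0 mul0rn addr0.
exists x => // h Hh; rewrite omulrn_gt0 // in x1; apply: le_lt_trans x1.
by rewrite oleNgt; apply/negP => h0; apply: nw; exists h; rewrite o0 mul0rn.
Qed.

Lemma fills_mul n v : (0 < n)%N -> above H v -> g *+ n < j v.
Proof.
move=> n0 /(fills_div n0)[v' /fg.2 gv' v'n].
rewrite -(elementary_lt elj) (elementaryMn elj) in v'n.
by olin (v'n, nnM n (nn_lt gv')).
Qed.

Lemma fills_pos_exists : exists u : U, 0 < u.
Proof.
have := elementary_sat elj (fEx (fPos (lvar None))) (of_void U).
rewrite !sat_fEx => -[_ h]; case: h => [|x]; last by rewrite sat_fPos leval_var; exists x.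
by exists g; rewrite sat_fPos leval_var; exact: fills_gt0.
Qed.

Lemma fills_between (s s' : seq U) : (forall h, List.In h s -> H h) ->
  (forall v, List.In v s' -> above H v) ->
  exists x, (forall h, List.In h s -> h < x) /\ (forall v, List.In v s' -> x < v).
Proof.
have [[H0 HD HN] Hc] := cH; move=> hs hs'.
have [m [Hm hm]] : exists m, H m /\ forall h, List.In h s -> h <= m.
  elim: s hs => [|h s IH] hs; first by exists 0.
  have [|m [Hm hm]] := IH; first by move=> ? ?; apply: hs; right.
  have [mh|hm'] := orP (ole_total m h); [exists h|exists m]; split=> //.
  - by apply: hs; left.
  - by move=> x [->//|/hm xm]; exact: le_trans xm mh.
  - by move=> x [<-//|/hm].
have [u u0] := fills_pos_exists.
have [-> |[v [av hv]]] : s' = [::] \/ exists v, above H v /\ forall x, List.In x s' -> v <= x.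
  elim: s' hs' => [|v s' IH] hs'; [by left|right].
  have av : above H v by apply: hs'; left.
  have [|->|[v' [av' hv']]] := IH; first by move=> ? ?; apply: hs'; right.
    by exists v; split=> // x [<-|].
  have [vv'|v'v] := orP (ole_total v v'); [exists v|exists v']; split=> //.
  - by move=> x [<-//|/hv' ?]; exact: le_trans vv' _.
  - by move=> x [<-//|/hv'].
- exists (m + u); split=> // h /hm hm'; by olin (hm', u0).
have [v' av' v'v] := fills_div (isT : (0 < 2)%N) av.
exists v'; split=> [h /hs /av' //|x /hv hx].
have := av' 0 H0 => v'0; by olin (v'v, hx, v'0).
Qed.

End Fills.

Lemma sgn_opp (U N : oagType) (a : U) (b : N) : (0 < a) = (0 < b) -> (a == 0) = (b == 0) ->
  (0 < - a) = (0 < - b) /\ (- a == 0) = (- b == 0).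
Proof.
move=> h1 h2; rewrite !oppr_eq0; split=> //.
have E (W : oagType) (x : W) : (0 < - x) = ~~ ((0 < x) || (x == 0)).
  have -> : (0 < - x) = (x < 0) by rewrite [RHS]olt_sub sub0r.
  by rewrite oltNge le_eqVlt orbC eq_sym.
by rewrite !E h1 h2.
Qed.

Section MoveBelow.
Variables (G : oagType) (regG : regular_oag G).
Variables (M : oagType) (mM : models (theory G) M) (W : Type) (e : W -> M).

Lemma move_below (w z : M) : (forall i, w + oag_one M *+ i < z) ->
  (forall (l : lin W) m, (0 < m)%N -> w *+ m <= leval e l -> ~ leval e l <= z *+ m) ->
  forall (L : seq (int * lin W)) m, (0 < m)%N -> exists x,
  [/\ x < w, divs m (x - z) & forall k l, List.In (k, l) L ->
    (0 < x *~ k + leval e l) = (0 < z *~ k + leval e l) /\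
    (x *~ k + leval e l == 0) = (z *~ k + leval e l == 0)].
Proof.
move=> wz nl L m m0.
pose nrm (t : int * lin W) : nat * lin W := (`|t.1|%N, lscale (sgz t.1) t.2).
have [B hB] := gap_coset regG mM m0.
pose s := [seq (t.1, w *+ t.1 + leval e t.2) | t <- [seq t <- map nrm L | (0 < t.1)%N & 0 < z *+ t.1 + leval e t.2]].
have far k l : (0 < k)%N -> 0 < z *+ k + leval e l -> forall i, oag_one M *+ i < w *+ k + leval e l.
  move=> k0 y0 i; rewrite oltNge; apply/negP => hi.
  have h0 : 0 < w *+ k + leval e l.
    rewrite oltNge; apply/negP => h; apply: (nl (lscale (-1) l) k k0); rewrite leval_opp; [olin h|olin y0].
  have [k' hk] : exists k', k = k'.+1 by exists k.-1; rewrite prednK.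
  apply: (nl (ladd (lscale i (lone W)) (lscale (-1) l)) k k0).
    by rewrite leval_add !leval_scale leval_one; olin hi.
  rewrite leval_add !leval_scale leval_one oleNgt; apply/negP => hi'.
  have wz0 : w < z by have := wz 0%N; rewrite mulr0n addr0.
  by have wzi := wz i; rewrite hk in hi' h0; olin (hi', h0, scaled k' wz0, wzi).
have [||eps [h1 h2]] := @room G regG M mM B s.
- move=> k a /List.in_map_iff[[k' l] [[<- <-] /List.filter_In[_ /andP[/= k0 y0]]]].
  by split=> //; exact: far.
- by exists (z - w); have := wz 0%N; rewrite mulr0n addr0 olt_sub.
have [|x [x1 [x2 x3]]] := hB (w - eps) w z; first by olin h1.
exists x; split=> // .
have P (k : nat) l : List.In (k, l) (map nrm L) ->
    (0 < x *+ k + leval e l) = (0 < z *+ k + leval e l) /\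
    (x *+ k + leval e l == 0) = (z *+ k + leval e l == 0).
  move=> hin; have [->|k0] := posnP k; first by rewrite !mulr0n.
  have wz0 : w < z by have := wz 0%N; rewrite mulr0n addr0.
  have [y0|y0|y0] := otrichotomy 0 (z *+ k + leval e l).
  - have {}h2 : eps *+ k < w *+ k + leval e l.
      apply: h2; apply/List.in_map_iff; exists (k, l); split=> //.
      by apply/List.filter_In; split=> //=; rewrite k0.
    have h : 0 < x *+ k + leval e l by olin (h2, nnM k (nn_lt x1)).
    by rewrite y0 h (gt_eqF h) (gt_eqF y0).
  - exfalso; apply: (nl (lscale (-1) l) k k0); rewrite leval_opp.
      by have E : leval e l = - (z *+ k) by [apply/eqP; rewrite -addr_eq0 addrC -y0]; rewrite E; olin (nnM k (nn_lt wz0)).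
    by have E : leval e l = - (z *+ k) by [apply/eqP; rewrite -addr_eq0 addrC -y0]; rewrite E opprK.
  - have h : x *+ k + leval e l < 0 by olin (y0, nnM k (nn_lt x2), nnM k (nn_lt wz0)).
    by rewrite !oltNge (ltW y0) (ltW h) (lt_eqF h) (lt_eqF y0).
move=> k l hin; have := P _ _ (List.in_map nrm _ _ hin).
rewrite leval_scale /=; have [k0|k0|->] := ltgtP k 0.
- rewrite (ltr0_sgz k0) mulrNz mulr1z.
  have E y : y *+ `|k| - leval e l = - (y *~ k + leval e l).
    by case: (k) k0 => // n _; rewrite NegzE /=; zabel.
  by rewrite !E => -[a b]; have := sgn_opp a b; rewrite !opprK.
- rewrite (gtr0_sgz k0) mulr1z.
  by case: (k) k0.
- by rewrite !mulr0z.
Qed.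

End MoveBelow.

(** * Invariants of dominated types *)

Lemma divs_coprime (M : oagType) a b (x : M) : coprime a b ->
  divs (a * b) x <-> divs a x /\ divs b x.
Proof.
move=> cop; split=> [h|[[y hy] [z hz]]].
  by split; apply: divs_dvd h; [exact: dvdn_mulr|exact: dvdn_mull].
have [u [v]] := Bezoutz a b; rewrite /gcdz /= (eqP cop) => uv.
exists (z *~ u + y *~ v).
have -> : x = x *~ (u * a%:Z + v * b%:Z) by rewrite uv mulr1z.
by rewrite mulrzDr {1}hz hy; zabel.
Qed.

Lemma pow_split p n : prime p -> (0 < n)%N -> exists i n1, [/\ n = (n1 * p ^ i)%N, coprime p n1 & (0 < n1)%N].
Proof.
move=> pp n0; have [n1 cop E] := pfactor_coprime pp n0.
exists (logn p n), n1; split=> //; by move: n0; rewrite {1}E muln_gt0 => /andP[].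
Qed.

Lemma divs_indep (M : oagType) (p : nat) (pp : prime p) (V : Type) (e : V -> M) (w : M) :
  (forall h, hull e h -> ~ divs p (w - h)) -> forall i (k : int) t, hull e t ->
  divs (p ^ i) (w *~ k + t) <-> ((p ^ i)%N%:Z %| k)%Z /\ divs (p ^ i) t.
Proof.
move=> nw; have p0 := prime_gt0 pp.
elim=> [|i IH] k t ht.
  by rewrite expn0; split=> _; [split; [exact: dvd1z|exists t]|exists (w *~ k + t)].
split=> [h|[hk hh]]; last by apply: divsD hh; exact: divs_dvdz.
suff hk : ((p ^ i.+1)%N%:Z %| k)%Z.
  split=> //; rewrite -(addKr (w *~ k) t); apply: divsD h; apply: divsN; exact: divs_dvdz.
have [/dvdzP[k' hk'] [t' ht']] : ((p ^ i)%N%:Z %| k)%Z /\ divs (p ^ i) t.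
  by apply/IH => //; apply: divs_dvd h; rewrite expnS dvdn_mull.
have pi0 : (0 < p ^ i)%N by rewrite expn_gt0 p0.
have {}h : divs p (w *~ k' + t').
  apply/(divsM p _ pi0); rewrite -expnS; move: h; rewrite hk' ht'.
  by congr divs; zabel.
have ht'' : hull e t' by apply: (hull_pure pi0); rewrite -ht'.
rewrite hk' expnS PoszM; apply: dvdz_mul => //.
apply: contrapT => /negP nk.
have cop : coprimez p k' by rewrite coprimezE prime_coprime // -[(p %| _)%N]dvdzE.
have [u [v]] := Bezoutz p k'; rewrite (eqP cop) => uv.
have ht2 : hull e (- t' *~ v) by apply/hull_mulz/hullN.
apply: (nw _ ht2).
have := divsD (divs_mulz v h) (divs_muln p (w *~ u)).
congr divs; have {3}-> : w = w *~ (u * p%:Z + v * k') by rewrite uv mulr1z.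
by zabel.
Qed.

Section Core.
Variables (G : oagType) (regG : regular_oag G).
Variables (K : Type) (K_nat : small K [set: nat]) (K_lim : strong_limit K).
Variables (U N : oagType) (j : U -> N) (elj : elementary j).
Variables (mU : models (theory G) U) (satU : saturated K U).
Variables (I J : Type) (smI : small K [set: I]) (smJ : small K [set: J]).
Variables (p : set (formula (I + U))) (q : set (formula (J + U))).
Variables (pglobal : global_type p) (qglobal : global_type q).
Variables (c : I -> N) (d : J -> N) (cp : realizes c j p) (dq : realizes d j q).
Variables (A : set U) (r : set (formula ((I + J) + A))) (smA : small K A).
Hypotheses (cr : complete_type (val : A -> U) r).
Hypotheses (rp : @in_x I J A @` (@Defs.restrict U I A p) `<=` r).
Hypotheses (rdom : forall phi, q phi ->
  entails (theory G) (@in_x I J U @` p `|` inst (val : A -> U) @` r) (@in_y I J U phi)).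

Let mN : models (theory G) N := models_elementary elj mU.

Lemma global_sat phi : p phi <-> sat (copair c j) phi.
Proof. exact: (complete_realizes pglobal (cp : realizes c (j \o id) p)). Qed.
Lemma global_sat' phi : q phi <-> sat (copair d j) phi.
Proof. exact: (complete_realizes qglobal (dq : realizes d (j \o id) q)). Qed.

Definition env3 (M : oagType) (k : N -> M) (y : J -> M) : (I + J) + A -> M :=
  copair (copair (k \o c) y) (k \o j \o val).

Definition good (M : oagType) (k : N -> M) (y : J -> M) : Prop :=
  elementary k /\ forall psi, r psi -> sat (env3 k y) psi.

Lemma dom_same (M : oagType) (k : N -> M) (y : J -> M) : good k y ->
  same_sat (copair d j) (copair y (k \o j)).
Proof.
move=> [elk real].
have mM := models_elementary elk mN.
have H phi : q phi -> sat (copair y (k \o j)) phi.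
  move=> qphi; have := rdom qphi (e := copair (copair (k \o c) y) (k \o j)) mM.
  rewrite /in_y sat_rename.
  have -> : copair (copair (k \o c) y) (k \o j) \o copair (inl \o inr) inr = copair y (k \o j).
    by apply/funext => -[].
  apply=> psi [[psi' ppsi' <-]|[psi' rpsi' <-]].
    rewrite /in_x sat_rename; have /(elementary_sat elk) := cp ppsi'.
    by congr (sat _ _); apply/funext => -[].
  rewrite /inst sat_rename; have := real _ rpsi'.
  by congr (sat _ _); apply/funext => -[].
move=> phi; split=> [s|s]; first by apply: H; apply/global_sat'.
apply: contrapT => ns; have : sat (copair y (k \o j)) (fNot phi) by apply: H; apply/global_sat'.
exact.
Qed.

Let rho : (I + J) + A -> J + N := copair (copair (inr \o c) inl) (inr \o j \o val).

Lemma sat_rho (M : oagType) (k : N -> M) (y : J -> M) psi :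
  sat (copair y k) (rename rho psi) = sat (env3 k y) psi.
Proof. by rewrite sat_rename; congr (sat _ _); apply/funext => -[[]|]. Qed.

Lemma descend (M : oagType) (k : N -> M) (elk : elementary k) (y : J -> M) (s : seq (formula (J + N))) :
  (forall phi, List.In phi s -> sat (copair y k) phi) ->
  exists y0 : J -> N, forall phi, List.In phi s -> sat (copair y0 id) phi.
Proof.
move=> hs.
pose sw (v : J + N) : N + J := match v with inl x => inr x | inr x => inl x end.
have [psi hpsi] := ex_closure (rename sw (conjs s)).
have E (W : oagType) (k' : N -> W) (y' : J -> W) : copair k' y' \o sw = copair y' k' by apply/funext => -[].
have : sat (id : N -> N) psi.
  apply/(elementary_sat elk)/hpsi; exists y; rewrite sat_rename E; exact/sat_conjs.
by move=> /hpsi[y0]; rewrite sat_rename E => /sat_conjs; exists y0.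
Qed.

Lemma refine (M : oagType) (k : N -> M) (elk : elementary k) (phi0 : formula (J + N)) :
  (forall s, (forall psi, List.In psi s -> r psi) -> exists y : J -> M,
    (forall psi, List.In psi s -> sat (env3 k y) psi) /\ sat (copair y k) phi0) ->
  exists (M' : oagType) (k' : N -> M') (y' : J -> M'), good k' y' /\ sat (copair y' k') phi0.
Proof.
move=> h.
have [|M' [k' [y' [elk' real]]]] := @compactness N J (rename rho @` r `|` [set phi0]).
  move=> s hs.
  have [s' [hs' sub]] : exists s', (forall psi, List.In psi s' -> r psi) /\
      forall phi, List.In phi s -> List.In phi (phi0 :: map (rename rho) s').
    elim: s hs => [|phi s IH] hs; first by exists [::].
    have [|s' [h1 h2]] := IH; first by move=> ? ?; apply: hs; right.
    have [[psi rpsi e]|e] := hs phi (or_introl erefl).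
      exists (psi :: s'); split=> [psi' [<-//|/h1 //]|phi' [<-|/h2[]]]; first by right; left.
        by left.
      by right; right.
    by exists s'; split=> // phi' [<-|/h2]; [left|].
  have [y [hy hy0]] := h s' hs'.
  have [|y0 hy0'] := @descend M k elk y (phi0 :: map (rename rho) s').
    by move=> phi [<- //|/List.in_map_iff[psi [<- /hy]]]; rewrite sat_rho.
  by exists y0 => phi /sub/hy0'.
exists M', k', y'; split; last by apply: real; right.
split=> // psi rpsi; rewrite -sat_rho; apply: real; left; by exists psi.
Qed.

Lemma good_exists : exists (M : oagType) (k : N -> M) (y : J -> M), good k y.
Proof.
have [||M [k [y [gd _]]]] := @refine N id _ (fEq (tZero _) (tZero _)); last by exists M, k, y.
  by [].
move=> s hs.
pose f : (I + J) + A -> (I + A) + J := fun v => match v with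
  inl (inl i) => inl (inl i) | inl (inr y) => inr y | inr a => inl (inr a) end.
have [psi hpsi] := ex_closure (rename f (conjs s)).
have E (W : oagType) (x : I -> W) (y : J -> W) (a : A -> W) :
  copair (copair x a) y \o f = copair (copair x y) a by apply/funext => -[[]|].
have : p (inst val psi).
  apply: contrapT => np; have {}np : p (fNot (inst val psi)) by apply/(complete_not _ pglobal).
  have rn : r (in_x J (fNot psi)) by apply: rp; exists (fNot psi).
  have [f' _] := (complete_typeE _ _).1 cr.
  have [|v hv] := f' (in_x J (fNot psi) :: s); first by move=> phi [<-|/hs].
  have := hv _ (or_introl erefl); rewrite /in_x sat_rename; apply; apply/hpsi.
  exists (v \o inr); rewrite sat_rename; apply/sat_conjs => phi hphi.
  rewrite (_ : _ \o f = copair v (val : A -> U)); first by apply: hv; right.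
  by apply/funext => -[[]|].
move=> /global_sat; rewrite /inst sat_rename.
rewrite (_ : _ \o _ = copair c (j \o (val : A -> U))); last by apply/funext => -[].
move=> /hpsi[y]; rewrite sat_rename E => /sat_conjs hy; exists y; split=> // psi' /hy.
Qed.

(* The set of values [z] such that some [y] satisfies the finitely many
   formulas in [s] and [l y] is the affine function [t] of [z]. *)
Lemma fiber (W : Type) (iW : I -> W) (aW : A -> W) (s : seq (formula ((I + J) + A)))
    (l : lin J) (t : lin (option W)) : exists phi : formula (option W),
  forall (M : oagType) (e : W -> M) z, sat (oscons e z) phi <->
    exists y : J -> M, (forall psi, List.In psi s ->
      sat (copair (copair (e \o iW) y) (e \o aW)) psi) /\ leval y l = leval (oscons e z) t.
Proof.
pose f : (I + J) + A -> option W + J := fun v => match v with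
  inl (inl i) => inl (Some (iW i)) | inl (inr y) => inr y | inr a => inl (Some (aW a)) end.
have [phi hphi] := ex_closure (fAnd (rename f (conjs s))
   (fZero (ladd (lmap (inr : J -> option W + J) l) (lscale (-1) (lmap (inl : option W -> option W + J) t))))).
exists phi => M e z; rewrite hphi.
have E (y : J -> M) : copair (oscons e z) y \o f = copair (copair (e \o iW) y) (e \o aW) by apply/funext => -[[]|].
split=> -[y]; rewrite ?sat_fAnd ?sat_rename ?E ?sat_fZero ?leval_add ?leval_opp ?leval_map.
  move=> [/sat_conjs h1 h2]; exists y; split=> //.
  by apply: subr0_eq.
move=> [h1 h2]; exists y; rewrite sat_fAnd sat_rename E sat_fZero leval_add leval_opp !leval_map.
split; first exact/sat_conjs.
by have -> : copair (oscons e z) y \o inr = y by []; rewrite h2 subrr.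
Qed.

Section Claims.
Variables (M : oagType) (k : N -> M) (y : J -> M) (gd : good k y).
Let elk : elementary k := gd.1.
Let mM : models (theory G) M := models_elementary elk mN.
Let x : I -> M := k \o c.
Let a : A -> M := k \o j \o val.

(* Otherwise [y] could be moved so that [leval y l] falls below [w]. *)
Lemma claim_below (l : lin J) (w : U) :
  (forall i, k (j w) + oag_one M *+ i < leval y l) ->
  (forall (M' : oagType) (k' : N -> M') (y' : J -> M'), good k' y' -> k' (j w) < leval y' l) ->
  exists (t : lin (I + A)) m, [/\ (0 < m)%N, k (j w) *+ m <= leval (copair x a) t &
    leval (copair x a) t <= leval y l *+ m].
Proof.
move=> hw hdom; apply: contrapT => hn.
pose phi0 : formula (J + N) := fPos (ladd (lvar (inr (j w))) (lscale (-1) (lmap inl l))).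
have [|M' [k' [y' [gd' h]]]] := @refine M k elk phi0; last first.
- have := hdom _ _ _ gd'; rewrite oltNge => /negP; apply.
  move: h; rewrite sat_fPos leval_add leval_opp leval_map leval_var /=.
  have -> : copair y' k' \o inl = y' by [].
  by move=> h; olin h.
move=> s hs.
have [phi hphi] := @fiber (I + A) inl inr s l (lvar None).
have [ts [m [m0 hts]]] := regular_data regG phi.
have /choice[F hF] : forall t : lin (option (I + A)), exists kl : int * lin (I + A),
    forall (U : oagType) (e : I + A -> U) x, leval (oscons e x) t = x *~ kl.1 + leval e kl.2.
  by move=> t; have [k0 [l0 h]] := lin_option t; exists (k0, l0).
have [|z [zw zm hz]] := move_below regG mM (e := copair x a) (w := k (j w)) (z := leval y l) hw _ [seq F t | t <- ts] m0.
  by move=> t n n0 h1 h2; apply: hn; exists t, n.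
have /hphi[y1 [h1 h2]] : sat (oscons (copair x a) z) phi.
  apply/(hts M M mM mM _ (oscons (copair x a) (leval y l))); last first.
    apply/hphi; exists y; split; last by rewrite leval_var.
    by move=> psi hpsi; apply: gd.2; exact: hs.
  move=> t ht; rewrite !hF; have := List.in_map F _ _ ht; rewrite [F t]surjective_pairing => /hz[hs1 hs2].
  rewrite hs1 hs2; split=> // n' n'0 n'm; apply: divs_cong.
  by have := divs_mulz (F t).1 (divs_dvd n'm zm); congr divs; zabel.
exists y1; split=> //.
rewrite sat_fPos leval_add leval_opp leval_map leval_var /=.
have -> : copair y1 k \o inl = y1 by [].
rewrite leval_var /= in h2; by rewrite h2; olin zw.
Qed.

(* Otherwise [y] could be moved so that [b] becomes congruent modulo [pr] to an
   element of [U] chosen generic. *)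
Lemma claim_mod (pr : nat) (l : lin J) m (u0 : U) (b : M) : prime pr -> (0 < m)%N ->
  b *+ m = leval y l + k (j u0) ->
  (forall u, ~ divs pr (b - k (j u))) ->
  exists2 h, hull (copair x (k \o j)) h & divs pr (b - h).
Proof.
move=> ppr m0 hb nb; apply: contrapT => hn.
pose W := (I + (A + unit))%type.
pose e : W -> M := copair x (copair a (fun=> k (j u0))).
have hsub h : hull e h -> hull (copair x (k \o j)) h.
  case=> n [t [n0 ht]]; exists n, (lmap (fun v : W => match v with
     inl i => inl i | inr (inl u) => inr (val u) | inr (inr _) => inr u0 end) t); split=> //.
  by rewrite leval_map ht; congr leval; apply/funext => -[|[]].
have nb' h : hull e h -> ~ divs pr (b - h) by move=> hh hd; apply: hn; exists h => //; exact: hsub.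
have smW : small K [set: W].
  by apply: small_sum => //; apply: small_sum => //; [exact: (small_set _ _).1 smA|exact: small_count].
have [u' hu'] : exists u', forall h, hull e h -> ~ divs pr (k (j u') - h).
  have /choice[f hf] : forall P : lin W * nat, exists u, forall u1 h1, h1 *+ P.2 = leval e P.1 ->
      divs pr (k (j u1) - h1) -> (0 < P.2)%N -> divs pr (u1 - u).
    move=> [t n] /=; have [[u [h [hh hd]]]|nu] := pselect (exists u h, h *+ n = leval e t /\ divs pr (k (j u) - h)).
      exists u => u1 h1 hh1 hd1 n0; have e1 : h1 = h by apply: (omulrnI n0); rewrite hh1.
      apply/(elementary_divs elj)/(elementary_divs elk).
      have := divsB hd1 hd; congr divs; rewrite (elementaryB elj) (elementaryB elk) e1; by zabel.
    by exists 0 => u1 h1 e1 h2; case: nu; exists u1, h1.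
  have [||u' hu'] := @saturated_avoid K U satU (lin W * nat)%type _ f pr.
  - by apply: small_prod => //; exact: small_lin.
  - move=> s.
    pose g P : formula (option U) := fNot (fDiv pr (ladd (lvar None) (lscale (-1) (lvar (Some (f P)))))).
    have : sat (id : U -> U) (fEx (conjs (map g s))).
      apply/(elementary_sat (elementary_comp elj elk)); rewrite sat_fEx; exists b.
      apply/sat_conjs => phi /List.in_map_iff[P [<- _]].
      rewrite sat_fNot sat_fDiv leval_add leval_opp !leval_var /=; exact: nb.
    rewrite sat_fEx => -[u /sat_conjs hu]; exists u => P hP.
    have := hu _ (List.in_map g _ _ hP).
    by rewrite sat_fNot sat_fDiv leval_add leval_opp !leval_var /=.
  exists u' => h [n [t [n0 ht]]] hd; apply: (hu' (t, n)); exact: (hf (t, n) _ _ ht hd n0).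
pose phi1 : formula (J + U) := fEx (fAnd
  (fZero (ladd (lscale m (lvar None)) (lscale (-1) (ladd (lmap (Some \o inl) l) (lvar (Some (inr u0)))))))
  (fDiv pr (ladd (lvar None) (lscale (-1) (lvar (Some (inr u'))))))).
have hphi1 (M' : oagType) (y' : J -> M') (g : U -> M') : sat (copair y' g) phi1 <->
    exists w, w *+ m = leval y' l + g u0 /\ divs pr (w - g u').
  rewrite /phi1 sat_fEx; split=> -[w]; rewrite ?sat_fAnd ?sat_fZero ?sat_fDiv ?leval_add ?leval_scale ?leval_add ?leval_map ?leval_var.
    move=> [h1 h2]; exists w; split; last by move: h2; congr divs; rewrite /=; zabel.
    apply: subr0_eq; rewrite -[RHS]h1 /=.
    by rewrite (_ : _ \o _ = y') //; zabel.
  move=> [h1 h2]; exists w; rewrite sat_fAnd sat_fZero sat_fDiv !leval_add !leval_scale leval_add leval_map !leval_var.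
  split; last by move: h2; congr divs; rewrite /=; zabel.
  by rewrite (_ : _ \o _ = y') //= -pmulrn h1; zabel.
pose phi0 : formula (J + N) := rename (copair inl (inr \o j)) phi1.
have hphi0 (M' : oagType) (y' : J -> M') (k' : N -> M') :
    sat (copair y' k') phi0 <-> sat (copair y' (k' \o j)) phi1.
  by rewrite sat_rename (_ : _ \o _ = copair y' (k' \o j)) //; apply/funext => -[].
have [|M' [k' [y' [gd' /hphi0 h]]]] := @refine M k elk phi0; last first.
  have /hphi1[w [h1 h2]] : sat (copair y (k \o j)) phi1.
    by apply/(dom_same gd phi1)/(dom_same gd' phi1).
  have e1 : w = b by apply: (omulrnI m0); rewrite h1 hb.
  by rewrite e1 in h2; exact: (nb u').
move=> s hs.
pose t0 : lin (option W) := ladd (lscale m (lvar None)) (lscale (-1) (lvar (Some (inr (inr tt))))).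
have [phi hphi] := @fiber W inl (inr \o inl) s l t0.
have [ts [n [n0 hts]]] := regular_data regG phi.
have /choice[F hF] : forall t : lin (option W), exists kl : int * lin W,
    forall (U : oagType) (e : W -> U) x, leval (oscons e x) t = x *~ kl.1 + leval e kl.2.
  by move=> t; have [k1 [l1 h]] := lin_option t; exists (k1, l1).
have nbh : ~ hull e b by move=> hh; apply: (nb' _ hh); rewrite subrr; exact: divs0.
have [i [n1 [En cop n10]]] := pow_split ppr n0.
have P0 : (0 < pr ^ i.+1)%N by rewrite expn_gt0 prime_gt0.
have cop' : coprime n1 (pr ^ i.+1) by rewrite coprime_sym coprimeXl.
have [z0 [hz1 hz2]] : exists z0, divs n1 (z0 - b) /\ divs (pr ^ i.+1) (z0 - k (j u')).
  have [u [v]] := Bezoutz n1 (pr ^ i.+1)%N; rewrite /gcdz /= (eqP cop') => uv.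
  exists (b *~ (v * (pr ^ i.+1)%N%:Z) + k (j u') *~ (u * n1%:Z)); split.
    have -> : b *~ (v * (pr ^ i.+1)%N%:Z) + k (j u') *~ (u * n1%:Z) - b = ((k (j u') - b) *~ u) *+ n1.
      have {2}-> : b = b *~ (u * n1%:Z + v * (pr ^ i.+1)%N%:Z) by rewrite uv mulr1z.
      by zabel.
    exact: divs_muln.
  have -> : b *~ (v * (pr ^ i.+1)%N%:Z) + k (j u') *~ (u * n1%:Z) - k (j u') = ((b - k (j u')) *~ v) *+ (pr ^ i.+1).
    have {2}-> : k (j u') = k (j u') *~ (u * n1%:Z + v * (pr ^ i.+1)%N%:Z) by rewrite uv mulr1z.
    by zabel.
  exact: divs_muln.
have nP0 : (0 < n1 * pr ^ i.+1)%N by rewrite muln_gt0 n10.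
have [B hB] := gap_coset regG mM nP0.
have [eps [eps0 heps]] := signs_near regG mM [seq F t | t <- ts] B nbh.
have [|x0 [bx0 [x0eps]]] := hB b (b + eps) z0; first by olin eps0.
move=> /(divs_coprime _ cop')[hx1 hx2].
have {}hx1 : divs n1 (x0 - b) by have := divsD hx1 hz1; congr divs; zabel.
have {}hx2 : divs (pr ^ i.+1) (x0 - k (j u')) by have := divsD hx2 hz2; congr divs; zabel.
have hx2p : divs pr (x0 - k (j u')) by apply: divs_dvd hx2; rewrite expnS dvdn_mulr.
have nx0 h : hull e h -> ~ divs pr (x0 - h).
  by move=> hh hd; apply: (hu' h hh); have := divsB hd hx2p; congr divs; zabel.
have /hphi[y1 [h1 h2]] : sat (oscons e x0) phi.
  apply/(hts M M mM mM _ (oscons e b)); last first.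
    apply/hphi; exists y; split; first by move=> psi hpsi; apply: gd.2; exact: hs.
    by rewrite leval_add !leval_scale !leval_var /= -pmulrn hb; zabel.
  move=> t ht; rewrite !hF; have := List.in_map F _ _ ht; rewrite [F t]surjective_pairing.
  move=> /(heps x0 bx0 x0eps)[hs1 hs2]; rewrite hs1 hs2; split=> // n' n'0 n'n.
  have [i' [n2 [En' cop2 n20]]] := pow_split ppr n'0.
  have dn2 : (n2 %| n1)%N.
    have : (n2 %| n1 * pr ^ i)%N by rewrite -En; apply: dvdn_trans n'n; rewrite En' dvdn_mulr.
    by rewrite Gauss_dvdl // coprime_sym coprimeXl.
  have cop3 : coprime n2 (pr ^ i') by rewrite coprime_sym coprimeXl.
  have ht' := hull_leval e (F t).2.
  rewrite En' (divs_coprime (x0 *~ _ + _) cop3) (divs_coprime (b *~ _ + _) cop3).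
  rewrite (divs_indep ppr nx0) // (divs_indep ppr nb') //.
  have : divs n2 (x0 *~ (F t).1 + leval e (F t).2) <-> divs n2 (b *~ (F t).1 + leval e (F t).2).
    by apply: divs_cong; have := divs_mulz (F t).1 (divs_dvd dn2 hx1); congr divs; zabel.
  by move=> ->.
exists y1; split=> //.
apply/hphi0/hphi1; exists x0; split=> //.
move: h2; rewrite leval_add !leval_scale !leval_var /= -pmulrn => ->; by zabel.
Qed.

End Claims.
Lemma form_transfer (M : oagType) (k : N -> M) (y : J -> M) : good k y ->
  forall (l0 : lin (J + U)) u,
   (j u < leval (copair d j) l0) = (k (j u) < leval (copair y (k \o j)) l0) /\
   (leval (copair d j) l0 < j u) = (leval (copair y (k \o j)) l0 < k (j u)).
Proof.
move=> gd l0 u; split; rewrite olt_sub [RHS]olt_sub.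
- have := same_sat_pos (dom_same gd) (ladd l0 (lscale (-1) (lvar (inr u)))).
  by rewrite !leval_add !leval_opp !leval_var.
- have := same_sat_pos (dom_same gd) (ladd (lvar (inr u)) (lscale (-1) l0)).
  by rewrite !leval_add !leval_opp !leval_var.
Qed.

Lemma dom_calH : calH j d `<=` calH j c.
Proof.
move=> H /(calHE elj)[cH [l0 fl]]; apply/(calHE elj); split=> //; apply: contrapT => nH.
have [M [k [y gd]]] := good_exists; have elk := gd.1; have mM := models_elementary elk mN.
have elkj := elementary_comp elj elk.
have [l [l' hl]] := lin_sum l0.
pose u0 := leval (id : U -> U) l'.
have hM (M' : oagType) (k' : N -> M') (y' : J -> M') : elementary k' ->
    leval (copair y' (k' \o j)) l0 = leval y' l + k' (j u0).
  move=> elk'; have [-> _] := hl _ y' (k' \o j).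
  congr (_ + _); exact: (elementary_leval (elementary_comp elj elk') id l').
pose gy := leval y l + k (j u0).
have fy : fills (k \o j) H gy.
  have [f1 f2] := fl; split=> [h /f1|v /f2]; rewrite /gy -hM //.
    by rewrite (form_transfer gd _ _).1.
  by rewrite (form_transfer gd _ _).2.
have gy0 : 0 < gy := fills_gt0 elkj cH fy.
pose Tt (t : lin (I + A)) := leval (copair c (j \o val)) t.
have kT t : leval (copair (k \o c) (k \o j \o val)) t = k (Tt t).
  by rewrite -(elementary_leval elk); congr leval; apply/funext => -[].
have nfill (t : lin (I + A)) (s : int) m : ~ fills j H (Tt t *~ s + j u0 *+ m).
  move=> hf; apply: nH.
  exists (ladd (lscale s (lmap (copair inl (inr \o (val : A -> U))) t)) (lscale m (lvar (inr u0)))).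
  rewrite leval_add !leval_scale leval_map leval_var -pmulrn /=.
  by rewrite (_ : _ \o _ = copair c (j \o (val : A -> U))) //; apply/funext => -[].
have lower h : H h -> exists t m, [/\ (0 < m)%N, j h *+ m <= Tt t + j u0 *+ m &
    k (Tt t) + k (j u0) *+ m <= gy *+ m].
  move=> Hh; have [||t [m [m0 h1 h2]]] := @claim_below M k y gd l (h - u0).
  - move=> i; have := fills_far elkj cH fy i Hh.
    by rewrite /gy /= (elementaryB elj) (elementaryB elk) => h1; olin h1.
  - move=> M' k' y' gd'; have [/(_ h Hh) + _] := fl.
    rewrite (form_transfer gd' _ _).1 (hM _ _ _ gd'.1) (elementaryB elj) (elementaryB gd'.1) => h1.
    by olin h1.
  exists t, m; rewrite !kT in h1 h2; split=> //.
    rewrite -(elementaryMn elk) (elementary_le elk) (elementaryB elj) in h1.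
    by olin h1.
  by rewrite /gy; olin h2.
have upper v : above H v -> exists t m, [/\ (0 < m)%N, Tt t *~ (-1) + j u0 *+ m <= j v *+ m &
    gy *+ m <= k (Tt t *~ (-1) + j u0 *+ m)].
  move=> av; have [||t [m [m0 h1 h2]]] := @claim_below M k y gd (lscale (-1) l) (u0 - v).
  - move=> i; have := fills_far_above elkj cH fy i av.
    by rewrite leval_opp /gy /= (elementaryB elj) (elementaryB elk) => h1; olin h1.
  - move=> M' k' y' gd'; have [_ /(_ v av)] := fl.
    rewrite (form_transfer gd' _ _).2 (hM _ _ _ gd'.1) leval_opp (elementaryB elj) (elementaryB gd'.1) => h1.
    by olin h1.
  exists t, m; rewrite leval_opp !kT in h1 h2; split=> //.
    rewrite -(elementaryMn elk) (elementary_le elk) (elementaryB elj) in h1.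
    by olin h1.
  rewrite (elementaryD elk) (elementaryMz elk) (elementaryMn elk) /gy; by olin h2.
pose P := (lin (I + A) * nat)%type.
have smP : small K [set: P].
  apply: small_prod => //.
  by apply: small_lin => //; apply: small_sum => //; exact: (small_set _ _).1 smA.
have /choice[lo hlo] : forall pp : P, exists h, H h /\ forall h', H h' ->
    Tt pp.1 + j u0 *+ pp.2 <= j h' -> Tt pp.1 + j u0 *+ pp.2 <= j h.
  move=> pp; have [[h [Hh hh]]|nh] := pselect (exists h, H h /\ Tt pp.1 + j u0 *+ pp.2 <= j h).
    by exists h.
  by exists 0; split=> [|h' Hh' hh]; [have [[]] := cH|case: nh; exists h'].
pose Q (pp : P) := exists v, above H v /\ j v *+ pp.2 < Tt pp.1 *~ (-1) + j u0 *+ pp.2.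
pose P' := {pp : P | Q pp}.
have smP' : small K [set: P'].
  apply: (small_inj (f := @proj1_sig P Q)) smP => -[p1 h1] [p2 h2] /= e; subst p2.
  by congr exist; exact: Prop_irrelevance.
have /choice[hi hhi] : forall pp : P', exists v, above H v /\ j v *+ (sval pp).2 < Tt (sval pp).1 *~ (-1) + j u0 *+ (sval pp).2.
  by move=> [pp hpp]; exact: hpp.
have [|x [x1 x2 _]] := @saturated_cut K K_nat K_lim U satU P P' smP smP' lo hi false 0.
  move=> s s' m _.
  have [||x [h1 h2]] := fills_between regG elkj mU cH fy (s := map lo s) (s' := map hi s').
  - by move=> h /List.in_map_iff[pp [<- _]]; have [] := hlo pp.
  - by move=> h /List.in_map_iff[pp [<- _]]; have [] := hhi pp.
  exists x; split=> // i hin; first by apply: h1; exact: List.in_map.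
  by apply: h2; exact: List.in_map.
have [[H0 HD HN] Hc] := cH.
have ax : above H x.
  suff pos h : H h -> 0 <= h -> h < x.
    move=> h Hh; have [h0|h0] := orP (ole_total 0 h); first exact: pos.
    exact: le_lt_trans h0 (pos 0 H0 (lexx 0)).
  move=> Hh h0; have [t [m [m0 h1 h2]]] := lower h Hh.
  have [h' [Hh' hh']] : exists h', H h' /\ Tt t + j u0 *+ m <= j h'.
    apply: contrapT => nh; apply: (nfill t 1 m); rewrite mulr1z; split=> [h' Hh'|v av].
      by rewrite oltNge; apply/negP => h3; apply: nh; exists h'.
    have := fills_mul regG elkj mU cH fy m0 av.
    rewrite -(elementary_lt elk) (elementaryD elk) (elementaryMn elk) => h3.
    exact: le_lt_trans h2 h3.
  have [_ /= hl2] := hlo (t, m); have hl3 := hl2 h' Hh' hh'.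
  apply: le_lt_trans (x1 (t, m)); rewrite -(elementary_le elj).
  apply: le_trans hl3; apply: le_trans h1.
  rewrite -(elementaryMn elj) (elementary_le elj).
  by rewrite -(prednK m0) ; olin (nnM m.-1 (h0 : nn false h)).
have [t [m [m0 h1 h2]]] := upper x ax.
have [v1 [av1 hv1]] : Q (t, m).
  rewrite /Q /=.
  have [v0 [av0 hv0]] : exists v0, above H v0 /\ j v0 <= Tt t *~ (-1) + j u0 *+ m.
    apply: contrapT => nv; apply: (nfill t (-1) m); split=> [h Hh|v av].
      rewrite -(elementary_lt elk); apply: lt_le_trans h2.
      have [/(_ h Hh) /= hg _] := fy; apply: lt_le_trans hg _.
      by rewrite -(prednK m0); olin (nnM m.-1 (nn_lt gy0)).
    by rewrite oltNge; apply/negP => h3; apply: nv; exists v.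
  have [v1 av1 hv1] := fills_div regG elkj mU cH fy m0 av0.
  exists v1; split=> //; rewrite -(elementaryMn elj).
  by apply: lt_le_trans hv0; rewrite (elementary_lt elj).
have Qp : Q (t, m) by exists v1.
have [av hv] := hhi (exist Q (t, m) Qp); have := x2 (exist Q (t, m) Qp).
set v := hi _ in av hv *; rewrite /= in hv => xv.
have : j v *+ m < j x *+ m := lt_le_trans hv h1.
rewrite -!(elementaryMn elj) (elementary_lt elj) => hh.
by olin (hh, nnM m (nn_lt xv)).
Qed.

Lemma dom_kappa pr : prime pr -> kappa j d pr #<= kappa j c pr.
Proof.
move=> ppr; have [M [k [y gd]]] := good_exists; have elk := gd.1.
have elkj := elementary_comp elj elk.
have [tau [t1 t2 t3 t4]] := hull_transfer (dom_same gd).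
have [Bd1 Bd2 _] := kappaP regG elj mN d ppr.
have [Bc1 _ Bc3] := kappaP regG elj mN c ppr.
set Bd := kappa j d pr in Bd1 Bd2 *; set Bc := kappa j c pr in Bc1 Bc3 *.
have tj u : tau (j u) = k (j u).
  have := t1 (j u) 1%N (lvar (inr u)) isT; rewrite !leval_var mulr1n; exact.
have tinj a b : hull (copair d j) a -> hull (copair d j) b -> tau a = tau b -> a = b.
  move=> ha hb e; apply: subr0_eq.
  have [_ [_ hz] _ _] := t4 _ (hullB ha hb); apply: hz.
  have -> : a - b = a + b *~ (-1) by zabel.
  by rewrite (t2 _ _ ha (hull_mulz _ hb)) (t3 _ _ hb) e; zabel.
have tsum (s : seq N) (f : N -> int) : (forall b, b \in s -> hull (copair d j) b) ->
    tau (\sum_(b <- s) b *~ f b) = \sum_(b <- s) tau b *~ f b.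
  elim: s => [|b s IH] hs.
    by rewrite !big_nil; have [_ [h _] _ _] := t4 0 (hull0 _); exact: h.
  have hs' b' : b' \in s -> hull (copair d j) b' by move=> h; apply: hs; rewrite in_cons h orbT.
  have hb := hs b (mem_head _ _).
  rewrite !big_cons t2 ?t3 ?IH //; first exact: hull_mulz.
  by apply: hull_sum => b' /hs'; exact: hull_mulz.
pose W' := mod_base (k \o j) pr.
have XY : tau @` Bd #<= k @` Bc.
  apply: (exchange ppr (mod_base0 elkj pr) (@mod_baseD _ _ _ elkj pr) (@mod_baseN _ _ _ elkj pr)
    (@mod_base_mul _ _ _ elkj pr)).
  - move=> s f us sX [u [w E]] x xs.
    have /choice[g hg] : forall x, exists b, (tau @` Bd) x -> Bd b /\ tau b = x.
      by move=> x'; have [[b Bb <-]|nx] := pselect ((tau @` Bd) x'); [exists b|exists 0 => /nx].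
    have hgs x' : x' \in s -> Bd (g x') /\ tau (g x') = x' by move=> /sX/hg.
    have us' : uniq (map g s).
      by rewrite map_inj_in_uniq // => a b /hgs[_ ea] /hgs[_ eb] e; rewrite -ea -eb e.
    have sB : [set` map g s] `<=` Bd by move=> b /mapP[x' /hgs[? _] ->].
    have hb b : b \in map g s -> hull (copair d j) b by move=> /sB/Bd1.
    have hS : hull (copair d j) (\sum_(b <- map g s) b *~ f (tau b)).
      by apply: hull_sum => b /hb; exact: hull_mulz.
    have := Bd2 (map g s) (f \o tau) us' sB _ (g x) (map_f g xs).
    rewrite /= (hgs x xs).2; apply.
    have : divs pr (\sum_(b <- map g s) b *~ f (tau b) + j u *~ (-1)).
      have hju := hull_mulz (-1) (hull_range j d u).
      have [_ _ _ /(_ pr)] := t4 _ (hullD hS hju) => ->.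
      rewrite (t2 _ _ hS hju) (t3 _ _ (hull_range j d u)) tj tsum // big_map.
      have -> : \sum_(x' <- s) tau (g x') *~ f (tau (g x')) = \sum_(x' <- s) x' *~ f x'.
        by apply: eq_big_seq => x' /hgs[_ ->].
      by rewrite E; exists w => /=; zabel.
    by case=> z hz; exists u, z; rewrite -hz; zabel.
  - move=> _ [b Bb <-].
    have [m [l0 [m0 hb]]] := Bd1 b Bb.
    have [l [l' hl]] := lin_sum l0.
    have htb := t1 _ _ _ m0 hb; have [E _] := hl _ y (k \o j).
    rewrite E (elementary_leval elkj id l') /= in htb.
    have [hu|[u hu]] : (forall u, ~ divs pr (tau b - k (j u))) \/ exists u, divs pr (tau b - k (j u)).
      by have [?|/existsNP[u /contrapT ?]] := pselect (forall u, ~ divs pr (tau b - k (j u))); [left|right; exists u].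
    + have [h [n [t [n0 ht]]] [z hz]] := claim_mod gd ppr m0 htb hu.
      have Et : leval (copair (k \o c) (k \o j)) t = k (leval (copair c j) t).
        by rewrite -(elementary_leval elk); congr leval; apply/funext => -[].
      have [h0 hh0] : divs n (leval (copair c j) t) by apply/(elementary_divs elk); exists h; rewrite -Et -ht.
      have Eh : h = k h0 by apply: (omulrnI n0); rewrite ht Et hh0 (elementaryMn elk).
      have [lb [hlb [u [w Ew]]]] : spanned (mod_base j pr) Bc h0 by apply: Bc3; exists n, t.
      have -> : tau b = h + z *+ pr by rewrite -hz; zabel.
      apply: (spannedD (@mod_baseD _ _ _ elkj pr)); last first.
        by apply: spannedW; exact: mod_base_mul.
      exists [seq (k t.1, t.2) | t <- lb]; split=> [t' /mapP[t'' /hlb ? ->]|]; first by exists t''.1.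
      rewrite big_map /= Eh.
      have -> : \sum_(t' <- lb) k t'.1 *~ t'.2 = k (\sum_(t' <- lb) t'.1 *~ t'.2).
        elim: (lb) => [|t' s IH]; first by rewrite !big_nil (elementary0 elk).
        by rewrite !big_cons IH (elementaryD elk) (elementaryMz elk).
      exists u, (k w); rewrite -(elementaryB elk) Ew (elementaryD elk) (elementaryMn elk) //.
    + apply: spannedW; case: hu => z hz.
      by exists u, z; rewrite -hz /=; zabel.
apply: card_le_trans (card_le_trans XY (card_image_le _ _)).
apply: (card_le_fun (f := tau)) => [b Bb|a b /Bd1 ha /Bd1 hb]; first by exists b.
exact: tinj.
Qed.


End Core.

(** * Invariant cuts *)

Section Cuts.
Variables (G : oagType) (regG : regular_oag G).
Variables (K : Type) (K_nat : small K [set: nat]) (K_lim : strong_limit K).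
Variables (U N : oagType) (j : U -> N) (elj : elementary j).
Variables (mU : models (theory G) U) (satU : saturated K U).

Lemma far_from_range (g : N) u i : ~ range j g -> j u < g -> j u + oag_one N *+ i < g.
Proof.
move=> ng; elim: i u => [|i IH] u ug; first by rewrite mulr0n addr0.
have [o0|[o0 ol]] := one_spec N; first by rewrite o0 mul0rn addr0.
have : j (u + oag_one U) < g.
  rewrite lt_neqAle; apply/andP; split.
    by apply/eqP => e; apply: ng; rewrite -e; exists (u + oag_one U).
  have : 0 < g - j u by rewrite -olt_sub.
  by move=> /ol h; rewrite (elementaryD elj) (elementary_one elj); olin h.
by move=> /IH; rewrite (elementaryD elj) (elementary_one elj) mulrS addrA.
Qed.

Lemma between_generic (u v z : U) : (forall i, u + oag_one U *+ i < v) ->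
  exists x, [/\ forall i, u + oag_one U *+ i < x, forall i, x + oag_one U *+ i < v &
    forall m, (0 < m)%N -> divs m (x - z)].
Proof.
move=> uv.
have [|x [h1 h2 h3]] := @saturated_cut K K_nat K_lim U satU nat nat K_nat K_nat
    (fun i => u + oag_one U *+ i) (fun i => v - oag_one U *+ i) true z.
  move=> s s' m m0; have [B hB] := gap_coset regG mU m0.
  pose mx := foldr maxn 0%N (s ++ s').
  have hmx i : List.In i (s ++ s') -> (i <= mx)%N.
    rewrite /mx; elim: (s ++ s') => //= a t IH [->|/IH h]; first exact: leq_maxl.
    exact: leq_trans h (leq_maxr _ _).
  have [|x [x1 [x2 x3]]] := hB (u + oag_one U *+ mx) (v - oag_one U *+ mx) z.
    by have h := uv (mx + B + mx)%N; olin h.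
  exists x; split=> // i hi; have : (i <= mx)%N by apply: hmx; apply/In_cat; (by left) || (by right).
    by move=> /(one_le_nat U) h; olin (x1, h).
  by move=> /(one_le_nat U) h; olin (x2, h).
by exists x; split=> [|i|m m0]; [|have h := h2 i; olin h|exact: h3].
Qed.

Definition same_cut (E : set U) (u u' : U) : Prop := forall (k : int) a, E a ->
  (0 < u *~ k + a) = (0 < u' *~ k + a) /\ (u *~ k + a == 0) = (u' *~ k + a == 0).

Definition cut_inv (E : set U) (g : N) : Prop := forall u u', same_cut E u u' ->
  (forall n, (0 < n)%N -> divs n (u - u')) -> (j u < g <-> j u' < g).

Definition left_dense (E : set U) (g : N) : Prop := forall u, j u < g ->
  exists t n, [/\ E t, (0 < n)%N, u *+ n <= t & j t <= g *+ n].
Definition right_dense (E : set U) (g : N) : Prop := forall v, g < j v ->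
  exists t n, [/\ E t, (0 < n)%N, g *+ n <= j t & t <= v *+ n].

(* Otherwise some u < g < v have no multiple of an element of E between them.
   There are then x1 < x2 in between, congruent to v and to u modulo all
   integers, such that x2 and u, as well as x1 and v, have the same type over
   E, so invariance gives first x2 < g, hence x1 < g, and then v < g. *)
Lemma cut_dichotomy (E : set U) (g : N) : (forall a, E a -> E (- a)) -> ~ range j g ->
  cut_inv E g -> left_dense E g \/ right_dense E g.
Proof.
move=> EN ng inv; apply: contrapT => /not_orP[/existsNP[u /not_implyP[ug hu]] /existsNP[v /not_implyP[gv hv]]].
have nb t n : E t -> (0 < n)%N -> ~ (u *+ n <= t /\ t <= v *+ n).
  move=> Et n0 [h1 h2]; have [h|h] := orP (ole_total (j t) (g *+ n)).
    by apply: hu; exists t, n.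
  by apply: hv; exists t, n.
have uv i : u + oag_one U *+ i < v.
  rewrite -(elementary_lt elj) (elementaryD elj) (elementaryMn elj) (elementary_one elj).
  exact: lt_trans (far_from_range i ng ug) gv.
have same x y : u <= x -> x <= v -> u <= y -> y <= v -> same_cut E x y.
  move=> ux xv uy yv k a Ea.
  have pos (n : nat) b : E b -> (0 < x *+ n + b) = (0 < y *+ n + b) /\ (x *+ n + b == 0) = (y *+ n + b == 0).
    move=> Eb; have [->|n0] := posnP n; first by rewrite !mulr0n.
    have [h|h] := orP (ole_total (u *+ n) (- b)).
      have h' : v *+ n < - b.
        by rewrite oltNge; apply/negP => h2; apply: (nb (- b) n) => //; exact: EN.
      have hx : x *+ n + b < 0 by olin (h', nnM n (nn_le xv)).
      have hy : y *+ n + b < 0 by olin (h', nnM n (nn_le yv)).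
      by rewrite !oltNge (ltW hx) (ltW hy) (lt_eqF hx) (lt_eqF hy).
    have h' : - b < u *+ n.
      have uv0 : u <= v by have := uv 0%N; rewrite mulr0n addr0; exact: ltW.
      rewrite lt_neqAle h andbT; apply/eqP => e; apply: (nb (- b) n); [exact: EN|exact: n0|].
      by rewrite e; split=> //; olin (nnM n (nn_le uv0)).
    have hx : 0 < x *+ n + b by olin (h', nnM n (nn_le ux)).
    have hy : 0 < y *+ n + b by olin (h', nnM n (nn_le uy)).
    by rewrite hx hy (gt_eqF hx) (gt_eqF hy).
  case: k => n; first exact: pos.
  have [a1 a2] := pos n.+1 (- a) (EN _ Ea); have := sgn_opp a1 a2.
  by rewrite !NegzE !opprD !opprK !mulrNz.
have [x1 [h1 h2 h3]] := between_generic v uv.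
have [x2 [h4 h5 h6]] := between_generic u h2.
have ux1 : u < x1 by have := h1 0%N; rewrite mulr0n addr0.
have x1x2 : x1 < x2 by have := h4 0%N; rewrite mulr0n addr0.
have x2v : x2 < v by have := h5 0%N; rewrite mulr0n addr0.
have uu := ltW (lt_trans ux1 (lt_trans x1x2 x2v)).
have sc2 : same_cut E x2 u.
  by apply: same => //; [exact: ltW (lt_trans ux1 x1x2)|exact: ltW].
have sc1 : same_cut E x1 v.
  by apply: same => //; [exact: ltW|exact: ltW (lt_trans x1x2 x2v)].
have jx2 : j x2 < g := (inv _ _ sc2 h6).2 ug.
have : j v < g.
  by apply: (inv _ _ sc1 h3).1; apply: lt_trans jx2; rewrite (elementary_lt elj).
by move=> /(lt_trans gv); rewrite ltxx.
Qed.

Lemma fills_notin (H : set U) (g : N) : fills j H g -> ~ range j g.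
Proof.
move=> [f1 f2] [u _ ug]; rewrite -ug in f1 f2.
have /f2 : above H u by move=> h /f1; rewrite (elementary_lt elj).
by rewrite ltxx.
Qed.

Lemma not_lt_range (g : N) u : ~ range j g -> ~ (j u < g) -> g < j u.
Proof.
move=> ng; have [//|e|//] := otrichotomy (j u) g.
by case: ng; rewrite -e; exists u.
Qed.

Definition near_fills (g : N) : Prop := exists n t (s : int) H,
  [/\ (0 < n)%N, s = 1 \/ s = -1, convex_subgroup H & fills j H ((g *+ n - j t) *~ s)].

Lemma zero_convex : convex_subgroup [set (0 : U)].
Proof.
split; first by split=> // [x y /= -> ->|x /= ->]; rewrite ?addr0 ?oppr0.
by move=> x y z /= -> -> h1 h2; apply: le_anti; rewrite h1 h2.
Qed.

Lemma near_fills_rational (g : N) t n : (0 < n)%N -> ~ range j g ->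
  (forall u, j u < g -> u *+ n <= t) -> (forall v, g < j v -> t <= v *+ n) -> near_fills g.
Proof.
move=> n0 ng hu hv; have [B hB] := gap regG mU n0.
pose e := g *+ n - j t.
have ngn : ~ range j (g *+ n) by move=> /(elementary_pure elj n0).
have e1 w : oag_one U *+ B < w -> e < j w.
  move=> wB; have [|x [x1 x2]] := hB t (t + w); first by olin wB.
  have : g < j x by apply: not_lt_range => // /hu; rewrite oleNgt x1.
  rewrite -(elementary_lt elj) (elementaryMn elj) (elementaryD elj) in x2.
  by move=> h; rewrite /e; olin (x2, nnM n (nn_lt h)).
have e2 w : oag_one U *+ B < w -> - e < j w.
  move=> wB; have [|x [x1 x2]] := hB (t - w) t; first by olin wB.
  have : j x < g.
    have [//|e'|/hv] := otrichotomy (j x) g; last by rewrite oleNgt x2.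
    by case: ng; exists x.
  rewrite -(elementary_lt elj) (elementaryMn elj) (elementaryB elj) in x1.
  by move=> h; rewrite /e; olin (x1, nnM n (nn_lt h)).
have [o0|[o0 _]] := one_spec U; last first.
  have o0' : 0 < oag_one N by rewrite -(elementary_one elj) (elementary_gt0 elj).
  have w0 : oag_one U *+ B < oag_one U *+ B.+1 by olin o0.
  have b x : 0 <= x -> x < j (oag_one U *+ B.+1) -> range j x.
    rewrite (elementaryMn elj) (elementary_one elj) => x0 /ltW xB.
    have [i _ ->] := between_ones o0' x0 xB.
    by exists (oag_one U *+ i) => //; rewrite (elementaryMn elj) (elementary_one elj).
  exfalso; apply: ngn; have -> : g *+ n = e + j t by rewrite /e subrK.
  have [h|h] := orP (ole_total 0 e).
    by have [u _ <-] := b _ h (e1 _ w0); exists (u + t) => //; rewrite (elementaryD elj).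
  have h' : 0 <= - e by olin h.
  have [u _ ue] := b _ h' (e2 _ w0); exists (t - u) => //; rewrite (elementaryB elj) ue; zabel.
have ab w : above [set 0] w -> oag_one U *+ B < w by rewrite o0 mul0rn; apply.
have [h|h|h] := otrichotomy 0 e.
- exists n, t, 1, [set 0]; split=> //; [by left|exact: zero_convex|].
  rewrite mulr1z; split=> [_ ->|w /ab/e1 //]; by rewrite (elementary0 elj).
- by case: ngn; exists t => //; apply/eqP; rewrite eq_sym -subr_eq0 -/e h.
- exists n, t, (-1), [set 0]; split=> //; [by right|exact: zero_convex|].
  rewrite mulrNz mulr1z; split=> [_ ->|w /ab/e2 //]; rewrite (elementary0 elj); move: h; rewrite /e => h; olin h.
Qed.

Lemma near_fills_left (P : Type) (smP : small K [set: P]) (en : P -> U) (g : N) :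
  ~ range j g -> left_dense (range en) g -> near_fills g.
Proof.
move=> ng hl.
have [[t [n [n0 [h1 h2]]]]|nE] := pselect (exists t n, (0 < n)%N /\
   ((forall u, j u < g -> u *+ n <= t) /\ (forall v, g < j v -> t <= v *+ n))).
  exact: near_fills_rational h1 h2.
have [[u1 hu1]|nL] := pselect (exists u, j u < g); last first.
  exists 1%N, 0, (-1), setT; rewrite mulr1n mulrNz mulr1z (elementary0 elj) subr0; split=> //; first by right.
  split=> [h _|v /(_ v I)]; last by rewrite ltxx.
  have : g < j (- h) by apply: not_lt_range => // h'; apply: nL; exists (- h).
  by rewrite (elementaryN elj) => h'; olin h'.
pose valid (x : P * nat) := (0 < x.2)%N /\ j (en x.1) <= g *+ x.2.
pose Q := {x | valid x}.
have smQ : small K [set: Q].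
  apply: (small_inj (f := @proj1_sig _ valid)); last exact: small_prod.
  by move=> -[p1 h1] [p2 h2] /= e; subst p2; congr exist; exact: Prop_irrelevance.
have /choice[S hS] : forall x : Q, exists u, j u < g /\ en (sval x).1 < u *+ (sval x).2.
  move=> [[i n] [/= n0 h]]; apply: contrapT => h'; apply: nE; exists (en i), n; split=> //; split.
    by move=> u ug; rewrite oleNgt; apply/negP => h2; apply: h'; exists u.
  move=> v gv; rewrite -(elementary_le elj) (elementaryMn elj); apply: le_trans h _.
  by olin (nnM n (nn_lt gv)).
have cof u : j u < g -> exists x, u < S x.
  move=> /hl[t [n [[i _ <-] n0 h1 h2]]].
  have vx : valid (i, n) by [].
  exists (exist valid (i, n) vx); have [_ /= h] := hS (exist valid (i, n) vx).
  by olinM n (h, h1).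
have SL x : j (S x) < g by have [] := hS x.
pose H : set U := [set h | forall u, j u < g -> j (u + h) < g /\ j (u - h) < g].
have cH : convex_subgroup H.
  split; first split.
  - by move=> u; rewrite addr0 subr0.
  - move=> x y Hx Hy u ug; have [h1 h2] := Hx u ug.
    by rewrite addrA opprD addrA; split; [have [] := Hy _ h1|have [] := Hy _ h2].
  - by move=> x Hx u ug; rewrite opprK; have [] := Hx u ug.
  move=> x y z Hx Hz xy yz u ug; have [_ h1] := Hx u ug; have [h2 _] := Hz u ug.
  split; [apply: le_lt_trans h2|apply: le_lt_trans h1]; rewrite (elementary_le elj).
    by olin yz.
  by olin xy.
have [[H0 HD HN] Hc] := cH.
have abv v : above H v -> exists x, g < j (S x + v).
  move=> av; have v0 := av 0 H0.
  have nv : ~ H v by move=> /av; rewrite ltxx.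
  have [u [ug h]] : exists u, j u < g /\ g < j (u + v).
    apply: contrapT => h; apply: nv => u ug; split.
      apply: contrapT => h'; apply: h; exists u; split=> //; exact: not_lt_range.
    apply: le_lt_trans ug; rewrite (elementary_le elj); olin v0.
  have [x ux] := cof u ug; exists x; apply: lt_trans h _; rewrite (elementary_lt elj); olin ux.
have [[x hx]|nx] := pselect (exists x, forall v, above H v -> g < j (S x + v)).
  exists 1%N, (S x), 1, H; rewrite mulr1n mulr1z; split=> //; first by left.
  split=> [h Hh|v /hx].
    have [h1 _] := Hh _ (SL x); rewrite (elementaryD elj) in h1; olin h1.
  by rewrite (elementaryD elj) => h1; olin h1.
have /choice[w hw] : forall x, exists v, above H v /\ j (S x + v) < g.
  move=> x; apply: contrapT => h; apply: nx; exists x => v av.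
  by apply: not_lt_range => // h'; apply: h; exists v.
have /choice[S2 hS2] : forall x, exists x', g < j (S x' + w x) by move=> x; apply: abv; have [] := hw x.
have [|x [h1 h2 _]] := @saturated_cut K K_nat K_lim U satU Q Q smQ smQ S (fun x => S (S2 x) + w x) false 0.
  move=> s s' m _.
  have [x [xg hx]] : exists x, j x < g /\ forall i, List.In i s -> S i < x.
    elim: s => [|i s [x [xg hx]]]; first by exists u1.
    have [ix|xi] := orP (ole_total (S i) x).
      have [x' xx'] := cof x xg; exists (S x'); split=> // i' [<-|/hx h]; first exact: le_lt_trans ix xx'.
      exact: lt_trans h xx'.
    have [x' xx'] := cof _ (SL i); exists (S x'); split=> // i' [<- //|/hx h].
    exact: lt_trans h (le_lt_trans xi xx').
  exists x; split=> // i _; rewrite -(elementary_lt elj); exact: lt_trans xg (hS2 i).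
have gx : g < j x.
  apply: not_lt_range => // /cof[x' hx']; have := lt_trans hx' (h1 x'); by rewrite ltxx.
exists 1%N, x, (-1), H; rewrite mulr1n mulrNz mulr1z; split=> //; first by right.
split=> [h Hh|v av].
  have : g < j (x - h).
    apply: not_lt_range => // /Hh[+ _]; rewrite subrK => h'.
    by have := lt_trans h' gx; rewrite ltxx.
  by rewrite (elementaryB elj) => h'; olin h'.
have [i hi] := abv v av; have [_ hwi] := hw i.
have wv : w i < v by have := lt_trans hwi hi; rewrite (elementary_lt elj) => h; olin h.
have : j (x - v) < g.
  apply: lt_trans (SL (S2 i)); rewrite (elementary_lt elj); have h := h2 i; olin (h, wv).
by rewrite (elementaryB elj) => h; olin h.
Qed.

Lemma near_fills_dense (P : Type) (smP : small K [set: P]) (en : P -> U) (g : N) :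
  ~ range j g -> left_dense (range en) g \/ right_dense (range en) g -> near_fills g.
Proof.
move=> ng [|hr]; first exact: near_fills_left.
have [|v hv|n [t [s [H [n0 hs cH f]]]]] := @near_fills_left P smP (fun i => - en i) (- g).
- by move=> [u _ e]; apply: ng; exists (- u) => //; rewrite (elementaryN elj) e opprK.
- have /hr[t [n [[i _ <-] n0 h1 h2]]] : g < j (- v) by rewrite (elementaryN elj); olin hv.
  exists (- en i), n; split=> //; [olin h2|rewrite (elementaryN elj); olin h1].
exists n, (- t), (- s), H; split=> //; first by case: hs => ->; [right|left]; rewrite ?opprK.
have -> // : (g *+ n - j (- t)) *~ (- s) = (- g *+ n - j t) *~ s.
by rewrite (elementaryN elj); zabel.
Qed.

End Cuts.

Lemma lin_ord2 (t : lin 'I_2) : exists k l c : int, forall (U : oagType) (e : 'I_2 -> U),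
  leval e t = e ord0 *~ k + e ord_max *~ l + oag_one U *~ c.
Proof.
pose f (i : 'I_2) : bool := i != ord0.
have [k [l [c h]]] := lin2 (lmap f t); exists k, l, c => U e.
have := h U (fun b => if b then e ord_max else e ord0); rewrite leval_map => <-.
congr leval; apply/funext => i; rewrite /f /=; case: eqP => [->//|ni] /=.
by congr e; apply/val_inj; case: i ni => [[|[|]]] //= lt0 h0; case: h0; apply/val_inj.
Qed.

Section InvariantForms.
Variables (G : oagType) (regG : regular_oag G).
Variables (U N : oagType) (j : U -> N) (elj : elementary j).
Variables (mU : models (theory G) U).
Variables (J : Type) (q : set (formula (J + U))) (qglobal : global_type q).
Variables (d : J -> N) (dq : realizes d j q).
Variables (A : set U).
Hypothesis (inv : forall n (phi : formula (J + 'I_n)) (b b' : 'I_n -> U),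
      same_type A b b' -> (q (inst b phi) <-> q (inst b' phi))).

Definition gen_with (t : U) : lin (A + unit) -> U := leval (copair (val : A -> U) (fun=> t)).

Lemma gen_withN t a : range (gen_with t) a -> range (gen_with t) (- a).
Proof. by move=> [l _ <-]; exists (lscale (-1) l) => //; rewrite /gen_with leval_opp. Qed.

Lemma invariant_cut (l : lin J) (t : U) : cut_inv j (range (gen_with t)) (leval d l + j t).
Proof.
move=> u u' hs hd.
pose b (x : U) (i : 'I_2) := if i == ord0 then x else t.
pose phi : formula (J + 'I_2) :=
  fPos (ladd (lmap inl l) (ladd (lvar (inr ord_max)) (lscale (-1) (lvar (inr ord0))))).
have E x : q (inst (b x) phi) <-> j x < leval d l + j t.
  rewrite (complete_realizes qglobal (dq : realizes d (j \o id) q)) /inst sat_rename.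
  rewrite sat_fPos !leval_add leval_opp leval_map !leval_var /= /b /=.
  by rewrite -/(d) (_ : _ \o inl = d) //; split=> h; olin h.
rewrite -(E u) -(E u'); apply: inv; apply: (same_sat_forms regG mU mU) => f.
have [l1 [l2 hl]] := lin_sum f; have [k [k' [c hk]]] := lin_ord2 l1.
have [a [Ea Ha]] : exists a, range (gen_with t) a /\ forall x, leval (copair (b x) (val : A -> U)) f = x *~ k + a.
  pose lt : lin (A + unit) := ladd (lscale k' (lvar (inr tt))) (ladd (lscale c (lone _)) (lmap inl l2)).
  exists (gen_with t lt); split; first by exists lt.
  move=> x; have [-> _] := hl U (b x) val.
  rewrite hk /gen_with !leval_add !leval_scale leval_one leval_map leval_var /b /=.
  by rewrite (_ : x *~ k + _ + _ = x *~ k + (t *~ k' + oag_one U *~ c)) -?addrA //.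
rewrite !Ha; have [h1 h2] := hs k a Ea; split=> // n n0; apply: divs_cong.
by have := divs_mulz k (hd n n0); congr divs; zabel.
Qed.

End InvariantForms.

(** * Linking two types *)

Lemma divs_primes (M : oagType) n (z : M) : (0 < n)%N ->
  (forall pr i, prime pr -> (pr ^ i %| n)%N -> divs (pr ^ i) z) -> divs n z.
Proof.
elim/ltn_ind: n => n IH n0 h; have [n1|n1] := leqP n 1.
  have -> : n = 1%N by apply/eqP; rewrite eqn_leq n1.
  by exists z.
have pp := pdiv_prime n1; have [i [m [E cop m0]]] := pow_split pp n0.
have i0 : (0 < i)%N.
  rewrite lt0n; apply/eqP => i0; rewrite i0 expn0 muln1 in E.
  by move: cop; rewrite prime_coprime // -E pdiv_dvd.
rewrite E; apply/divs_coprime; first by rewrite coprime_sym coprimeXl.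
split; last by apply: h => //; rewrite [X in (_ %| X)%N]E dvdn_mull.
apply: IH => // [|pr i' ppr hm].
  by rewrite [X in (_ < X)%N]E ltn_Pmulr // -[X in (X < _)%N](expn0 (pdiv n)) ltn_exp2l // prime_gt1.
by apply: h => //; apply: dvdn_trans hm _; rewrite [X in (_ %| X)%N]E dvdn_mulr.
Qed.

Lemma fills_sign (U N M : oagType) (j : U -> N) (k : U -> M) (elj : elementary j) (elk : elementary k)
  (H : set U) g g' w : fills j H g -> fills k H g' ->
  (0 < g + j w) = (0 < g' + k w) /\ (g + j w == 0) = (g' + k w == 0).
Proof.
move=> f f'.
have [a|/not_above[h Hh wh]] := pselect (above H (- w)).
  have aux (X : oagType) (i : U -> X) (x : X) : elementary i -> fills i H x -> x + i w < 0.
    by move=> eli [_ /(_ _ a)]; rewrite (elementaryN eli) => h; olin h.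
  have h1 := aux _ _ _ elj f; have h2 := aux _ _ _ elk f'.
  by rewrite !oltNge (ltW h1) (ltW h2) (lt_eqF h1) (lt_eqF h2).
have aux (X : oagType) (i : U -> X) (x : X) : elementary i -> fills i H x -> 0 < x + i w.
  move=> eli [/(_ h Hh) h1 _]; rewrite -(elementary_le eli) (elementaryN eli) in wh.
  by olin (h1, wh).
have h1 := aux _ _ _ elj f; have h2 := aux _ _ _ elk f'.
by rewrite h1 h2 (gt_eqF h1) (gt_eqF h2).
Qed.

Section Determination.
Variables (G : oagType) (regG : regular_oag G).
Variables (U N : oagType) (j : U -> N) (elj : elementary j) (mU : models (theory G) U).
Variables (I J : Type) (p : set (formula (I + U))) (q : set (formula (J + U))).
Variables (pglobal : global_type p) (qglobal : global_type q).
Variables (c : I -> N) (d : J -> N) (cp : realizes c j p) (dq : realizes d j q).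
Variables (A : set U) (sigma : nat -> N -> N).
Let mN : models (theory G) N := models_elementary elj mU.
Let vA : A -> U := val.

Definition gensA : set U := range (fun l : lin A => leval vA l).

Definition cut_form (V : Type) (vJ : J -> V) (n : nat) (l : lin J) (t : V) (s : int) : lin V :=
  lscale s (ladd (lscale n (lmap vJ l)) (lscale (-1) (lvar t))).

Definition cut_data (n : nat) (l : lin J) (t : A) (s : int) (l1 : lin I) (u : A) (H : set U) : Prop :=
  [/\ (0 < n)%N, s = 1 \/ s = -1, convex_subgroup H,
     fills j H ((leval d l *+ n - j (vA t)) *~ s) & fills j H (leval c l1 + j (vA u))].

Definition on_left n l t s := left_dense j gensA ((leval d l *+ n - j (vA t)) *~ s).
Definition on_right n l t s := right_dense j gensA ((leval d l *+ n - j (vA t)) *~ s).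

Let X (l : lin I) : lin ((I + J) + A) := lmap (inl \o inl) l.
Let Y (l : lin J) : lin ((I + J) + A) := lmap (inl \o inr) l.
Let C (a : A) : lin ((I + J) + A) := lvar (inr a).

Definition cut_ineq n l t s l1 u : lin ((I + J) + A) :=
  ladd (ladd (X l1) (C u)) (lscale (-1) (lscale s (ladd (lscale n (Y l)) (lscale (-1) (C t))))).

Definition cong_data pr b m (l : lin J) (u : A) m' (l' : lin I) (u' : A) : Prop :=
  [/\ prime pr, kappa j d pr b, (0 < m)%N /\ (0 < m')%N, b *+ m = leval d l + j (vA u) &
     sigma pr b *+ m' = leval c l' + j (vA u')].

Definition cong_form m (l : lin J) (u : A) m' (l' : lin I) (u' : A) : lin ((I + J) + A) :=
  ladd (lscale m'%:Z (ladd (Y l) (C u))) (lscale (- m%:Z) (ladd (X l') (C u'))).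

Definition cut_formula (phi : formula ((I + J) + A)) : Prop := exists n l t s l1 u H,
  cut_data n l t s l1 u H /\
  ((on_left n l t s /\ phi = fPos (cut_ineq n l t s l1 u)) \/
   (on_right n l t s /\ phi = fPos (lscale (-1) (cut_ineq n l t s l1 u)))).

Definition cong_formula (phi : formula ((I + J) + A)) : Prop := exists pr b m l u m' l' u' i,
  cong_data pr b m l u m' l' u' /\ phi = fDiv (m * m' * pr ^ i) (cong_form m l u m' l' u').

(* Besides the restrictions of p and q: on which side of a form of [c] filling
   the same convex subgroup lies each form of [d], and that the elements of the
   basis for [d] are congruent to their images in the basis for [c]. *)
Definition link_type : set (formula ((I + J) + A)) :=
  [set phi | (@in_x I J A @` (@Defs.restrict U I A p)) phi \/ (@in_y I J A @` (@Defs.restrict U J A q)) phi \/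
     cut_formula phi \/ cong_formula phi].

Hypothesis order_data : forall l : lin J, (exists t : A, leval d l = j (vA t)) \/
  (exists n t s l1 u H, cut_data n l t s l1 u H /\ (on_left n l t s \/ on_right n l t s)).
Hypothesis basis_data : forall pr b, prime pr -> kappa j d pr b ->
  exists m l u m' l' u', cong_data pr b m l u m' l' u'.
Hypothesis span_data : forall (l : lin J) pr i, prime pr -> exists (s : seq (N * int)) (u : A) g,
  (forall t, t \in s -> kappa j d pr t.1) /\
  leval d l = \sum_(t <- s) t.1 *~ t.2 + j (vA u) + g *+ (pr ^ i).
Hypothesis sigma_basis : forall pr b, prime pr -> kappa j d pr b -> kappa j c pr (sigma pr b).
Hypothesis sigma_inj : forall pr, prime pr -> forall b b', kappa j d pr b -> kappa j d pr b' ->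
  sigma pr b = sigma pr b' -> b = b'.

Section Model.
Variables (M : oagType) (e : (I + J) + U -> M) (mM : models (theory G) M).
Let k : U -> M := e \o inr.
Let x : I -> M := e \o inl \o inl.
Let y : J -> M := e \o inl \o inr.
Hypothesis ep : forall phi, p phi -> sat e (in_x J phi).
Hypothesis elink : forall phi, link_type phi -> sat e (inst vA phi).

Let same_c : same_sat (copair c j) (copair x k).
Proof.
have H phi : p phi -> sat (copair x k) phi.
  move=> /ep; rewrite /in_x sat_rename; congr (sat _ _); by apply/funext => -[].
move=> phi; split=> s; first by apply: H; apply/(global_sat pglobal cp).
apply: contrapT => ns; have : sat (copair x k) (fNot phi) by apply: H; apply/(global_sat pglobal cp).
exact.
Qed.

Let elk : elementary k.
Proof.
move=> n phi a; rewrite (elementary_sat elj).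
have := same_c (rename (inr \o a) phi); rewrite !sat_rename.
exact.
Qed.

Let same_d : same_sat (copair d (j \o vA)) (copair y (k \o vA)).
Proof.
have H phi : sat (copair d (j \o vA)) phi -> sat (copair y (k \o vA)) phi.
  move=> s; have : link_type (in_y I phi).
    right; left; exists phi => //; rewrite /Defs.restrict /=; apply/(global_sat qglobal dq).
    by rewrite /inst sat_rename; move: s; congr (sat _ _); apply/funext => -[].
  move=> /elink; rewrite /inst /in_y !sat_rename; congr (sat _ _); by apply/funext => -[].
move=> phi; split=> s; first exact: H.
apply: contrapT => ns; have /H : sat (copair d (j \o vA)) (fNot phi) by [].
exact.
Qed.

Let e_link (l : lin ((I + J) + A)) : leval (e \o copair inl (inr \o vA)) l = leval (copair (copair x y) (k \o vA)) l.
Proof. by congr leval; apply/funext => -[[]|]. Qed.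

Let leval_same_d (l : lin J) (a : lin A) m s :
  [/\ (0 < (leval d l *+ m + j (leval vA a)) *~ s) = (0 < (leval y l *+ m + k (leval vA a)) *~ s),
   leval d l *+ m + j (leval vA a) = 0 <-> leval y l *+ m + k (leval vA a) = 0 &
   forall n, divs n (leval d l *+ m + j (leval vA a)) <-> divs n (leval y l *+ m + k (leval vA a))].
Proof.
pose f : lin (J + A) := ladd (lscale m (lmap inl l)) (lmap inr a).
have Ed : leval (copair d (j \o vA)) f = leval d l *+ m + j (leval vA a).
  by rewrite leval_add leval_scale !leval_map -(elementary_leval elj).
have Ey : leval (copair y (k \o vA)) f = leval y l *+ m + k (leval vA a).
  by rewrite leval_add leval_scale !leval_map -(elementary_leval elk).
rewrite -Ed -Ey; split; last by move=> n; exact: same_sat_divs.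
- by rewrite -!leval_scale; exact: same_sat_pos.
- exact: same_sat_eq0.
Qed.

Let fills_y n l t s l1 u H : cut_data n l t s l1 u H -> on_left n l t s \/ on_right n l t s ->
  fills k H ((leval y l *+ n - k (vA t)) *~ s).
Proof.
move=> cd; have [n0 hs cH f1 f2] := cd => lr.
have [[H0 HD HN] Hc] := cH.
have f2' : fills k H (leval x l1 + k (vA u)).
  have E (R : oagType) (z : I -> R) (i : U -> R) :
    leval (copair z i) (ladd (lmap inl l1) (lvar (inr (vA u)))) = leval z l1 + i (vA u).
    by rewrite leval_add leval_map leval_var.
  have [g1 g2] := f2; split=> [h /g1|v /g2].
    have := same_sat_pos same_c (ladd (ladd (lmap inl l1) (lvar (inr (vA u)))) (lscale (-1) (lvar (inr h)))).
    by rewrite !leval_add !leval_opp !leval_map !leval_var /= => h1 h2; rewrite olt_sub -h1 -olt_sub.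
  have := same_sat_pos same_c (ladd (lvar (inr v)) (lscale (-1) (ladd (lmap inl l1) (lvar (inr (vA u)))))).
  by rewrite !leval_add !leval_opp !leval_add !leval_map !leval_var /= => h1 h2; rewrite olt_sub -h1 -olt_sub.
set ed := (leval d l *+ n - j (vA t)) *~ s in f1 *.
set ey := (leval y l *+ n - k (vA t)) *~ s.
have cmp m (a : lin A) s' : (0 < (ed *+ m + j (leval vA a)) *~ s') = (0 < (ey *+ m + k (leval vA a)) *~ s').
  have := same_sat_pos same_d (lscale s' (ladd (lscale m (cut_form inl n l (inr t) s)) (lmap inr a))).
  rewrite /cut_form !leval_scale !leval_add !leval_scale !leval_add !leval_opp !leval_scale !leval_map !leval_var /=.
  by rewrite -(elementary_leval elj vA a) -(elementary_leval elk vA a) -!pmulrn.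
have cle m (a : lin A) : (j (leval vA a) <= ed *+ m) = (k (leval vA a) <= ey *+ m).
  rewrite !oleNgt; congr negb; have := cmp m (lscale (-1) a) (-1).
  rewrite leval_opp !mulrNz !mulr1z (elementaryN elj) (elementaryN elk) !opprB => h.
  by rewrite olt_sub h -olt_sub.
have cge m (a : lin A) : (ed *+ m <= j (leval vA a)) = (ey *+ m <= k (leval vA a)).
  rewrite !oleNgt; congr negb; have := cmp m (lscale (-1) a) 1.
  rewrite leval_opp !mulr1z (elementaryN elj) (elementaryN elk) => h.
  by rewrite olt_sub h -olt_sub.
have ineq (b : int) : (b = 1 /\ on_left n l t s) \/ (b = -1 /\ on_right n l t s) ->
    0 < (leval x l1 + k (vA u) - ey) *~ b.
  move=> hb.
  have : sat e (inst vA (fPos (lscale b (cut_ineq n l t s l1 u)))).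
    apply: elink; right; right; left; exists n, l, t, s, l1, u, H; split=> //.
    case: hb => -[-> hlr]; [left|right]; split=> //.
    congr fPos; rewrite /lscale; case: (cut_ineq _ _ _ _ _ _) => z w /=.
    by rewrite mulr1; congr pair; elim: z => //= -[z1 z2] z IH; rewrite IH mulr1.
  rewrite /inst sat_rename sat_fPos e_link leval_scale /cut_ineq leval_add leval_opp leval_scale !leval_add.
  rewrite leval_scale leval_opp /X /Y /C !leval_map !leval_var /= /ey -pmulrn.
  by rewrite (_ : _ \o (inl \o inl) = x) // (_ : _ \o (inl \o inr) = y).
have ey0 : 0 < ed -> 0 < ey.
  have := cmp 1%N (lzero A) 1; rewrite leval_zero (elementary0 elj) (elementary0 elk) !addr0 !mulr1n !mulr1z.
  by move=> ->.
have ed0 : 0 < ed := fills_gt0 elj cH f1.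
have {}ey0 := ey0 ed0.
case: lr => [hl|hr].
  split=> [h Hh|v av].
    have pos h' : H h' -> k h' <= ey.
      move=> Hh'; have [g1 _] := f1; have [t' [n' [[a _ <-] n'0 h1 h2]]] := hl _ (g1 _ Hh').
      rewrite cle in h2; rewrite -(elementary_le elk) (elementaryMn elk) in h1.
      by olinM n' (h1, h2).
    have [h0|h0] := orP (ole_total h 0).
      by apply: le_lt_trans ey0; rewrite -(elementary0 elk) (elementary_le elk).
    have [h0'|h0'|h0'] := otrichotomy 0 h.
    + have := pos (h + h) (HD _ _ Hh Hh); rewrite (elementaryD elk) => h1.
      have h2 : 0 < k h by rewrite (elementary_gt0 elk).
      by olin (h2, h1).
    + by rewrite -h0' (elementary0 elk).
    + by move: h0; rewrite oleNgt h0'.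
  have [_ /(_ v av) h1] := f2'.
  have := ineq 1 (or_introl (conj erefl hl)); rewrite mulr1z => h2.
  by olin (h1, h2).
have h2 := ineq (-1) (or_intror (conj erefl hr)); rewrite mulrNz mulr1z in h2.
split=> [h Hh|v av].
  by have [/(_ h Hh) h1 _] := f2'; olin (h1, h2).
have [v' av' v'v] := fills_div regG elj mU cH f1 (isT : (0 < 2)%N) av.
have [_ /(_ v' av')] := f1 => /hr[t' [n' [[a _ <-] n'0 h1 h3]]].
rewrite cge in h1; rewrite -(elementary_le elk) (elementaryMn elk) in h3.
have h4 : ey <= k v' by olinM n' (h1, h3).
have v'0 : 0 < k v' by rewrite (elementary_gt0 elk); exact: av'.
rewrite -(elementary_lt elk) (elementaryMn elk) in v'v.
by olin (v'v, h4, v'0).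
Qed.

Let sign_y (l : lin J) u : (0 < leval d l + j u) = (0 < leval y l + k u) /\
  (leval d l + j u == 0) = (leval y l + k u == 0).
Proof.
have [[t ht]|[n [t [s [l1 [u' [H [cd lr]]]]]]]] := order_data l.
  have hy : leval y l = k (vA t).
    have [_ h _] := leval_same_d l (lscale (-1) (lvar t)) 1%N 1.
    rewrite !mulr1n leval_opp leval_var (elementaryN elj) (elementaryN elk) in h.
    apply: subr0_eq; apply/h; by rewrite ht subrr.
  rewrite ht hy -(elementaryD elj) -(elementaryD elk) (elementary_gt0 elj) (elementary_gt0 elk).
  split=> //; apply/eqP/eqP; rewrite -?(elementary0 elj) -?(elementary0 elk).
    by move=> /(elementary_inj elj) ->.
  by move=> /(elementary_inj elk) ->.
have fy := fills_y cd lr; have [n0 hs cH f1 _] := cd.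
have [s1 s2] := fills_sign elj elk ((vA t + u *+ n) *~ s) f1 fy.
have Ed : (leval d l *+ n - j (vA t)) *~ s + j ((vA t + u *+ n) *~ s) = (leval d l + j u) *+ n *~ s.
  by rewrite (elementaryMz elj) (elementaryD elj) (elementaryMn elj); zabel.
have Ey : (leval y l *+ n - k (vA t)) *~ s + k ((vA t + u *+ n) *~ s) = (leval y l + k u) *+ n *~ s.
  by rewrite (elementaryMz elk) (elementaryD elk) (elementaryMn elk); zabel.
rewrite Ed Ey in s1 s2.
have : (0 < (leval d l + j u) *+ n) = (0 < (leval y l + k u) *+ n) /\
   ((leval d l + j u) *+ n == 0) = ((leval y l + k u) *+ n == 0).
  case: hs s1 s2 => ->; first by rewrite !mulr1z.
  rewrite !mulrNz !mulr1z => h1 h2; have := sgn_opp h1 h2; by rewrite !opprK.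
by rewrite !omulrn_gt0 // !omulrn_eq0.
Qed.

Let divs_y (l : lin J) u n : (0 < n)%N -> divs n (leval d l + j u) <-> divs n (leval y l + k u).
Proof.
have [tau [t1 t2 t3 t4]] := hull_transfer same_d.
have [tau' [t1' t2' t3' t4']] := hull_transfer same_c.
suff H pr i : prime pr -> divs (pr ^ i) (leval d l + j u) <-> divs (pr ^ i) (leval y l + k u).
  move=> n0; split=> h; apply: divs_primes => // pr i ppr hn; apply/(H pr i ppr); exact: divs_dvd h.
move=> ppr; have [s [u1 [g [hs E]]]] := span_data l i ppr.
have [Bd1 Bd2 _] := kappaP regG elj mN d ppr.
have [Bc1 Bc2 _] := kappaP regG elj mN c ppr.
have hB b : kappa j d pr b -> [/\ hull (copair d (j \o vA)) b, hull (copair c j) (sigma pr b) &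
    divs (pr ^ i) (tau b - tau' (sigma pr b))].
  move=> Bb; have [m [l2 [u2 [m' [l2' [u2' cd]]]]]] := basis_data ppr Bb.
  have [_ _ [m0 m'0] e1 e2] := cd.
  pose f : lin (J + A) := ladd (lmap inl l2) (lvar (inr u2)).
  pose f' : lin (I + U) := ladd (lmap inl l2') (lvar (inr (vA u2'))).
  have E1 : b *+ m = leval (copair d (j \o vA)) f by rewrite leval_add leval_map leval_var e1.
  have E2 : sigma pr b *+ m' = leval (copair c j) f' by rewrite leval_add leval_map leval_var e2.
  split; [by exists m, f|by exists m', f'|].
  have : sat e (inst vA (fDiv (m * m' * pr ^ i) (cong_form m l2 u2 m' l2' u2'))).
    by apply: elink; right; right; right; exists pr, b, m, l2, u2, m', l2', u2', i.
  rewrite /inst sat_rename sat_fDiv e_link /cong_form leval_add !leval_scale !leval_add /X /Y /C !leval_map !leval_var /=.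
  rewrite (_ : _ \o (inl \o inl) = x) // (_ : _ \o (inl \o inr) = y) //.
  have T1 := t1 _ _ _ m0 E1; have T2 := t1' _ _ _ m'0 E2.
  rewrite leval_add leval_map leval_var /= in T1; rewrite leval_add leval_map leval_var /= in T2.
  have -> : (leval y l2 + k (vA u2)) *~ m' + (leval x l2' + k (vA u2')) *~ - m%:Z =
     (tau b - tau' (sigma pr b)) *+ (m * m').
    have <- : tau b *+ m = leval y l2 + k (vA u2) by rewrite T1 (_ : _ \o inl = y).
    have <- : tau' (sigma pr b) *+ m' = leval x l2' + k (vA u2') by rewrite T2 (_ : _ \o inl = x).
    by zabel.
  by rewrite mulnC; move/divsM; apply; rewrite muln_gt0 m0.
have [ss [kk [us ssl sF]]] := sum_uniqF s.
have ssB b : b \in ss -> kappa j d pr b by move=> /ssl[t /hs ht <-].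
have tau_u : tau (j (vA u1)) = k (vA u1).
  have := t1 (j (vA u1)) 1%N (lvar (inr u1)) isT; rewrite !leval_var mulr1n; exact.
have tau'_u v : tau' (j v) = k v.
  have := t1' (j v) 1%N (lvar (inr v)) isT; rewrite !leval_var mulr1n; exact.
have hu1 : hull (copair d (j \o vA)) (j (vA u1)) by exact: (hull_var (copair d (j \o vA)) (inr u1)).
have hS : hull (copair d (j \o vA)) (\sum_(b <- ss) b *~ kk b).
  by apply: hull_sum => b /ssB /hB[hb _ _]; exact: hull_mulz.
have hl : hull (copair d (j \o vA)) (leval d l).
  by have := hull_leval (copair d (j \o vA)) (lmap inl l); rewrite leval_map.
have pi0 : (0 < pr ^ i)%N by rewrite expn_gt0 prime_gt0.
have hg : hull (copair d (j \o vA)) g.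
  apply: (hull_pure pi0); have -> : g *+ (pr ^ i) = leval d l - (\sum_(b <- ss) b *~ kk b + j (vA u1)).
    by rewrite {1}E (sF _ id); zabel.
  by apply: hullB => //; exact: hullD.
have tl : tau (leval d l) = leval y l.
  have := t1 (leval d l) 1%N (lmap inl l) isT; rewrite !leval_map mulr1n; exact.
have tsum (s' : seq N) (V : Type) (ev : V -> N) (tt : N -> M) (F : N -> N) (f : N -> int) :
    (forall a b, hull ev a -> hull ev b -> tt (a + b) = tt a + tt b) ->
    (forall a q, hull ev a -> tt (a *~ q) = tt a *~ q) -> (tt 0 = 0) ->
    (forall b, b \in s' -> hull ev (F b)) ->
    tt (\sum_(b <- s') F b *~ f b) = \sum_(b <- s') tt (F b) *~ f b.
  move=> a1 a2 a0; elim: s' => [|b s' IH] hs'; first by rewrite !big_nil.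
  have hs'' b' : b' \in s' -> hull ev (F b') by move=> h; apply: hs'; rewrite in_cons h orbT.
  have hb := hs' b (mem_head _ _).
  rewrite !big_cons a1 ?a2 ?IH //; first exact: hull_mulz.
  by apply: hull_sum => b' /hs''; exact: hull_mulz.
have tau0 : tau 0 = 0 by have [_ [h _] _ _] := t4 0 (hull0 _); exact: h.
have tau'0 : tau' 0 = 0 by have [_ [h _] _ _] := t4' 0 (hull0 _); exact: h.
have Ey : divs (pr ^ i) (leval y l + k u - tau' (\sum_(b <- ss) sigma pr b *~ kk b + j (vA u1 + u))).
  have hS' : hull (copair c j) (\sum_(b <- ss) sigma pr b *~ kk b).
    by apply: hull_sum => b /ssB /hB[_ hb _]; exact: hull_mulz.
  rewrite t2' //; last exact: hull_range.
  have E3 : tau (\sum_(b <- ss) b *~ kk b + j (vA u1) + g *+ (pr ^ i)) =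
      \sum_(b <- ss) tau b *~ kk b + k (vA u1) + tau g *~ (pr ^ i)%N.
    rewrite (t2 _ _ (hullD hS hu1) (hull_muln _ hg)) (t2 _ _ hS hu1) tau_u [g *+ _]pmulrn (t3 _ _ hg).
    rewrite (tsum _ _ (copair d (j \o vA)) tau id) //; by move=> b /ssB /hB[].
  rewrite tau'_u (elementaryD elk) -tl E (sF _ id) E3.
  rewrite (tsum _ _ (copair c j) tau' (sigma pr)) //; last by move=> b /ssB /hB[].
  have -> : \sum_(b <- ss) tau b *~ kk b + k (vA u1) + tau g *~ (pr ^ i)%N + k u -
      (\sum_(b <- ss) tau' (sigma pr b) *~ kk b + (k (vA u1) + k u)) =
      (\sum_(b <- ss) tau b *~ kk b - \sum_(b <- ss) tau' (sigma pr b) *~ kk b) + tau g *~ (pr ^ i)%N.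
    by zabel.
  apply: divsD; last by exists (tau g).
  rewrite -sumrB; apply: divs_sum => b /ssB /hB[_ _ h]; rewrite -mulrzBl; exact: divs_mulz.
rewrite (divs_cong Ey).
have hS'' : hull (copair c j) (\sum_(b <- ss) sigma pr b *~ kk b + j (vA u1 + u)).
  apply: hullD; last exact: hull_range.
  by apply: hull_sum => b /ssB /hB[_ hb _]; exact: hull_mulz.
have [_ _ _ /(_ (pr ^ i)%N) <-] := t4' _ hS''.
have Ed : divs (pr ^ i) (leval d l + j u - (\sum_(b <- ss) b *~ kk b + j (vA u1 + u))).
  by rewrite E (sF _ id) (elementaryD elj); exists g; zabel.
rewrite (divs_cong Ed).
rewrite (divs_independent elj ppr Bd1 Bd2 i (F := id)) //.
rewrite (divs_independent elj ppr Bc1 Bc2 i (F := sigma pr)) //.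
- by move=> b /ssB; exact: sigma_basis.
- by move=> b b' /ssB hb /ssB hb'; exact: sigma_inj.
Qed.

Lemma link_determines phi : q phi -> sat e (in_y I phi).
Proof.
move=> /(global_sat' qglobal dq) s; rewrite /in_y sat_rename.
rewrite (_ : _ \o _ = copair y k); last by apply/funext => -[].
apply/(_ : same_sat (copair d j) (copair y k)) => //.
apply: (same_sat_forms regG mN mM) => f; have [l [l' hl]] := lin_sum f.
have [-> _] := hl _ d j; have [-> _] := hl _ y k.
rewrite (elementary_leval elj id l') (elementary_leval elk id l').
have [h1 h2] := sign_y l (leval id l'); split=> // n n0; exact: divs_y.
Qed.

End Model.
End Determination.

(** * Consistency of the linking type *)

Lemma crt_pair (M : oagType) a b (y z : M) : coprime a b ->
  exists x, divs a (x - y) /\ divs b (x - z).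
Proof.
move=> cop; have [u [v]] := Bezoutz a b; rewrite /gcdz /= (eqP cop) => uv.
exists (y *~ (v * b%:Z) + z *~ (u * a%:Z)); split.
  exists ((z - y) *~ u); have {2}-> : y = y *~ (u * a%:Z + v * b%:Z) by rewrite uv mulr1z.
  by zabel.
exists ((y - z) *~ v); have {2}-> : z = z *~ (u * a%:Z + v * b%:Z) by rewrite uv mulr1z.
by zabel.
Qed.

Lemma crt_primes (M : oagType) (s : seq nat) (e : nat -> nat) (z : nat -> M) :
  uniq s -> {in s, forall p, prime p} -> exists x, forall p, p \in s -> divs (p ^ e p) (x - z p).
Proof.
elim: s => [|p s IH] /=; first by exists 0.
move=> /andP[ps us] hs.
have [|x hx] := IH us; first by move=> r rs; apply: hs; rewrite in_cons rs orbT.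
have pp : prime p by apply: hs; rewrite mem_head.
pose Q := (\prod_(r <- s) r ^ e r)%N.
have cop : coprime Q (p ^ e p).
  apply: coprimeXr; rewrite /Q; elim: (s) ps hs {us IH hx} => [|r s' IH] ps hs.
    by rewrite big_nil coprime1n.
  move: ps; rewrite in_cons negb_or => /andP[pr ps].
  rewrite big_cons coprimeMl IH // ?andbT; last first.
    by move=> q; rewrite in_cons => /orP[/eqP->//|qs]; apply: hs; rewrite !in_cons qs !orbT.
  apply: coprimeXl; rewrite prime_coprime ?dvdn_prime2 // 1?eq_sym //; apply: hs; by rewrite !in_cons eqxx orbT.
have [y [hy1 hy2]] := crt_pair x (z p) cop.
exists y => r; rewrite in_cons => /orP[/eqP->//|rs].
have -> : y - z r = (y - x) + (x - z r) by zabel.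
apply: divsD; last exact: hx.
by apply: divs_dvd hy1; rewrite /Q (big_rem r) //= dvdn_mulr.
Qed.

Lemma mulz_bound (M : oagType) (eps x : M) (k : int) : - eps < x -> x < eps ->
  x *~ k <= eps *+ `|k| /\ - (x *~ k) <= eps *+ `|k|.
Proof.
move=> h1 h2; case: k => n /=; split.
- by olin (nnW (nnM n (nn_lt h2)) : nn false _).
- by olin (nnW (nnM n (nn_lt h1)) : nn false _).
- by rewrite NegzE; olin (nnW (nnM n.+1 (nn_lt h1)) : nn false _).
- by rewrite NegzE; olin (nnW (nnM n.+1 (nn_lt h2)) : nn false _).
Qed.

Lemma sum_bound (M : oagType) n (eps : M) (x : 'I_n -> M) (k : 'I_n -> int) :
  0 < eps -> (forall i, - eps < x i /\ x i < eps) ->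
  \sum_i x i *~ k i < eps *+ (\sum_i `|k i|)%N.+1 /\ - (\sum_i x i *~ k i) < eps *+ (\sum_i `|k i|)%N.+1.
Proof.
move=> e0; elim: n x k => [|n IH] x k hx; first by rewrite !big_ord0 oppr0 mulr1n.
rewrite !big_ord_recl; have [h1 h2] := IH (fun i => x (lift ord0 i)) (fun i => k (lift ord0 i)) (fun i => hx _).
have [g1 g2] := hx ord0; have [h3 h4] := mulz_bound (k ord0) g1 g2.
split; [olin (h1, h3)|olin (h2, h4)].
Qed.

Lemma sum_divs (M : oagType) (T : Type) (s : seq T) m (x y : T -> M) (a : T -> int) :
  (forall i, divs m (x i - y i)) -> divs m (\sum_(i <- s) x i *~ a i - \sum_(i <- s) y i *~ a i).
Proof.
move=> h; rewrite -sumrB; elim/big_ind: _ => [|u v|i _]; [exact: divs0|exact: divsD|].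
by rewrite -mulrzBl; exact: divs_mulz.
Qed.

Definition add_mod (N : oagType) (D : set N) (P : nat) (h : N -> N) : Prop :=
  forall x y, D x -> D y -> divs P (h (x + y) - h x - h y).

Section AddMod.
Variables (N : oagType) (D : set N) (P : nat) (h : N -> N).
Hypotheses (D0 : D 0) (DD : forall x y, D x -> D y -> D (x + y)) (DZ : forall x k, D x -> D (x *~ k)).
Hypothesis ah : add_mod D P h.

Lemma add_mod0 : divs P (h 0).
Proof.
by have := ah D0 D0; rewrite addr0 => /divsN; rewrite (_ : - _ = h 0) //; zabel.
Qed.

Lemma add_modZ x k : D x -> divs P (h (x *~ k) - h x *~ k).
Proof.
move=> Dx.
have hn (n : nat) : divs P (h (x *~ n) - h x *~ n).
  elim: n => [|n IH]; first by rewrite !mulr0z subr0; exact: add_mod0.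
  have := divsD (ah Dx (DZ n Dx)) IH; have -> : x + x *~ n = x *~ n.+1 by zabel.
  by congr divs; zabel.
case: k => n; first exact: hn.
have := ah (DZ (Negz n) Dx) (DZ n.+1 Dx).
have -> : x *~ Negz n + x *~ n.+1 = 0 by rewrite NegzE; zabel.
move=> h1; have := divsB (divsB add_mod0 h1) (hn n.+1).
by congr divs; rewrite NegzE; zabel.
Qed.

Lemma add_mod_sum n (x : 'I_n -> N) (k : 'I_n -> int) : (forall i, D (x i)) ->
  D (\sum_i x i *~ k i) /\ divs P (h (\sum_i x i *~ k i) - \sum_i h (x i) *~ k i).
Proof.
elim: n x k => [|n IH] x k hx; first by rewrite !big_ord0 subr0; split=> //; exact: add_mod0.
rewrite !big_ord_recl.
have [h1 h2] := IH (fun i => x (lift ord0 i)) (fun i => k (lift ord0 i)) (fun i => hx _).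
split; first by apply: (DD) => //; exact: (DZ).
have h3 := add_modZ (k ord0) (hx ord0); have h4 := ah (DZ (k ord0) (hx ord0)) h1.
by have := divsD h4 (divsD h3 h2); congr divs; zabel.
Qed.
End AddMod.

Section Delta.
Variables (G : oagType) (regG : regular_oag G).
Variables (N : oagType) (mN : models (theory G) N) (o0 : oag_one N = 0).
Variables (W : set N).
Hypotheses (W0 : W 0) (WD : forall x y, W x -> W y -> W (x + y)) (WN : forall x, W x -> W (- x)).

Let shrink C (eps : N) : 0 < eps -> exists eps', 0 < eps' /\ eps' *+ C.+1 < eps.
Proof.
move=> e0; have [B hB] := gap regG mN (isT : (0 < C.+1)%N).
have [|x [x1 x2]] := hB 0 eps; first by rewrite o0 mul0rn addr0.
by exists x; rewrite omulrn_gt0 in x1.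
Qed.

(* Infinitesimal realization of a homomorphism modulo [m]: the relations of
   [d] over [W] are preserved. *)
Lemma infinitesimal_lift n (d : 'I_n -> N) : exists M0, (0 < M0)%N /\
  forall m, (0 < m)%N -> forall (D : set N) (h : N -> N),
    D 0 -> (forall x y, D x -> D y -> D (x + y)) -> (forall x k, D x -> D (x *~ k)) ->
    (forall i, D (d i)) -> (forall w, W w -> D w) ->
    add_mod D (m * M0) h -> (forall w, W w -> divs (m * M0) (h w)) ->
    forall eps, 0 < eps -> exists del : 'I_n -> N,
    [/\ forall i, - eps < del i /\ del i < eps, forall i, divs m (del i - h (d i)) &
     forall a : 'I_n -> int, W (\sum_i d i *~ a i) -> \sum_i del i *~ a i = 0].
Proof.
elim: n d => [|n IH] d.
  exists 1%N; split=> // m m0 D h _ _ _ _ _ _ _ eps e0; exists (fun=> 0).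
  by split=> [[]//|[]//|a _]; rewrite big_ord0.
have [M0 [M00 hM0]] := IH (fun i => d (lift ord0 i)).
have [[k [a [w [k0 Ww E]]]]|nk] := pselect (exists k a w, [/\ (0 < k)%N, W w &
    d ord0 *+ k = \sum_(i < n) d (lift ord0 i) *~ a i + w]).
  exists (k * M0)%N; rewrite muln_gt0 k0; split=> // m m0 D h D0 DD DZ dD WDs ah hW eps e0.
  have [eps' [e'0 he']] := shrink (\sum_i `|a i|)%N e0.
  have mk0 : (0 < m * k)%N by rewrite muln_gt0 m0.
  rewrite mulnA in ah hW.
  have [del [d1 d2 d3]] := hM0 (m * k)%N mk0 D h D0 DD DZ (fun i => dD _) WDs ah hW eps' e'0.
  pose S := \sum_i del i *~ a i.
  have dvP : (m * k %| m * k * M0)%N by rewrite dvdn_mulr.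
  have ah' : add_mod D (m * k) h by move=> x y Dx Dy; exact: divs_dvd dvP (ah x y Dx Dy).
  have hS : divs (m * k) (S - h (d ord0) *+ k).
    have [g1 g2] := @add_mod_sum _ D (m * k) h D0 DD DZ ah' n (fun i => d (lift ord0 i)) a (fun i => dD _).
    have g3 : divs (m * k) (S - \sum_i h (d (lift ord0 i)) *~ a i).
      exact: sum_divs.
    have g4 := ah' _ _ g1 (WDs _ Ww); rewrite -E in g4.
    have g5 := add_modZ D0 DZ ah' k (dD ord0); rewrite -pmulrn in g5.
    have g6 := divs_dvd dvP (hW _ Ww).
    by have := divsD (divsB g3 g2) (divsD g5 (divsB (divsN g4) g6)); congr divs; zabel.
  have [x hx] := hS; pose del0 := h (d ord0) + x *+ m.
  have E0 : del0 *+ k = S by rewrite /del0; have -> : S = h (d ord0) *+ k + x *+ (m * k) by [rewrite -hx; zabel]; zabel.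
  have [b1 b2] := sum_bound a e'0 d1.
  have k1 : exists k', k = k'.+1 by exists k.-1; rewrite prednK.
  have [k' Ek] := k1.
  have ek : 0 <= eps *+ k' by have /= := nnM k' (ltW e0 : nn false eps).
  exists (fun i => if unlift ord0 i is Some i' then del i' else del0); split=> [i|i|b].
  - case: unliftP => [i' _|_].
      have [c1 c2] := d1 i'.
      have ee : eps' <= eps.
        have hp : 0 <= eps' *+ (\sum_i `|a i|)%N by have /= := nnM (\sum_i `|a i|)%N (ltW e'0 : nn false eps').
        by olin (he', hp).
      by split; [olin (c1, ee)|olin (c2, ee)].
    rewrite -/S -E0 Ek in b1 b2.
    by split; [olinM k'.+1 (b2, he', ek)|olinM k'.+1 (b1, he', ek)].
  - case: unliftP => [i' ->|->]; first by apply: divs_dvd (d2 i'); rewrite dvdn_mulr.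
    by exists x; rewrite /del0; zabel.
  - rewrite !big_ord_recl unlift_none => hWb.
    under eq_bigr => i _ do rewrite liftK.
    have Wk z m' : W z -> W (z *~ m').
      by move=> Wz; apply: (subgroup_mulz W0 WD WN).
    have hWc : W (\sum_i d (lift ord0 i) *~ (b (lift ord0 i) * k%:Z + a i * b ord0)).
      have -> : \sum_i d (lift ord0 i) *~ (b (lift ord0 i) * k%:Z + a i * b ord0) =
         (d ord0 *~ b ord0 + \sum_i d (lift ord0 i) *~ b (lift ord0 i)) *~ k%:Z - w *~ b ord0.
        have -> : (d ord0 *~ b ord0 + \sum_i d (lift ord0 i) *~ b (lift ord0 i)) *~ k%:Z =
           (d ord0 *+ k) *~ b ord0 + (\sum_i d (lift ord0 i) *~ b (lift ord0 i)) *~ k%:Z by zabel.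
        rewrite E !mulrz_suml mulrzDl !mulrz_suml.
        have -> : \sum_i d (lift ord0 i) *~ (b (lift ord0 i) * k%:Z + a i * b ord0) =
           \sum_i d (lift ord0 i) *~ a i *~ b ord0 + \sum_i d (lift ord0 i) *~ b (lift ord0 i) *~ k%:Z.
          by rewrite -big_split; apply: eq_bigr => i _ /=; zabel.
        by zabel.
      by apply: (WD); [exact: Wk|apply: WN; exact: Wk].
    have := d3 _ hWc => E1; apply: (omulrnI k0); rewrite mul0rn; apply: etrans E1.
    have -> : (del0 *~ b ord0 + \sum_i del i *~ b (lift ord0 i)) *+ k =
      (del0 *+ k) *~ b ord0 + (\sum_i del i *~ b (lift ord0 i)) *~ k%:Z by zabel.
    rewrite E0 /S !mulrz_suml -big_split; apply: eq_bigr => i _ /=; by zabel.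
exists M0; split=> // m m0 D h D0 DD DZ dD WDs ah hW eps e0.
have [del [d1 d2 d3]] := hM0 m m0 D h D0 DD DZ (fun i => dD _) WDs ah hW eps e0.
have [B hB] := gap_coset regG mN m0.
have [|del0 [c1 [c2 c3]]] := hB 0 eps (h (d ord0)); first by rewrite o0 mul0rn addr0.
exists (fun i => if unlift ord0 i is Some i' then del i' else del0); split=> [i|i|b].
- case: unliftP => [i' _|_]; first exact: d1.
  by split=> //; olin (c1, e0).
- by case: unliftP => [i' ->|->].
- rewrite !big_ord_recl unlift_none => hWb.
  under eq_bigr => i _ do rewrite liftK.
  have b0 : b ord0 = 0.
    apply/eqP; apply: contrapT => /negP nb; apply: nk.
    pose S := \sum_(i < n) d (lift ord0 i) *~ b (lift ord0 i).
    have := hWb; rewrite -/S; case Eb: (b ord0) => [k|k] hWb'.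
      exists k, (fun i => - b (lift ord0 i)), (d ord0 *~ k + S); rewrite lt0n; split=> //.
        by apply/eqP => k0; rewrite Eb k0 in nb.
      under eq_bigr => i _ do rewrite mulrNz; rewrite sumrN -/S; zabel.
    exists k.+1, (fun i => b (lift ord0 i)), (- (d ord0 *~ Negz k + S)); split=> //; first exact: WN.
    by rewrite -/S NegzE; zabel.
  rewrite b0 mulr0z add0r in hWb; rewrite b0 mulr0z add0r.
  exact: (d3 (fun i => b (lift ord0 i)) hWb).
Qed.

End Delta.

Lemma lin_fin (J : Type) n (f : J -> 'I_n) (l : lin J) : exists a : 'I_n -> int,
  forall (N : oagType) (x : 'I_n -> N), leval (x \o f) l = \sum_i x i *~ a i + oag_one N *~ l.2.
Proof.
case: l => s c /=; elim: s => [|[w b] s [a IH]].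
  exists (fun=> 0) => N x; rewrite /leval big_nil big1 // => i _; exact: mulr0z.
exists (fun i => if i == f w then a i + b else a i) => N x.
have -> : leval (x \o f) ((w, b) :: s, c) = x (f w) *~ b + leval (x \o f) (s, c).
  by rewrite /leval big_cons addrA.
rewrite IH (bigD1 (f w)) //= [in RHS](bigD1 (f w)) //= eqxx.
rewrite [in RHS](eq_bigr (fun i => x i *~ a i)); first by zabel.
by move=> i /negPf ->.
Qed.

Section FinSat.
Variables (G : oagType) (regG : regular_oag G).
Variables (K : Type) (U N : oagType) (j : U -> N) (elj : elementary j).
Variables (mU : models (theory G) U) (satU : saturated K U).
Variables (I J : Type) (p : set (formula (I + U))) (q : set (formula (J + U))).
Variables (pglobal : global_type p) (qglobal : global_type q).
Variables (c : I -> N) (d : J -> N) (cp : realizes c j p) (dq : realizes d j q).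
Variables (A : set U) (smA : small K A) (sigma : nat -> N -> N).
Let mN : models (theory G) N := models_elementary elj mU.
Let vA : A -> U := val.

Hypothesis span_data : forall (l : lin J) pr i, prime pr -> exists (s : seq (N * int)) (u : A) g,
  (forall t, t \in s -> kappa j d pr t.1) /\
  leval d l = \sum_(t <- s) t.1 *~ t.2 + j (vA u) + g *+ (pr ^ i).
Hypothesis sigma_basis : forall pr b, prime pr -> kappa j d pr b -> kappa j c pr (sigma pr b).
Hypothesis sigma_inj : forall pr, prime pr -> forall b b', kappa j d pr b -> kappa j d pr b' ->
  sigma pr b = sigma pr b' -> b = b'.

Lemma realize_finite (s : seq I) : exists (cI : I -> N) (c' : I -> U),
  (forall i, List.In i s -> cI i = c i) /\ same_sat (copair cI (j \o vA)) (copair c' vA).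
Proof.
have [n [f [g fgK]]] := finite_support s.
pose r : set (formula ('I_n.+1 + A)) := [set phi | sat (copair (oenv g c) (j \o vA)) phi].
have fr : finsat vA r.
  move=> t ht.
  pose sw (v : 'I_n.+1 + A) : A + 'I_n.+1 := match v with inl x => inr x | inr x => inl x end.
  have E (M : oagType) (y : 'I_n.+1 -> M) (a : A -> M) : copair a y \o sw = copair y a by apply/funext => -[].
  have [psi hpsi] := ex_closure (rename sw (conjs t)).
  have : sat vA psi.
    apply/(elementary_sat elj)/hpsi; exists (oenv g c); rewrite sat_rename E.
    by apply/sat_conjs.
  by move=> /hpsi[y]; rewrite sat_rename E => /sat_conjs; exists y.
have [cc hcc] := saturated_family satU ((small_set _ _).1 smA) fr.
exists (oenv g c \o f), (cc \o f); split=> [i /fgK hi|phi]; first by rewrite /= /oenv hi.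
have E (M : oagType) (y : 'I_n.+1 -> M) (a : A -> M) :
  copair (y \o f) a = copair y a \o copair (inl \o f) inr by apply/funext => -[].
rewrite !E -!sat_rename; split=> [h|h]; first exact: hcc.
apply: contrapT => nh; have : r (fNot (rename (copair (inl \o f) inr) phi)) by [].
by move=> /hcc.
Qed.

Section Fixed.
Variables (cI : I -> N) (c' : I -> U) (same : same_sat (copair cI (j \o vA)) (copair c' vA)).
Variables (tau : N -> U).
Hypothesis tr : transfer (copair cI (j \o vA)) (copair c' vA) tau.
Let t1 := let: And4 h _ _ _ := tr in h.
Let t2 := let: And4 _ h _ _ := tr in h.
Let t3 := let: And4 _ _ h _ := tr in h.
Let t4 := let: And4 _ _ _ h := tr in h.

Definition matched pr b := kappa j d pr b /\ hull (copair cI (j \o vA)) (sigma pr b).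

Definition shift pr (b : N) : N := if `[< matched pr b >] then j (tau (sigma pr b)) - b else 0.

Definition Phi pr (l : seq (N * int)) : N := \sum_(t <- l) shift pr t.1 *~ t.2.

Let Dd : set N := hull (copair d j).

Lemma Phi_cong pr i (l : seq (N * int)) : prime pr -> (forall t, t \in l -> kappa j d pr t.1) ->
  mod_base j (pr ^ i) (\sum_(t <- l) t.1 *~ t.2) -> divs (pr ^ i) (Phi pr l).
Proof.
move=> ppr hl; have [s [k [us sl sF]]] := sum_uniqF l.
rewrite /Phi (sF _ (shift pr)) (sF _ id) => hm.
have [Bd1 Bd2 _] := kappaP regG elj mN d ppr.
have hk : forall b, b \in s -> ((pr ^ i)%N%:Z %| k b)%Z.
  by apply: (independent_pow elj ppr Bd1 Bd2 us) hm => b /sl[t /hl ht <-].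
by apply: divs_sum => b /hk; exact: divs_dvdz.
Qed.

(* [h] is, modulo [m], the homomorphism vanishing on [U] and moving each
   matched basis element to the copy in [U] of its image under [sigma]. *)
Definition shift_hom (m : nat) (h : N -> N) : Prop :=
  [/\ add_mod Dd m h, forall u, divs m (h (j u)) &
   forall pr i, prime pr -> (pr ^ i %| m)%N -> forall l u g, (forall t, t \in l -> kappa j d pr t.1) ->
     Dd g -> divs (pr ^ i) (h (\sum_(t <- l) t.1 *~ t.2 + j u + g *+ (pr ^ i)) - Phi pr l)].

Lemma shift_homW m m' h : (m %| m')%N -> shift_hom m' h -> shift_hom m h.
Proof.
move=> mm [h1 h2 h3]; split=> [x y Dx Dy|u|pr i ppr hi]; [exact: divs_dvd (h1 x y Dx Dy)|exact: divs_dvd (h2 u)|].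
apply: h3 => //; exact: dvdn_trans mm.
Qed.

Lemma Phi_cat pr l l' : Phi pr (l ++ l') = Phi pr l + Phi pr l'.
Proof. by rewrite /Phi big_cat. Qed.

Lemma shift_hom_exists m : (0 < m)%N -> exists h, shift_hom m h.
Proof.
move=> m0.
have rep pr x i : prime pr -> Dd x -> exists l u g, [/\ forall t, t \in l -> kappa j d pr t.1, Dd g &
    x = \sum_(t <- l) t.1 *~ t.2 + j u + g *+ (pr ^ i)].
  move=> ppr Dx; have [Bd1 _ Bd3] := kappaP regG elj mN d ppr.
  exact: (spanned_pow elj ppr Bd1 Bd3).
have /choice[R hR] : forall xp : N * nat, exists l, prime xp.2 -> Dd xp.1 ->
    (forall t, t \in l -> kappa j d xp.2 t.1) /\
    exists u g, xp.1 = \sum_(t <- l) t.1 *~ t.2 + j u + g *+ (xp.2 ^ logn xp.2 m).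
  move=> [x pr] /=; have [[ppr Dx]|nx] := pselect (prime pr /\ Dd x); last first.
    by exists [::] => ppr Dx; case: nx.
  have [l [u [g [h1 h2 h3]]]] := rep pr x (logn pr m) ppr Dx.
  by exists l => _ _; split=> //; exists u, g.
have /choice[h hh] : forall x, exists z, forall pr, pr \in primes m ->
    divs (pr ^ logn pr m) (z - Phi pr (R (x, pr))).
  move=> x; have [|z hz] := crt_primes (s := primes m) (logn^~ m) (fun pr => Phi pr (R (x, pr))) (primes_uniq m).
    by move=> pr; rewrite mem_primes => /andP[].
  by exists z.
have h3 : forall pr i, prime pr -> (pr ^ i %| m)%N -> forall l u g, (forall t, t \in l -> kappa j d pr t.1) ->
     Dd g -> divs (pr ^ i) (h (\sum_(t <- l) t.1 *~ t.2 + j u + g *+ (pr ^ i)) - Phi pr l).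
  move=> pr i ppr him l u g hl Dg; set x := \sum_(t <- l) _ + _ + _.
  have [Bd1 _ _] := kappaP regG elj mN d ppr.
  have Dx : Dd x.
    apply: hullD; last exact: hull_muln.
    apply: hullD; last exact: hull_range.
    apply: (@hull_sum N _ (copair d j) _ l (fun t : N * int => t.1 *~ t.2)) => t /hl/Bd1; exact: hull_mulz.
  case: i him @x Dx => [|i] him x Dx; first by exists (h x - Phi pr l); rewrite expn0.
  have prm : pr \in primes m.
    by rewrite mem_primes ppr m0 /=; apply: dvdn_trans him; rewrite expnS dvdn_mulr.
  have [hl' [u' [g' Ex]]] := hR (x, pr) ppr Dx.
  have hi : (pr ^ i.+1 %| pr ^ logn pr m)%N by apply: dvdn_exp2l; rewrite -pfactor_dvdn.
  have E1 := divs_dvd hi (hh x pr prm).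
  set l' := R (x, pr) in hl' Ex E1.
  pose l2 := l ++ [seq (t.1, - t.2) | t <- l'].
  have hl2 t : t \in l2 -> kappa j d pr t.1.
    by rewrite mem_cat => /orP[/hl//|/mapP[t' /hl' ht' ->]].
  have neg (F : N -> N) : \sum_(t <- [seq (t.1, - t.2) | t <- l']) F t.1 *~ t.2 = - \sum_(t <- l') F t.1 *~ t.2.
    by rewrite big_map -sumrN; apply: eq_bigr => t _; rewrite mulrNz.
  have := Phi_cong ppr hl2 (i := i.+1); rewrite Phi_cat.
  have -> : Phi pr [seq (t.1, - t.2) | t <- l'] = - Phi pr l' by exact: (neg (shift pr)).
  move=> H; have {}H : divs (pr ^ i.+1) (Phi pr l - Phi pr l').
    apply: H; rewrite big_cat (neg id) /=.
    have [g2 Eg2] : divs (pr ^ i.+1) (g' *+ (pr ^ logn pr m)) by exact: divs_dvd hi (divs_muln _ _).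
    exists (u' - u), (g2 - g); rewrite mulrnBl -Eg2 (elementaryB elj).
    have : \sum_(t <- l) t.1 *~ t.2 + j u + g *+ (pr ^ i.+1) = \sum_(t <- l') t.1 *~ t.2 + j u' + g' *+ (pr ^ logn pr m) by [].
    move=> EE; have -> : \sum_(t <- l) t.1 *~ t.2 = \sum_(t <- l') t.1 *~ t.2 + j u' + g' *+ (pr ^ logn pr m) - j u - g *+ (pr ^ i.+1).
      by rewrite -EE; zabel.
    by zabel.
  by have := divsB E1 H; congr divs; zabel.
exists h; split=> // [x y Dx Dy|u].
  apply: divs_primes => // pr i ppr hi.
  have [l [u [g [hl Dg Ex]]]] := rep pr x i ppr Dx.
  have [l' [u' [g' [hl' Dg' Ey]]]] := rep pr y i ppr Dy.
  have H1 := h3 pr i ppr hi l u g hl Dg; rewrite -Ex in H1.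
  have H2 := h3 pr i ppr hi l' u' g' hl' Dg'; rewrite -Ey in H2.
  have H3 := h3 pr i ppr hi (l ++ l') (u + u') (g + g') _ (hullD Dg Dg').
  have {}H3 : divs (pr ^ i) (h (x + y) - (Phi pr l + Phi pr l')).
    rewrite -Phi_cat; have -> : x + y = \sum_(t <- l ++ l') t.1 *~ t.2 + j (u + u') + (g + g') *+ pr ^ i.
      by rewrite Ex Ey big_cat (elementaryD elj) /=; zabel.
    by apply: H3 => t; rewrite mem_cat => /orP[/hl|/hl'].
  by have := divsB (divsB H3 H1) H2; congr divs; zabel.
apply: divs_primes => // pr i ppr hi.
have [//|] := h3 pr i ppr hi [::] u 0 _ (hull0 _).
by move=> z; rewrite big_nil mul0rn addr0 add0r /Phi big_nil subr0 => hz; exists z.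
Qed.

Definition adm (L : seq (lin J)) (Th : seq N) (m : nat) (y : J -> N) (h : N -> N) : Prop :=
  shift_hom m h /\ forall l, List.In l L -> let beta := leval y l - leval d l in
   [/\ range j (leval d l) -> beta = 0,
       forall th, List.In th Th -> 0 < th -> - th < beta /\ beta < th &
       divs m (beta - h (leval d l))].

Lemma admW L L' Th Th' m m' y h : (forall l, List.In l L -> List.In l L') ->
  (forall l, List.In l Th -> List.In l Th') -> (m %| m')%N ->
  adm L' Th' m' y h -> adm L Th m y h.
Proof.
move=> sL sT mm [h1 h2]; split; first exact: shift_homW mm h1.
move=> l /sL/h2[a1 a2 a3]; split=> // [th /sT|]; first exact: a2.
exact: divs_dvd mm a3.
Qed.

Let hull_d (l : lin J) : Dd (leval d l).
Proof. by have := hull_leval (copair d j) (lmap inl l); rewrite leval_map. Qed.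

Lemma cong_preserved (l : lin J) (a : lin A) pr i m h beta : prime pr -> (pr ^ i %| m)%N ->
  shift_hom m h -> divs m (beta - h (leval d l)) ->
  divs (pr ^ i) (leval d l + j (leval vA a)) <-> divs (pr ^ i) (leval d l + beta + j (leval vA a)).
Proof.
move=> ppr him [_ _ hc] hb; have [l0 [u [g [hl0 E]]]] := span_data l i ppr.
have [Bd1 Bd2 _] := kappaP regG elj mN d ppr.
have [Bc1 Bc2 _] := kappaP regG elj mN c ppr.
have pi0 : (0 < pr ^ i)%N by rewrite expn_gt0 prime_gt0.
have [s [k [us sl sF]]] := sum_uniqF l0.
have sB b : b \in s -> kappa j d pr b by move=> /sl[t /hl0 ht <-].
have Dg : Dd g.
  apply: (hull_pure pi0); have -> : g *+ (pr ^ i) = leval d l - (\sum_(b <- s) b *~ k b + j (vA u)).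
    by rewrite {1}E (sF _ id); zabel.
  apply: (hullB (hull_d l)); apply: hullD; last exact: hull_range.
  by apply: hull_sum => b /sB/Bd1; exact: hull_mulz.
have hbeta : divs (pr ^ i) (beta - \sum_(b <- s) shift pr b *~ k b).
  have H1 := divs_dvd him hb.
  have H2 := hc pr i ppr him l0 (vA u) g hl0 Dg; rewrite -E /Phi (sF _ (shift pr)) in H2.
  by have := divsD H1 H2; congr divs; zabel.
set av := leval vA a.
have E1 : divs (pr ^ i) (leval d l + j av - (\sum_(b <- s) b *~ k b + j (vA u + av))).
  by rewrite E (sF _ id) (elementaryD elj); exists g; zabel.
have E2 : divs (pr ^ i) (leval d l + beta + j av -
    (\sum_(b <- s) b *~ k b + \sum_(b <- s) shift pr b *~ k b + j (vA u + av))).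
  by have := divsD E1 hbeta; congr divs; zabel.
rewrite (divs_cong E1) (divs_cong E2).
have [hk|nk] := pselect (forall b, b \in s -> matched pr b -> ((pr ^ i)%N%:Z %| k b)%Z).
  apply: iff_sym; apply: divs_cong.
  have : divs (pr ^ i) (\sum_(b <- s) shift pr b *~ k b).
    apply: divs_sum => b bs; rewrite /shift; case: asboolP => [mb|_]; first exact/divs_dvdz/hk.
    by rewrite mul0rz; exact: divs0.
  by congr divs; zabel.
have nall : ~ (forall b, b \in s -> ((pr ^ i)%N%:Z %| k b)%Z) by move=> h1; apply: nk => b bs _; exact: h1.
split=> H; exfalso; apply: nall.
  by have [] := (divs_independent elj ppr Bd1 Bd2 i (F := id) k (vA u + av) us sB (fun _ _ _ _ => id)).1 H.
pose S1 := [seq b <- s | ~~ `[< matched pr b >]]; pose S2 := [seq b <- s | `[< matched pr b >]].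
have split_sum (F : N -> N) : \sum_(b <- s) F b = \sum_(b <- S1) F b + \sum_(b <- S2) F b.
  by rewrite !big_filter (bigID (fun b => ~~ `[< matched pr b >])) /=; congr (_ + _); apply: eq_bigl => b; rewrite negbK.
have ES : \sum_(b <- s) b *~ k b + \sum_(b <- s) shift pr b *~ k b =
    \sum_(b <- S1) b *~ k b + \sum_(b <- S2) j (tau (sigma pr b)) *~ k b.
  rewrite -big_split split_sum /=; congr (_ + _); apply: eq_big_seq => b; rewrite mem_filter => /andP[hb' _].
    by rewrite /shift (negPf hb') mul0rz addr0.
  by rewrite /shift hb'; zabel.
rewrite ES in H.
have jsum (s' : seq N) : \sum_(b <- s') j (tau (sigma pr b)) *~ k b = j (\sum_(b <- s') tau (sigma pr b) *~ k b).
  elim: s' => [|b s' IH]; first by rewrite !big_nil (elementary0 elj).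
  by rewrite !big_cons IH (elementaryD elj) (elementaryMz elj).
have H' : divs (pr ^ i) (\sum_(b <- S1) b *~ k b + j (\sum_(b <- S2) tau (sigma pr b) *~ k b + (vA u + av))).
  by move: H; rewrite jsum -addrA -(elementaryD elj).
have uS1 : uniq S1 by exact: filter_uniq.
have [|g1 g2] := (divs_independent elj ppr Bd1 Bd2 i (F := id) k _ uS1 _ (fun _ _ _ _ => id)).1 H'.
  by move=> b; rewrite mem_filter => /andP[_ /sB].
have S2m b : b \in S2 -> matched pr b by rewrite mem_filter => /andP[/asboolP].
have hcI : hull (copair cI (j \o vA)) (j (vA u)) by exact: (hull_var (copair cI (j \o vA)) (inr u)).
have hav : hull (copair cI (j \o vA)) (j av).
  by have := hull_leval (copair cI (j \o vA)) (lmap inr a); rewrite leval_map (elementary_leval elj vA a).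
have tu : tau (j (vA u)) = vA u.
  have := t1 (b := j (vA u)) (m := 1) (l := lvar (inr u)) isT; rewrite !leval_var mulr1n; exact.
have ta : tau (j av) = av.
  have := t1 (b := j av) (m := 1) (l := lmap inr a) isT; rewrite !leval_map mulr1n (elementary_leval elj vA a); exact.
have hsum (s' : seq N) : (forall b, b \in s' -> matched pr b) ->
    hull (copair cI (j \o vA)) (\sum_(b <- s') sigma pr b *~ k b) /\
    tau (\sum_(b <- s') sigma pr b *~ k b) = \sum_(b <- s') tau (sigma pr b) *~ k b.
  elim: s' => [|b s' IH] hs'.
    by rewrite !big_nil; split; [exact: hull0|have [_ [h0 _] _ _] := t4 (hull0 _); exact: h0].
  have [|h1 h2] := IH; first by move=> b' b's; apply: hs'; rewrite in_cons b's orbT.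
  have [_ hb'] := hs' b (mem_head _ _).
  rewrite !big_cons; split; first by apply: hullD => //; exact: hull_mulz.
  by rewrite t2 ?t3 ?h2 //; exact: hull_mulz.
have [hS2 tS2] := hsum S2 S2m.
have g3 : divs (pr ^ i) (\sum_(b <- S2) sigma pr b *~ k b + j (vA u + av)).
  rewrite (elementaryD elj).
  have [_ _ _ /(_ (pr ^ i)%N) ->] := t4 (hullD hS2 (hullD hcI hav)).
  by rewrite (t2 hS2 (hullD hcI hav)) (t2 hcI hav) tS2 tu ta.
have uS2 : uniq S2 by exact: filter_uniq.
have [||g4 _] := (divs_independent elj ppr Bc1 Bc2 i (F := sigma pr) k _ uS2 _ _).1 g3.
- by move=> b /S2m[hb' _]; exact: sigma_basis.
- by move=> b b' /S2m[hb' _] /S2m[hb'' _]; exact: sigma_inj.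
move=> b bs; have [mb|mb] := boolP `[< matched pr b >].
  by apply: g4; rewrite mem_filter mb.
by apply: g1; rewrite mem_filter mb.
Qed.

Definition eventually (P : (J -> N) -> Prop) : Prop := exists L Th m, (0 < m)%N /\
  forall y h, adm L Th m y h -> P y.

Lemma eventually_list (T : Type) (s : seq T) (P : T -> (J -> N) -> Prop) :
  (forall t, List.In t s -> eventually (P t)) -> eventually (fun y => forall t, List.In t s -> P t y).
Proof.
elim: s => [|t s IH] hs; first by exists [::], [::], 1%N; split.
have [L [Th [m [m0 h1]]]] := hs t (or_introl erefl).
have [|L' [Th' [m' [m'0 h2]]]] := IH; first by move=> t' h; apply: hs; right.
exists (L ++ L'), (Th ++ Th'), (m * m')%N; rewrite muln_gt0 m0; split=> // y h ad t' [<-|].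
  apply: (h1 y h); apply: admW ad => [l hl|l hl|]; [apply/In_cat; by left|apply/In_cat; by left|exact: dvdn_mulr].
apply: (h2 y h); apply: admW ad => [l hl|l hl|]; [apply/In_cat; by right|apply/In_cat; by right|exact: dvdn_mull].
Qed.

Lemma eventuallyW (P Q : (J -> N) -> Prop) : (forall y, P y -> Q y) -> eventually P -> eventually Q.
Proof. by move=> PQ [L [Th [m [m0 h]]]]; exists L, Th, m; split=> // y z /h/PQ. Qed.

Lemma step_q (phi : formula (J + A)) : sat (copair d (j \o vA)) phi ->
  eventually (fun y => sat (copair y (j \o vA)) phi).
Proof.
move=> sd; have [ts [m [m0 hts]]] := regular_data regG phi.
suff : eventually (fun y => forall t, List.In t ts ->
    [/\ (0 < leval (copair d (j \o vA)) t) = (0 < leval (copair y (j \o vA)) t),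
      (leval (copair d (j \o vA)) t == 0) = (leval (copair y (j \o vA)) t == 0) &
      forall k, (0 < k)%N -> (k %| m)%N -> (divs k (leval (copair d (j \o vA)) t) <-> divs k (leval (copair y (j \o vA)) t))]).
  by apply: eventuallyW => y hy; apply/(hts _ _ mN mN _ _ hy).
apply: eventually_list => t _; have [l [a hla]] := lin_sum t.
set v := leval d l + j (leval vA a).
exists [:: l], [:: v; - v], m; split=> // y h [hc /(_ l (or_introl erefl))[b1 b2 b3]].
have [-> _] := hla _ d (j \o vA); have [-> _] := hla _ y (j \o vA).
rewrite (elementary_leval elj vA a) -/v.
set beta := leval y l - leval d l in b1 b2 b3.
have Ey : leval y l + j (leval vA a) = v + beta by rewrite /v /beta; zabel.
rewrite Ey.
have [e1 e2] : (0 < v) = (0 < v + beta) /\ (v == 0) = (v + beta == 0).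
  have [v0|v0|v0] := otrichotomy 0 v.
  - have [h1 _] := b2 v (or_introl erefl) v0.
    have h2 : 0 < v + beta by olin h1.
    by rewrite v0 h2 (gt_eqF v0) (gt_eqF h2).
  - rewrite -v0 add0r b1 // -?v0 //; exists (- leval vA a) => //.
    by rewrite (elementaryN elj); apply/eqP; rewrite eq_sym -subr_eq0 opprK -/v -v0.
  - have nv : 0 < - v by olin v0.
    have [_ h1] := b2 (- v) (or_intror (or_introl erefl)) nv.
    have h2 : v + beta < 0 by olin h1.
    by rewrite !oltNge (ltW v0) (ltW h2) (lt_eqF v0) (lt_eqF h2).
split=> // k k0 km.
have cp' pr i : prime pr -> (pr ^ i %| k)%N -> divs (pr ^ i) v <-> divs (pr ^ i) (v + beta).
  move=> ppr hi; have -> : v + beta = leval d l + beta + j (leval vA a) by rewrite /v; zabel.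
  exact: (cong_preserved a ppr (dvdn_trans hi km) hc b3).
split=> hk; apply: divs_primes => // pr i ppr hi; apply/(cp' pr i ppr hi); exact: divs_dvd hk.
Qed.

Let env (y : J -> N) : (I + J) + A -> N := copair (copair (j \o c') y) (j \o vA).

Let leval_cut (n : nat) l t s l1 u y : leval (env y) (cut_ineq n l t s l1 u) =
  j (leval c' l1 + vA u) - (leval y l *+ n - j (vA t)) *~ s.
Proof.
rewrite /cut_ineq !leval_add leval_opp leval_scale leval_add leval_scale leval_opp !leval_map !leval_var /=.
by rewrite (elementaryD elj) -(elementary_leval elj c' l1).
Qed.

Lemma step_cut n l t s l1 u H : cut_data j c d n l t s l1 u H -> leval cI l1 = leval c l1 ->
  (on_left j d n l t s -> eventually (fun y => sat (env y) (fPos (cut_ineq n l t s l1 u)))) /\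
  (on_right j d n l t s -> eventually (fun y => sat (env y) (fPos (lscale (-1) (cut_ineq n l t s l1 u))))).
Proof.
move=> [n0 hs cH f1 f2] Ec; have [[H0 HD HN] Hc] := cH.
set ed := (leval d l *+ n - j (vA t)) *~ s in f1.
set g := leval c l1 + j (vA u) in f2; set w := leval c' l1 + vA u.
have move_ed y : exists b, ((leval y l *+ n - j (vA t)) *~ s = ed + b) /\
    (b = leval y (lscale n l) - leval d (lscale n l) \/ b = - (leval y (lscale n l) - leval d (lscale n l))).
  pose x := leval y (lscale n l) - leval d (lscale n l).
  have E : (leval y l *+ n - j (vA t)) *~ s = ed + x *~ s by rewrite /ed /x !leval_scale; zabel.
  rewrite E; case: hs => ->; [exists x|exists (- x)]; split; [zabel|by left|zabel|by right].
have cmp (k : nat) (a : lin A) s' : (0 < (g *+ k - j (leval vA a)) *~ s') = (0 < (w *+ k - leval vA a) *~ s').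
  have := same_sat_pos same (lscale s' (ladd (lscale k (ladd (lmap inl l1) (lvar (inr u)))) (lscale (-1) (lmap inr a)))).
  rewrite !leval_scale !leval_add !leval_scale !leval_add !leval_map !leval_var mulrNz mulr1z /=.
  by rewrite (elementary_leval elj vA a) -!pmulrn -/w => <-; rewrite /g -Ec.
have g0 := fills_gt0 elj cH f2.
have ed0 := fills_gt0 elj cH f1.
have le_mul (x : N) k : (0 < k)%N -> 0 < x -> x <= x *+ k.
  by case: k => // k _ x0; have := nnM k (ltW x0 : nn false x) => /= h; olin h.
have thr th (P : (J -> N) -> Prop) : 0 < th -> (forall y b, (leval y l *+ n - j (vA t)) *~ s = ed + b -> - th < b -> b < th -> P y) ->
    eventually P.
  move=> th0 hP; exists [:: lscale n l], [:: th], 1%N; split=> // y h [_ /(_ _ (or_introl erefl))[_ /(_ th (or_introl erefl) th0)[h1 h2] _]].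
  have [b [E hb]] := move_ed y; apply: (hP y b E); case: hb => -> //; [olin h2|olin h1].
split=> lr.
  have aw : above H w.
    move=> h Hh; have [t' [k [[lt _ <-] k0 h1 h2]]] := lr (h) (f1.1 h Hh).
    have [h' Hh' th'] : exists2 h', H h' & leval vA lt <= h'.
      apply: not_above => /(fills_mul regG elj mU cH f1 k0) h3.
      by have := lt_le_trans h3 h2; rewrite ltxx.
    have h4 : j h' < g := f2.1 h' Hh'.
    rewrite -(elementary_le elj) in th'.
    have h5 := le_mul g k k0 g0.
    have := cmp k lt 1; rewrite !mulr1z => /esym h6.
    have {}h6 : 0 < w *+ k - leval vA lt by rewrite h6; olin (h4, th', h5).
    move: h6 h1; move: (leval vA lt) => t0; clearbody w => h6 h1; by olinM k (h6, h1).
  have edw : ed < j w := f1.2 w aw.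
  apply: (thr (j w - ed)); first by olin edw.
  move=> y b E h1 h2; rewrite sat_fPos leval_cut E -/w; olin h2.
have [h Hh wh] : exists2 h, H h & w <= h.
  apply: not_above => aw.
  have [t' [k [[lt _ <-] k0 h1 h2]]] := lr w (f1.2 w aw).
  have at' : above H (leval vA lt).
    move=> h Hh; rewrite -(elementary_lt elj); apply: lt_le_trans h1.
    exact: lt_le_trans (f1.1 h Hh) (le_mul ed k k0 ed0).
  have := fills_mul regG elj mU cH f2 k0 at'.
  have := cmp k lt (-1); rewrite !mulrNz !mulr1z !opprB => h6 h7.
  have : 0 < leval vA lt - w *+ k by rewrite -h6; olin h7.
  by rewrite -olt_sub oltNge h2.
have hw : j w < ed by apply: le_lt_trans (f1.1 h Hh); rewrite (elementary_le elj).
apply: (thr (ed - j w)); first by olin hw.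
move=> y b E h1 h2; rewrite sat_fPos leval_opp leval_cut E -/w; olin h1.
Qed.

Lemma step_cong pr b m l u m' l' u' i : cong_data j c d sigma pr b m l u m' l' u' ->
  leval cI l' = leval c l' ->
  eventually (fun y => sat (env y) (fDiv (m * m' * pr ^ i) (cong_form m l u m' l' u'))).
Proof.
move=> [ppr kb [m0 m'0] Eb Es] Ec; rewrite -Ec in Es.
have Es' : sigma pr b *+ m' = leval (copair cI (j \o vA)) (ladd (lmap inl l') (lvar (inr u'))).
  by rewrite leval_add leval_map leval_var.
have mb : matched pr b by split=> //; exists m', (ladd (lmap inl l') (lvar (inr u'))).
have Et := t1 m'0 Es'; rewrite leval_add leval_map leval_var /= in Et.
have shE : shift pr b = j (tau (sigma pr b)) - b by rewrite /shift; case: asboolP.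
have pi0 : (0 < pr ^ i)%N by rewrite expn_gt0 prime_gt0.
exists [:: l], [::], (m * pr ^ i)%N; rewrite muln_gt0 m0; split=> // y h [[h1 h2 h3] /(_ _ (or_introl erefl))[_ _ hb]].
set beta := leval y l - leval d l in hb.
have [Bd1 _ _] := kappaP regG elj mN d ppr.
have Db : Dd b := Bd1 _ kb.
have H1 : divs (pr ^ i) (h b - shift pr b).
  have := h3 pr i ppr (dvdn_mull _ (dvdnn _)) [:: (b, 1%Z)] 0 0.
  rewrite /Phi !big_seq1 /= !mulr1z (elementary0 elj) mul0rn !addr0; apply; last exact: hull0.
  by move=> t'; rewrite inE => /eqP->.
have H2 : divs (m * pr ^ i) (beta - shift pr b *+ m).
  have El : leval d l = b *~ m + j (- vA u) by rewrite -pmulrn Eb (elementaryN elj) addrK.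
  have D1 : Dd (j (- vA u)) by exact: hull_range.
  have g1 := h1 _ _ (hull_mulz m Db) D1; rewrite -El in g1.
  have g2 := h2 (- vA u).
  have g3 := add_modZ (hull0 (copair d j)) (fun x k => @hull_mulz _ _ (copair d j) x k) h1 m Db.
  have g4 : divs (m * pr ^ i) (h b *+ m - shift pr b *+ m).
    by rewrite -mulrnBl mulnC; apply/divsM.
  by have := divsD (divsD hb (divsD g1 g3)) (divsD g4 g2); congr divs; zabel.
rewrite sat_fDiv /cong_form leval_add !leval_scale !leval_add !leval_map !leval_var /=.
rewrite (_ : leval (env y \o _) l' = j (leval c' l')); last exact: (elementary_leval elj c' l').
rewrite (_ : leval (env y \o _) l = leval d l + beta); last first.
  by rewrite /beta; have -> : env y \o (inl \o inr) = y by []; zabel.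
have -> : (leval d l + beta + j (vA u)) *~ m' + (j (leval c' l') + j (vA u')) *~ (- m%:Z) =
    (beta - shift pr b *+ m) *+ m'.
  have -> : leval d l + beta + j (vA u) = b *+ m + beta by rewrite Eb; zabel.
  rewrite -(elementaryD elj) -Et (elementaryMn elj) shE; by zabel.
by rewrite mulnAC; apply/divsM.
Qed.

Lemma adm_exists L Th m : (0 < m)%N -> exists y h, adm L Th m y h.
Proof.
move=> m0; have [[pr [b [ppr kb]]]|nk] := pselect (exists pr b, prime pr /\ kappa j d pr b); last first.
  have noB (l : seq (N * int)) pr : prime pr -> (forall t, t \in l -> kappa j d pr t.1) -> l = [::].
    by case: l => // t l ppr /(_ t (mem_head _ _)) kt; case: nk; exists pr, t.1.
  exists d, (fun=> 0); split.
    split=> [x y _ _|u|pr i ppr _ l u g /(noB _ _ ppr)-> _]; rewrite ?subr0; try exact: divs0.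
    by rewrite /Phi big_nil subr0; exact: divs0.
  move=> l _ /=; rewrite subrr subr0; split=> // [th _ th0|]; last exact: divs0.
  by split=> //; olin th0.
have [Bd1 Bd2 _] := kappaP regG elj mN d ppr.
have nb : ~ mod_base j pr b.
  move=> hb; have := Bd2 [:: b] (fun=> 1%Z) isT; rewrite big_seq1 mulr1z.
  move=> /(_ _ hb b (mem_head _ _)) h1.
  have : (pr%:Z %| 1)%Z by apply: h1 => x; rewrite /= inE => /eqP->.
  by rewrite dvdzE /= dvdn1 => /eqP p1; rewrite p1 in ppr.
have o0 : oag_one N = 0.
  have [//|[o0 _]] := one_spec N; case: nb.
  have [B hB] := gap_coset regG mN (prime_gt0 ppr).
  have [|x [x1 [x2 [z Ez]]]] := hB 0 (oag_one N *+ B.+1) b; first by olin o0.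
  have [i _ xi] := between_ones o0 (ltW x1) (ltW x2).
  exists (oag_one U *+ i), (- z); rewrite (elementaryMn elj) (elementary_one elj) -xi mulNrn -Ez; zabel.
have [u0 u00] : exists u : N, 0 < u.
  have [h|h|h] := otrichotomy 0 b; first by exists b.
    by case: nb; rewrite -h; exact: mod_base0.
  by exists (- b); olin h.
pose vars := flatten [seq [seq t.1 | t <- l.1] | l <- L].
have [n [f [g fgK]]] := finite_support vars.
have /choice[a ha] := lin_fin f.
pose d' := oenv g d.
have dE l : List.In l L -> leval d l = \sum_i d' i *~ a l i.
  move=> lL; have := ha l N d'; rewrite o0 mul0rz addr0 => <-.
  suff: forall v, List.In v [seq t.1 | t <- l.1] -> d v = (d' \o f) v.
    rewrite /leval; elim: (l.1) => [|t s IH] hv; first by rewrite !big_nil.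
    rewrite !big_cons -!addrA IH; last by move=> v hv'; apply: hv; right.
    by rewrite (hv t.1); last by left.
  move=> v hv; have : List.In v vars.
    rewrite /vars; elim: (L) lL => //= l2 L' IH [->|/IH h]; apply/In_cat; [by left|by right].
  by move=> /fgK E; rewrite /d' /oenv /= E.
have yE l (x : 'I_n.+1 -> N) : leval (fun v => d v + x (f v)) l = leval d l + \sum_i x i *~ a l i.
  have := ha l N x; rewrite o0 mul0rz addr0 => <-; rewrite /leval o0 !mul0rz !addr0 -big_split /=.
  by apply: eq_bigr => t _; rewrite mulrzDl.
have W0 : range j 0 by exists 0 => //; exact: elementary0.
have WD x y : range j x -> range j y -> range j (x + y).
  by move=> [u _ <-] [v _ <-]; exists (u + v) => //; exact: elementaryD.
have WN x : range j x -> range j (- x) by move=> [u _ <-]; exists (- u) => //; exact: elementaryN.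
have [M0 [M00 hM0]] := infinitesimal_lift regG mN o0 W0 WD WN d'.
have [|h hh] := @shift_hom_exists (m * M0); first by rewrite muln_gt0 m0.
have [h1 h2 _] := hh.
have D0 : Dd 0 := hull0 _.
have DD x y : Dd x -> Dd y -> Dd (x + y) := @hullD _ _ _ x y.
have DZ x k : Dd x -> Dd (x *~ k) := @hull_mulz _ _ _ x k.
have dD i : Dd (d' i).
  rewrite /d' /oenv; case: (g i) => [v|] //; exact: (hull_var (copair d j) (inl v)).
have WDs x : range j x -> Dd x by move=> [u _ <-]; exact: hull_range.
have hW x : range j x -> divs (m * M0) (h x) by move=> [u _ <-].
have hroom : forall k th, List.In (k, th) [seq ((\sum_i `|a l i|)%N.+1, th) | l <- L, th <- [seq th <- Th | 0 < th]] ->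
    (0 < k)%N /\ forall i, oag_one N *+ i < th.
  move=> k th; elim: (L) => //= l L' IH /In_cat[|//].
  move=> /List.in_map_iff[th' [[<- <-] hth]]; split=> // i; rewrite o0 mul0rn.
  by move: hth; elim: (Th) => //= x Th' IH'; case: ifP => // x0 [<-//|].
have [eps [e0 he]] := room regG mN 0 hroom (ex_intro _ u0 u00).
rewrite mulr0n in e0.
have [del [e1 e2 e3]] := hM0 m m0 Dd h D0 DD DZ dD WDs h1 hW eps e0.
exists (fun v => d v + del (f v)), h; split; first by apply: shift_homW hh; exact: dvdn_mulr.
move=> l lL /=; rewrite yE addrC addKr; split=> [|th thT th0|].
- by rewrite dE // => /e3.
- have {}he : eps *+ (\sum_i `|a l i|)%N.+1 < th.
    apply: he; elim: (L) lL => //= l2 L' IH [->|/IH h']; apply/In_cat; [left|by right].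
    apply/List.in_map_iff; exists th; split=> //.
    by elim: (Th) thT => //= x Th' IH' [->|/IH' h']; [rewrite th0; left|case: ifP => _ //; right].
  have [b1 b2] := sum_bound (a l) e0 e1; split; [olin (b2, he)|olin (b1, he)].
have ah' : add_mod Dd m h by move=> x y Dx Dy; apply: divs_dvd (h1 x y Dx Dy); exact: dvdn_mulr.
have [_ g2] := add_mod_sum D0 DD DZ ah' (a l) dD.
have g1 : divs m (\sum_i del i *~ a l i - \sum_i h (d' i) *~ a l i) by exact: sum_divs.
by rewrite dE //; have := divsB g1 g2; congr divs; zabel.
Qed.

End Fixed.
Let leval_ext (M : oagType) (V : Type) (e e' : V -> M) (l : lin V) :
  (forall v, List.In v [seq t.1 | t <- l.1] -> e v = e' v) -> leval e l = leval e' l.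
Proof.
rewrite /leval => h; congr (_ + _); elim: (l.1) h => [|t s IH] h; first by rewrite !big_nil.
by rewrite !big_cons (h t.1) ?IH //; [move=> v hv; apply: h; right|left].
Qed.

Lemma link_step phi : link_type j p q c d (A := A) sigma phi -> exists V : seq I,
  forall (cI : I -> N) (c' : I -> U) (tau : N -> U), (forall i, List.In i V -> cI i = c i) ->
  same_sat (copair cI (j \o vA)) (copair c' vA) -> transfer (copair cI (j \o vA)) (copair c' vA) tau ->
  eventually cI tau
    (fun y => sat (copair (copair (j \o c') y) (j \o vA)) phi).
Proof.
move=> [[psi hpsi <-]|[[psi hpsi <-]|[[n [l [t [s [l1 [u [H [cd hlr]]]]]]]]|
  [pr [b [m [l [u [m' [l' [u' [i [cd ->]]]]]]]]]]]]].
- exists (pmap (fun v : I + A => if v is inl i then Some i else None) (free_vars psi)).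
  move=> cI c' tau hc same _; exists [::], [::], 1%N; split=> // y _ _.
  have hpsi' : sat (copair c (j \o vA)) psi.
    have := (global_sat pglobal cp _).1 hpsi; rewrite /inst sat_rename; congr (sat _ _).
    by apply/funext => -[].
  have : sat (copair cI (j \o vA)) psi.
    rewrite (_ : sat _ _ = sat (copair c (j \o vA)) psi) //; apply: sat_ext => -[i|a] //= hi.
    apply: hc; elim: (free_vars psi) hi => //= v s IH [->|/IH h]; first by left.
    by case: v => [i'|_] //=; right.
  move=> /same/(elementary_sat elj); rewrite /in_x sat_rename; congr (sat _ _).
  by apply/funext => -[].
- exists [::] => cI c' tau hc same tr.
  have hpsi' : sat (copair d (j \o vA)) psi.
    have := (global_sat qglobal dq _).1 hpsi; rewrite /inst sat_rename; congr (sat _ _).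
    by apply/funext => -[].
  have := @step_q cI c' tau tr _ hpsi'; apply: eventuallyW => y.
  rewrite /in_y sat_rename; congr (sat _ _); by apply/funext => -[].
- exists [seq t.1 | t <- l1.1] => cI c' tau hc same tr.
  have [h1 h2] := @step_cut cI c' same tau _ _ _ _ _ _ _ cd (leval_ext hc).
  by case: hlr => -[lr ->]; [exact: h1|exact: h2].
exists [seq t.1 | t <- l'.1] => cI c' tau hc same tr.
exact: (@step_cong cI c' tau tr _ _ _ _ _ _ _ _ _ cd (leval_ext hc)).
Qed.

Lemma link_finsat : finsat vA (link_type j p q c d (A := A) sigma).
Proof.
move=> s hs.
have [V hV] : exists V : seq I, forall cI c' tau, (forall i, List.In i V -> cI i = c i) ->
  same_sat (copair cI (j \o vA)) (copair c' vA) -> transfer (copair cI (j \o vA)) (copair c' vA) tau ->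
  eventually cI tau
    (fun y => forall phi, List.In phi s -> sat (copair (copair (j \o c') y) (j \o vA)) phi).
  suff [V hV] : exists V : seq I, forall phi, List.In phi s -> forall cI c' tau, (forall i, List.In i V -> cI i = c i) ->
    same_sat (copair cI (j \o vA)) (copair c' vA) -> transfer (copair cI (j \o vA)) (copair c' vA) tau ->
    eventually cI tau
      (fun y => sat (copair (copair (j \o c') y) (j \o vA)) phi).
    exists V => cI c' tau *; apply: eventually_list => phi hphi; exact: hV.
  elim: s hs => [|phi s IH] hs; first by exists [::].
  have [V1 h1] := link_step (hs phi (or_introl erefl)).
  have [|V2 h2] := IH; first by move=> psi h; apply: hs; right.
  exists (V1 ++ V2) => psi [<-|hpsi] cI c' tau hc.
    by apply: h1 => i hi; apply: hc; apply/In_cat; left.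
  by apply: h2 => // i hi; apply: hc; apply/In_cat; right.
have [cI [c' [hc same]]] := realize_finite V.
have [tau htau] := hull_transfer same.
have [L [Th [m [m0 hL]]]] := hV cI c' tau hc same htau.
have [y [h had]] := adm_exists cI tau L Th m0.
have {}hL := hL y h had.
pose sw (v : (I + J) + A) : A + (I + J) := match v with inl x => inr x | inr x => inl x end.
have E (M : oagType) (z : I + J -> M) (a : A -> M) : copair a z \o sw = copair z a by apply/funext => -[].
have [psi hpsi] := ex_closure (rename sw (conjs s)).
have : sat vA psi.
  apply/(elementary_sat elj)/hpsi; exists (copair (j \o c') y); rewrite sat_rename E.
  by apply/sat_conjs.
by move=> /hpsi[z]; rewrite sat_rename E => /sat_conjs; exists z.
Qed.

End FinSat.

(** * The characterization of domination *)

Lemma card_le_inj (T : Type) (V : nmodType) (A : set T) (B : set V) : A #<= B ->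
  exists f : T -> V, (forall x, A x -> B (f x)) /\ (forall x y, A x -> A y -> f x = f y -> x = y).
Proof.
move=> /card_leP[f].
exists (fun x => if pselect (A x) is left h then val (f (exist _ x (mem_set h) : A)) else 0).
split=> [x Ax|x y Ax Ay].
  by case: pselect => // h; exact: set_mem (valP (f _)).
case: pselect => // hx; case: pselect => // hy /val_inj e.
have : (exist _ x (mem_set hx) : A) = (exist _ y (mem_set hy) : A).
  by apply: (inj (f := f)) => //; exact: mem_set.
by move=> /(congr1 val).
Qed.

Section Domination.
Variables (G : oagType) (regG : regular_oag G).
Variables (K : Type) (K_nat : small K [set: nat]) (K_lim : strong_limit K).
Variables (U N : oagType) (j : U -> N) (elj : elementary j).
Variables (mU : models (theory G) U) (satU : saturated K U).
Variables (I J : Type) (smallJ : small K [set: J]).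
Variables (p : set (formula (I + U))) (q : set (formula (J + U))).
Variables (pglobal : global_type p) (qglobal : global_type q) (qinv : invariant_type K q).
Variables (c : I -> N) (d : J -> N) (cp : realizes c j p) (dq : realizes d j q).
Hypothesis sub_calH : calH j d `<=` calH j c.
Hypothesis le_kappa : forall pr, prime pr -> kappa j d pr #<= kappa j c pr.
Let mN : models (theory G) N := models_elementary elj mU.

Lemma order_witness (A : set U) (smA : small K A)
  (inv : forall n (phi : formula (J + 'I_n)) (b b' : 'I_n -> U),
     same_type A b b' -> (q (inst b phi) <-> q (inst b' phi))) (l : lin J) :
  exists tu : U * U, leval d l = j tu.1 \/ exists (n : nat) (s : int) (l1 : lin I) H,
   [/\ (0 < n)%N, s = 1 \/ s = -1, convex_subgroup H,
     fills j H ((leval d l *+ n - j tu.1) *~ s) /\ fills j H (leval c l1 + j tu.2) &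
     left_dense j (range (gen_with (A := A) (- (tu.1 *~ s)))) ((leval d l *+ n - j tu.1) *~ s) \/
     right_dense j (range (gen_with (A := A) (- (tu.1 *~ s)))) ((leval d l *+ n - j tu.1) *~ s)].
Proof.
have [[u _ ul]|ng] := pselect (range j (leval d l)); first by exists (u, 0); left.
have dich := cut_dichotomy regG K_nat K_lim elj mU satU (@gen_withN _ A _).
have inv0 : cut_inv j (range (gen_with (A := A) 0)) (leval d l).
  by have := invariant_cut regG mU qglobal dq inv l (t := 0); rewrite (elementary0 elj) addr0.
have smE : small K [set: lin (A + unit)].
  by apply: small_lin => //; apply: small_sum => //; [exact: (small_set _ _).1 smA|exact: small_count].
have [n [t [s [H [n0 hs cH f]]]]] := near_fills_dense regG K_nat K_lim elj mU satU smE ng (dich _ _ ng inv0).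
have /sub_calH/(calHE elj)[_ [l' f']] : calH j d H.
  apply/(calHE elj); split=> //.
  exists (lscale s (ladd (lscale n (lmap inl l)) (lscale (-1) (lvar (inr t))))).
  by rewrite leval_scale leval_add leval_scale leval_opp leval_map leval_var.
have [l1 [l2 hl]] := lin_sum l'; have [E _] := hl _ c j.
rewrite E (elementary_leval elj id l2) in f'.
exists (t, leval id l2); right; exists n, s, l1, H; split=> //.
apply: dich; first exact: (fills_notin elj f).
have := invariant_cut regG mU qglobal dq inv (lscale (n%:Z * s) l) (t := - (t *~ s)).
rewrite leval_scale (_ : _ + _ = (leval d l *+ n - j t) *~ s) //.
by rewrite (elementaryN elj) (elementaryMz elj); zabel.
Qed.

Lemma dominates_intro : dominates K (theory G) p q.
Proof.
have [A0 [smA0 inv]] := qinv.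
have /choice[tw htw] := order_witness smA0 inv.
have /choice[sigma hsigma] : forall pr, exists f : N -> N, prime pr ->
    (forall x, kappa j d pr x -> kappa j c pr (f x)) /\
    (forall x y, kappa j d pr x -> kappa j d pr y -> f x = f y -> x = y).
  move=> pr; have [ppr|npr] := pselect (prime pr); last by exists id.
  by have [f hf] := card_le_inj (le_kappa ppr); exists f.
pose Q := {x : nat * N | prime x.1 /\ kappa j d x.1 x.2}.
have hullE (V : Type) (y : V -> N) b : hull (copair y j) b -> exists m l u, (0 < m)%N /\ b *+ m = leval y l + j u.
  move=> [m [f [m0 E]]]; have [l [l' hl]] := lin_sum f; have [El _] := hl _ y j.
  by exists m, l, (leval id l'); split=> //; rewrite E El (elementary_leval elj id l').
have /choice[bd hbd] : forall x : Q, exists z : nat * lin J * U,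
    (0 < z.1.1)%N /\ (sval x).2 *+ z.1.1 = leval d z.1.2 + j z.2.
  move=> [[pr b] [ppr kb]]; have [Bd _ _] := kappaP regG elj mN d ppr.
  by have [m [l [u h]]] := hullE _ _ _ (Bd _ kb); exists (m, l, u).
have /choice[bc hbc] : forall x : Q, exists z : nat * lin I * U,
    (0 < z.1.1)%N /\ sigma (sval x).1 (sval x).2 *+ z.1.1 = leval c z.1.2 + j z.2.
  move=> [[pr b] [ppr kb]]; have [Bd _ _] := kappaP regG elj mN c ppr.
  have [hs _] := hsigma pr ppr.
  by have [m [l [u h]]] := hullE _ _ _ (Bd _ (hs _ kb)); exists (m, l, u).
have smQ : small K [set: Q].
  apply: (small_inj (f := fun x : Q => ((sval x).1, (bd x).1))); last first.
    apply: small_prod => //; apply: small_prod => //; exact: small_lin.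
  move=> x x' [e1 e2]; have := hbd x; have := hbd x'; move: e1 e2.
  case: x x' => [[pr b] [ppr kb]] [[pr' b'] [ppr' kb']] /= epr; subst pr'; move=> <-.
  set m := (bd _).1.1; set l := (bd _).1.2; move=> [_ E'] [m0 E].
  have [Bd1 Bd2 _] := kappaP regG elj mN d ppr.
  have [eb|nb] := eqVneq b b'; first by subst b'; congr exist; exact: Prop_irrelevance.
  have [w _ hw] : range j (b - b').
    apply: (elementary_pure elj m0); eexists; last by rewrite mulrnBl E E' opprD addrACA subrr add0r -(elementaryB elj).
    by [].
  have := Bd2 [:: b; b'] (fun x => if x == b then 1 else - (1 : int)).
  rewrite /= !inE nb big_cons big_seq1 eqxx eq_sym (negPf nb) mulr1z mulrNz mulr1z -hw.
  move=> /(_ isT) h; exfalso.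
  have /h : [set` [:: b; b']] `<=` kappa j d pr by move=> x; rewrite /= !inE => /orP[/eqP->|/eqP->].
  move=> /(_ (mod_base_range _ _ _) b); rewrite !inE eqxx => /(_ isT).
  by rewrite dvdzE /= dvdn1 => /eqP p1; move: (prime_gt1 ppr); rewrite p1.
have /choice[sp hsp] : forall x : lin J * nat * nat, exists u : U, prime x.1.2 ->
   exists (s : seq (N * int)) g, (forall t, t \in s -> kappa j d x.1.2 t.1) /\
  leval d x.1.1 = \sum_(t <- s) t.1 *~ t.2 + j u + g *+ (x.1.2 ^ x.2).
  move=> [[l pr] i] /=; have [ppr|npr] := pselect (prime pr); last by exists 0.
  have [Bd1 _ Bd3] := kappaP regG elj mN d ppr.
  have hl : hull (copair d j) (leval d l).
    by have := hull_leval (copair d j) (lmap inl l); rewrite leval_map.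
  have [s [u [g [h1 _ h2]]]] := spanned_pow elj ppr Bd1 Bd3 i hl.
  by exists u => _; exists s, g.
pose A := A0 `|` (range (fun l => (tw l).1) `|` (range (fun l => (tw l).2) `|`
  (range (fun x => (bd x).2) `|` (range (fun x => (bc x).2) `|` range sp)))).
have smlin : small K [set: lin J] by exact: small_lin.
have smA : small K A.
  by do ! [apply: small_setU => //]; apply: small_range => //; do ! [apply: small_prod => //].
pose in_A u (h : A u) : A := exist _ u (mem_set h).
have A_t l : A (tw l).1 by right; left; exists l.
have A_u l : A (tw l).2 by right; right; left; exists l.
have A_d x : A (bd x).2 by right; right; right; left; exists x.
have A_c x : A (bc x).2 by right; right; right; right; left; exists x.
have A_s x : A (sp x) by right; right; right; right; right; exists x.
have gensM t s : A t -> range (gen_with (A := A0) (- (t *~ s))) `<=` gensA A.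
  move=> At x [l _ <-]; rewrite /gensA.
  have /choice[f hf] : forall v : A0 + unit, exists l : lin A, leval (val : A -> U) l = copair (val : A0 -> U) (fun=> - (t *~ s)) v.
    move=> [a|[]]; last by exists (lscale (- s) (lvar (in_A _ At))); rewrite leval_scale leval_var /= mulrNz.
    have Aa : A (val a) by left; exact/set_mem/(valP a).
    by exists (lvar (in_A _ Aa)); rewrite leval_var.
  suff [l' E] : exists l' : lin A, leval (val : A -> U) l' = gen_with (- (t *~ s)) l by exists l'.
  rewrite /gen_with; case: l => L k; elim: L => [|[v b] L [l' IH]].
    by exists (lscale k (lone _)); rewrite leval_scale leval_one /leval big_nil add0r.
  exists (ladd (lscale b (f v)) l'); rewrite leval_add leval_scale hf IH.
  by rewrite /leval big_cons /= addrA.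
have order_data : forall l : lin J, (exists t : A, leval d l = j (val t)) \/
    (exists n t s l1 u H, @cut_data U N j I J c d A n l t s l1 u H /\ (on_left j d n l t s \/ on_right j d n l t s)).
  move=> l; have [h|[n [s [l1 [H [n0 hs cH [f1 f2] lr]]]]]] := htw l.
    by left; exists (in_A _ (A_t l)).
  right; exists n, (in_A _ (A_t l)), s, l1, (in_A _ (A_u l)), H; split=> //.
  case: lr => lr; [left|right] => u /lr[t [n' [Et h1 h2 h3]]]; exists t, n'; split=> //; exact: gensM Et.
have basis_data pr b : prime pr -> kappa j d pr b -> exists m l u m' l' u', @cong_data U N j I J c d A sigma pr b m l u m' l' u'.
  move=> ppr kb; pose x : Q := exist _ (pr, b) (conj ppr kb).
  have [m0 E] := hbd x; have [m'0 E'] := hbc x.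
  by exists (bd x).1.1, (bd x).1.2, (in_A _ (A_d x)), (bc x).1.1, (bc x).1.2, (in_A _ (A_c x)).
have span_data l pr i : prime pr -> exists (s : seq (N * int)) (u : A) g,
    (forall t, t \in s -> kappa j d pr t.1) /\ leval d l = \sum_(t <- s) t.1 *~ t.2 + j (val u) + g *+ (pr ^ i).
  by move=> ppr; have [s [g h]] := hsp (l, pr, i) ppr; exists s, (in_A _ (A_s (l, pr, i))), g.
have sigma_basis pr b : prime pr -> kappa j d pr b -> kappa j c pr (sigma pr b) by move=> /hsigma[h _]; exact: h.
have sigma_inj pr : prime pr -> forall b b', kappa j d pr b -> kappa j d pr b' -> sigma pr b = sigma pr b' -> b = b'.
  by move=> /hsigma[].
have [r linkr cr] := lindenbaum (link_finsat regG elj mU satU pglobal qglobal cp dq smA span_data sigma_basis sigma_inj).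
exists A, r; split=> //.
- by move=> phi h; apply: linkr; left.
- by move=> phi h; apply: linkr; right; left.
move=> phi qphi M e mM he.
apply: (link_determines regG elj mU pglobal qglobal cp dq order_data basis_data span_data sigma_basis sigma_inj mM) => //.
  by move=> psi hpsi; apply: he; left; exists psi.
by move=> psi /linkr rpsi; apply: he; right; exists psi.
Qed.

End Domination.

Theorem theorem3p35 (G : oagType) (regG : regular_oag G)
    (K : Type) (U : oagType) (monU : monster K (theory G) U)
    (K' : Type) (N : oagType) (monN : monster K' (theory G) N)
    (bigN : small K' [set: U]) (j : U -> N) (elj : elementary j)
    (I J : Type) (smallI : small K [set: I]) (smallJ : small K [set: J])
    (p : set (formula (I + U))) (q : set (formula (J + U)))
    (pglobal : global_type p) (qglobal : global_type q)
    (pinv : invariant_type K p) (qinv : invariant_type K q)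
    (c : I -> N) (d : J -> N) (cp : realizes c j p) (dq : realizes d j q) :
  (dominates K (theory G) p q <->
     calH j d `<=` calH j c /\
     forall pr : nat, prime pr -> kappa j d pr #<= kappa j c pr)
  /\
  (calH j c = calH j d ->
   (forall pr : nat, prime pr -> kappa j c pr #= kappa j d pr) ->
   dom_equiv K (theory G) p q).
Proof.
have [mU K_nat K_lim satU _] := monU.
split; first split.
- move=> [A [r [smA cr rp _ rdom]]]; split.
    exact: (dom_calH regG K_nat K_lim elj mU satU smallI pglobal qglobal cp dq smA cr rp rdom).
  move=> pr ppr.
  exact: (dom_kappa regG K_nat K_lim elj mU satU smallI pglobal qglobal cp dq smA cr rp rdom ppr).
- move=> [hH hk].
  exact: (dominates_intro regG K_nat K_lim elj mU satU smallJ pglobal qglobal qinv cp dq hH hk).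
move=> eH ek; split.
  apply: (dominates_intro regG K_nat K_lim elj mU satU smallJ pglobal qglobal qinv cp dq); first by rewrite eH.
  by move=> pr /ek/card_eqPle[].
apply: (dominates_intro regG K_nat K_lim elj mU satU smallI qglobal pglobal pinv dq cp); first by rewrite eH.
by move=> pr /ek/card_eqPle[].
Qed.
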